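(* Given an RLSLP with $g_{rl}$ rules generating a string $S$, one can build, in $O(g_{rl})$ time, a locally balanced RLSLP generating $S$ with $O(g_{rl})$ rules.
   Context: A straight-line program (SLP) is a context-free grammar that generates exactly one string, with exactly one rule per nonterminal, each rule of the form $A\to a$ ($a$ a terminal) or $A\to BC$. A run-length SLP (RLSLP) additionally allows rules $A\to B^k$ for an integer $k>2$, meaning $\exp(A)=\exp(B)^k$, where $\exp(A)$ is the string $A$ expands to. Its size is its number of rules. In the parse tree, a node labeled $A$ with $A\to BC$ has children $B,C$, with $A\to B^k$ has $k$ children labeled $B$, and with $A\to a$ has one leaf child $a$. The height of $A$ is the height of the parse-tree subtree rooted at a node labeled $A$. An RLSLP is locally balanced if there is a constant $c$ such that every nonterminal $A$ has height at most $c\log|\exp(A)|$, where $\log x$ denotes $\max(1,\log_2 x)$. *)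

(* Defs.v *)
(* Stdlib world. *)
From Stdlib Require Import Reals List Arith.
Import ListNotations.
Set Implicit Arguments.

(** * Run-length straight-line programs *)

(* Terminals are integers, as the machine below handles them.  Nonterminals are
   the positions of their (unique) rules in the list [rules]. *)
Inductive rule : Type :=
| Term (a : nat)
| Pair (B C : nat)
| Run (B k : nat).

Record grammar : Type := Grammar { rules : list rule; start : nat }.

Definition size (G : grammar) : nat := length (rules G).

Inductive tree : Type :=
| Leaf (a : nat)
| Node (A : nat) (children : list tree).

Fixpoint yield (t : tree) : list nat :=
  match t with
  | Leaf a => [a]
  | Node _ ts => flat_map yield ts
  end.

Fixpoint height (t : tree) : nat :=
  match t with
  | Leaf _ => 0
  | Node _ ts => S (list_max (map height ts))
  end.

(* [parse G A t]: [t] is the parse tree of [A].  It is unique, since each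
   nonterminal has one rule; hence the equal subtrees in [parse_run]. *)
Inductive parse (G : grammar) : nat -> tree -> Prop :=
| parse_term A a :
    nth_error (rules G) A = Some (Term a) ->
    parse G A (Node A [Leaf a])
| parse_pair A B C t u :
    nth_error (rules G) A = Some (Pair B C) ->
    parse G B t -> parse G C u ->
    parse G A (Node A [t; u])
| parse_run A B k t :
    nth_error (rules G) A = Some (Run B k) ->
    parse G B t ->
    parse G A (Node A (repeat t k)).

Definition expands (G : grammar) (A : nat) (x : list nat) : Prop :=
  exists t, parse G A t /\ yield t = x.

(* The last clause says that exp(A) exists for every nonterminal; it excludes
   cyclic rules and references to missing nonterminals. *)
Definition rlslp (G : grammar) : Prop :=
  start G < size G /\
  (forall A B k, nth_error (rules G) A = Some (Run B k) -> 2 < k) /\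
  (forall A, A < size G -> exists x, expands G A x).

Definition generates (G : grammar) (x : list nat) : Prop :=
  expands G (start G) x.

Definition log (x : R) : R := Rmax 1 (ln x / ln 2).

(* The constant is a parameter: for a single grammar some constant always
   works, so the notion is only meaningful with [c] uniform in [G]. *)
Definition locally_balanced (c : R) (G : grammar) : Prop :=
  forall A t, parse G A t ->
    (INR (height t) <= c * log (INR (length (yield t))))%R.

(** * Word RAM *)

(* A machine with words of [w] bits, finitely many registers used by any given
   program, and a memory addressed by words.  Programs are structured, and each
   constant, register access, memory access, operation, test and assignment
   costs one unit of time. *)

Inductive binop : Type :=
| Add | Sub | Mul | Div | Mod | And | Or | Xor | Shl | Shr | Eq | Lt.

Inductive expr : Type :=
| Const (n : nat)
| Reg (x : nat)
| Read (e : expr)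
| Bin (o : binop) (e1 e2 : expr).

Inductive cmd : Type :=
| Skip
| Assign (x : nat) (e : expr)
| Store (e1 e2 : expr)
| Seq (c1 c2 : cmd)
| If (e : expr) (c1 c2 : cmd)
| While (e : expr) (c : cmd).

Record state : Type := State { reg : nat -> nat; mem : nat -> nat }.

Definition update (f : nat -> nat) (x v : nat) : nat -> nat :=
  fun y => if y =? x then v else f y.

(* Results are reduced modulo 2^w.  Division by zero follows [Nat.div] and
   [Nat.modulo]. *)
Definition eval_op (w : nat) (o : binop) (x y : nat) : nat :=
  (match o with
   | Add => x + y
   | Sub => x + 2 ^ w - y
   | Mul => x * y
   | Div => x / y
   | Mod => x mod y
   | And => Nat.land x y
   | Or => Nat.lor x y
   | Xor => Nat.lxor x y
   | Shl => Nat.shiftl x y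
   | Shr => Nat.shiftr x y
   | Eq => Nat.b2n (x =? y)
   | Lt => Nat.b2n (x <? y)
   end) mod 2 ^ w.

Fixpoint eval (w : nat) (s : state) (e : expr) : nat :=
  match e with
  | Const n => n mod 2 ^ w
  | Reg x => reg s x
  | Read e => mem s (eval w s e)
  | Bin o e1 e2 => eval_op w o (eval w s e1) (eval w s e2)
  end.

Fixpoint cost (e : expr) : nat :=
  match e with
  | Const _ => 1
  | Reg _ => 1
  | Read e => S (cost e)
  | Bin _ e1 e2 => S (cost e1 + cost e2)
  end.

(* [exec w c s t s']: started in [s], [c] halts in [s'] after time [t]. *)
Inductive exec (w : nat) : cmd -> state -> nat -> state -> Prop :=
| exec_skip s :
    exec w Skip s 1 s
| exec_assign x e s :
    exec w (Assign x e) s (S (cost e))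
      (State (update (reg s) x (eval w s e)) (mem s))
| exec_store e1 e2 s :
    exec w (Store e1 e2) s (S (cost e1 + cost e2))
      (State (reg s) (update (mem s) (eval w s e1) (eval w s e2)))
| exec_seq c1 c2 s1 s2 s3 t1 t2 :
    exec w c1 s1 t1 s2 -> exec w c2 s2 t2 s3 ->
    exec w (Seq c1 c2) s1 (t1 + t2) s3
| exec_if_true e c1 c2 s s' t :
    eval w s e <> 0 -> exec w c1 s t s' ->
    exec w (If e c1 c2) s (S (cost e + t)) s'
| exec_if_false e c1 c2 s s' t :
    eval w s e = 0 -> exec w c2 s t s' ->
    exec w (If e c1 c2) s (S (cost e + t)) s'
| exec_while_true e c s1 s2 s3 t1 t2 :
    eval w s1 e <> 0 -> exec w c s1 t1 s2 -> exec w (While e c) s2 t2 s3 ->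
    exec w (While e c) s1 (S (cost e + t1 + t2)) s3
| exec_while_false e c s :
    eval w s e = 0 ->
    exec w (While e c) s (S (cost e)) s.

Definition word_state (w : nat) (s : state) : Prop :=
  (forall x, reg s x < 2 ^ w) /\ (forall a, mem s a < 2 ^ w).

(** * Grammars in memory *)

Definition rule_at (s : state) (a : nat) (r : rule) : Prop :=
  match r with
  | Term b => mem s a = 0 /\ mem s (a + 1) = b /\ mem s (a + 2) = 0
  | Pair B C => mem s a = 1 /\ mem s (a + 1) = B /\ mem s (a + 2) = C
  | Run B k => mem s a = 2 /\ mem s (a + 1) = B /\ mem s (a + 2) = k
  end.

(* Register 0 holds the address of the table of rules, registers 1 and 2 the
   number of rules and the start nonterminal.  The bound keeps the table inside
   the 2^w addressable cells.  All other registers and cells are arbitrary. *)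
Definition stores (w : nat) (s : state) (G : grammar) : Prop :=
  reg s 0 + 3 * size G <= 2 ^ w /\
  reg s 1 = size G /\
  reg s 2 = start G /\
  (forall i r, nth_error (rules G) i = Some r -> rule_at s (reg s 0 + 3 * i) r).

(* Main.v *)
Require Import Defs.
From Stdlib Require Import Reals List Arith.
From Stdlib Require Import Lia Lra Sorted Permutation.
Import ListNotations.

(* Following the longer child from a nonterminal u leads to some r with a terminal
   or a run rule, and exp(u) = L exp(r) R, where L and R are products of the
   shorter children met on the way.  The links to longer children form a forest.
   It suffices to give each node u, at amortised constant cost, nonterminals for
   its L and R in which a letter x lies at depth O(log(|exp(u)| / |exp(x)|)): the
   heights of letters and their depths then telescope to O(log |exp(u)|), and r
   itself sits just below u.

   Climbing a path of the forest appends letters x to the word R (or L), each of at most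
   half the length of the current expansion.  The word is kept as a stack of units
   whose lengths grow geometrically towards the bottom: a new letter first absorbs
   the units shorter than four times what has been absorbed so far.  Products of
   blocks of entries [2^i, 2^(i+1)), nested towards either end, are stored along
   with the entries, so that the product of any sufficiently long upper part of the
   stack takes a constant number of new rules.  Where the forest branches, the
   highest branch inherits the stack; a branch of height e gets a copy of its lowest
   O(e) entries, with all the rest lumped into one unit.  The
   inheritance path that starts with such a copy has e + 1 nodes, and these paths
   are disjoint, so the copies cost linear time in total. *)

(** Every product formed on the way becomes an output nonterminal, so each must be balanced when it
    is created, not only the final contexts. Heights are compared with ten times [lam], itself about
    eight binary logarithms. A letter is at most half as long as its node, which frees 80 levels;
    the constants for boundedly many rules fit in. The true logarithm of an entry is not a usable
    measure: an entry shorter than its node may have the same [lam], and a lump is longer than its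
    lowest entry. Each entry therefore carries a surrogate [m], strictly below [lam] of the node and
    within a known slack of the truth. Two demands shape the stack. A pop must be a mere decrement,
    so whatever is stored with an entry may depend on lower entries only. Nodes are visited in
    search order, not path by path, so each inheritance path needs a memory region of its own, sized
    beforehand from its height. Lengths must fit into words. This is guaranteed only for
    nonterminals reachable from the start; the others get a placeholder rule. *)

(** * Expressions over arrays and their compilation to the word RAM *)

Inductive aexp : Type :=
| Cn (k : nat) | Sz | St | Vr (x : nat) | Ar (a : nat) (e : aexp)
| Pl (e1 e2 : aexp) | Mn (e1 e2 : aexp) | Tm (e1 e2 : aexp)
| Eqb (e1 e2 : aexp) | Ltb (e1 e2 : aexp).

(* Three arrays share a zone of [lim] records of three words.  With this layout
   the input table is the zone of the arrays 0, 1 and 2, and the output table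
   that of the arrays 3, 4 and 5. *)
Notation narrays := 30 (only parsing).

Record astate : Type := AState { tk : nat; vr : nat -> nat; ar : nat -> nat -> nat }.

Definition setv (h : astate) (x v : nat) : astate := AState (tk h) (update (vr h) x v) (ar h).

Definition seta (h : astate) (a i v : nat) : astate :=
  AState (tk h) (vr h) (fun a' => if a' =? a then update (ar h a) i v else ar h a').

Definition tick (h : astate) : astate := AState (S (tk h)) (vr h) (ar h).

(** The length of an array is known only at run time, so the zone offset is a multiple of register
    1. The program text thus depends on [cap] alone, which is a constant. *)
Definition cell (cap a : nat) (e : expr) : expr :=
  Bin Defs.Add (Bin Mul (Const 3) (Bin Defs.Add (Bin Mul (Const (cap * (a / 3))) (Reg 1)) e)) (Const (a mod 3)).

Fixpoint cx (cap : nat) (e : aexp) : expr :=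
  match e with
  | Cn k => Const k
  | Sz => Reg 1
  | St => Reg 2
  | Vr x => Reg (x + 3)
  | Ar a e => Read (cell cap a (cx cap e))
  | Pl e1 e2 => Bin Defs.Add (cx cap e1) (cx cap e2)
  | Mn e1 e2 => Bin Sub (cx cap e1) (cx cap e2)
  | Tm e1 e2 => Bin Mul (cx cap e1) (cx cap e2)
  | Eqb e1 e2 => Bin Eq (cx cap e1) (cx cap e2)
  | Ltb e1 e2 => Bin Lt (cx cap e1) (cx cap e2)
  end.

Definition asg cap x e := Assign (x + 3) (cx cap e).
Definition sto cap a e1 e2 := Store (cell cap a (cx cap e1)) (cx cap e2).
Definition ite cap e c1 c2 := If (cx cap e) c1 c2.
Definition whl cap e c := While (cx cap e) c.

(** A syntactic time bound for one traversal: both branches of a conditional are added, and a loop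
    body counts once, its repetitions being charged to ticks. *)
Fixpoint weight (c : cmd) : nat :=
  match c with
  | Skip => 1
  | Assign _ e => S (cost e)
  | Store e1 e2 => S (cost e1 + cost e2)
  | Seq c1 c2 => weight c1 + weight c2
  | If e c1 c2 => S (cost e + weight c1 + weight c2)
  | While e c => S (cost e + weight c)
  end.

(** * A program logic that counts loop iterations *)

Section Machine.
Variables w cap n st : nat.

Definition lim := cap * n.
Definition addr (a i : nat) : nat := 3 * (lim * (a / 3) + i) + a mod 3.

Fixpoint val (h : astate) (e : aexp) : nat :=
  match e with
  | Cn k => k
  | Sz => n
  | St => st
  | Vr x => vr h x
  | Ar a e => ar h a (val h e)
  | Pl e1 e2 => val h e1 + val h e2
  | Mn e1 e2 => val h e1 - val h e2
  | Tm e1 e2 => val h e1 * val h e2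
  | Eqb e1 e2 => Nat.b2n (val h e1 =? val h e2)
  | Ltb e1 e2 => Nat.b2n (val h e1 <? val h e2)
  end.

(** Excludes wrap-around and truncated subtraction, so that machine arithmetic modulo [2 ^ w] and
    arithmetic on the naturals agree. *)
Fixpoint ok (h : astate) (e : aexp) : Prop :=
  match e with
  | Cn k => k < 2 ^ w
  | Sz | St | Vr _ => True
  | Ar a e => ok h e /\ a < narrays /\ val h e < lim
  | Pl e1 e2 => ok h e1 /\ ok h e2 /\ val h e1 + val h e2 < 2 ^ w
  | Mn e1 e2 => ok h e1 /\ ok h e2 /\ val h e2 <= val h e1 < 2 ^ w
  | Tm e1 e2 => ok h e1 /\ ok h e2 /\ val h e1 * val h e2 < 2 ^ w
  | Eqb e1 e2 | Ltb e1 e2 => ok h e1 /\ ok h e2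
  end.

Definition rep (h : astate) (s : state) : Prop :=
  reg s 1 = n /\ reg s 2 = st /\ (forall x, reg s (x + 3) = vr h x) /\
  (forall a i, a < narrays -> i < lim -> mem s (addr a i) = ar h a i).

(* [tk] counts loop iterations.  Since [c] takes at most [weight c] time units
   between two iterations, bounding the running time means bounding [tk]. *)
Definition wp (c : cmd) (h : astate) (Q : astate -> Prop) : Prop :=
  forall s, rep h s -> exists t s' h' i,
    exec w c s t s' /\ t <= weight c * (1 + i) /\ rep h' s' /\ tk h' = tk h + i /\ Q h'.

(** The second bound keeps the thirty arrays addressable; together with the first it makes the small
    literals of the program words. *)
Definition fits : Prop := 1000 <= lim /\ 30 * lim <= 2 ^ w.
Hypothesis Hfits : fits.

Lemma addr_inj a i a' i' :
  i < lim -> i' < lim -> addr a i = addr a' i' -> a = a' /\ i = i'.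
Proof.
  unfold addr. intros Hi Hi' H.
  pose proof (Nat.mod_upper_bound a 3 ltac:(lia)).
  pose proof (Nat.mod_upper_bound a' 3 ltac:(lia)).
  pose proof (Nat.div_mod_eq a 3). pose proof (Nat.div_mod_eq a' 3).
  assert (E : lim * (a / 3) + i = lim * (a' / 3) + i') by lia.
  assert (a / 3 = a' / 3) by nia.
  split; [lia|nia].
Qed.

Lemma eval_cell h s a e i :
  rep h s -> a < narrays -> i < lim -> eval w s e = i ->
  eval w s (cell cap a e) = addr a i.
Proof.
  intros [Hn _] Ha Hi He. destruct Hfits as [Hbig mem_fits].
  pose proof (Nat.mod_upper_bound a 3 ltac:(lia)).
  pose proof (Nat.div_mod_eq a 3).
  assert (Hd : a / 3 <= 9) by lia.
  unfold lim in *.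
  clear Hfits. assert (0 < n) by nia. assert (0 < cap) by nia.
  assert (cap * n >= cap) by nia.
  assert (cap * n * (a / 3) <= cap * n * 9) by nia.
  assert (cap * (a / 3) <= cap * 9) by nia.
  cbn [cell eval]; unfold eval_op. rewrite Hn, He.
  rewrite (Nat.mod_small (cap * (a / 3))) by lia.
  rewrite (Nat.mod_small 3) by lia.
  rewrite (Nat.mod_small (a mod 3)) by lia.
  replace (cap * (a / 3) * n) with (cap * n * (a / 3)) by lia.
  rewrite (Nat.mod_small (cap * n * (a / 3))) by lia.
  rewrite (Nat.mod_small (cap * n * (a / 3) + i)) by lia.
  rewrite (Nat.mod_small (3 * _)) by lia.
  rewrite Nat.mod_small by lia. reflexivity.
Qed.

Lemma eval_cx h s e : rep h s -> ok h e -> eval w s (cx cap e) = val h e.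
Proof.
  intros Hr. pose proof Hr as (Hn & Hs & Hv & Hm). destruct Hfits as [Hbig mem_fits].
  induction e as [k| | |x|a e IH|e1 IH1 e2 IH2|e1 IH1 e2 IH2|e1 IH1 e2 IH2|e1 IH1 e2 IH2|e1 IH1 e2 IH2];
    cbn [ok val cx eval]; intros Hok; auto.
  - now apply Nat.mod_small.
  - destruct Hok as (He & Ha & Hi). rewrite (eval_cell h s a (cx cap e) (val h e)); auto.
  - destruct Hok as (H1 & H2 & H3). rewrite IH1, IH2 by auto. now apply Nat.mod_small.
  - destruct Hok as (H1 & H2 & H3). rewrite IH1, IH2 by auto. unfold eval_op.
    replace (val h e1 + 2 ^ w - val h e2) with (val h e1 - val h e2 + 1 * 2 ^ w) by lia.
    rewrite Nat.Div0.mod_add. apply Nat.mod_small. lia.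
  - destruct Hok as (H1 & H2 & H3). rewrite IH1, IH2 by auto. now apply Nat.mod_small.
  - destruct Hok as (H1 & H2). rewrite IH1, IH2 by auto. unfold eval_op.
    apply Nat.mod_small. destruct (_ =? _); cbn [Nat.b2n]; lia.
  - destruct Hok as (H1 & H2). rewrite IH1, IH2 by auto. unfold eval_op.
    apply Nat.mod_small. destruct (_ <? _); cbn [Nat.b2n]; lia.
Qed.

Lemma wp_conseq c h (Q Q' : astate -> Prop) :
  wp c h Q -> (forall h', Q h' -> Q' h') -> wp c h Q'.
Proof.
  intros Hw HQ s Hr. destruct (Hw s Hr) as (t & s' & h' & i & H1 & H2 & H3 & H4 & H5).
  exists t, s', h', i. auto 10.
Qed.

Lemma wp_skip h (Q : astate -> Prop) : Q h -> wp Skip h Q.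
Proof.
  intros HQ s Hr. exists 1, s, h, 0. repeat split; auto; try apply Hr; try constructor; cbn; lia.
Qed.

Lemma wp_asg x e h (Q : astate -> Prop) : ok h e -> Q (setv h x (val h e)) -> wp (asg cap x e) h Q.
Proof.
  intros Hok HQ s Hr. do 2 eexists. exists (setv h x (val h e)), 0.
  split; [constructor|]. split; [cbn [weight asg]; lia|].
  split; [|split; [cbn; lia|exact HQ]].
  rewrite (eval_cx h s e Hr Hok). destruct Hr as (H1 & H2 & H3 & H4).
  unfold rep, setv, update; cbn [reg mem vr ar].
  replace (1 =? x + 3) with false by (symmetry; apply Nat.eqb_neq; lia).
  replace (2 =? x + 3) with false by (symmetry; apply Nat.eqb_neq; lia).
  repeat split; auto. intros y.
  destruct (Nat.eqb_spec y x) as [->|Hn].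
  - now rewrite Nat.eqb_refl.
  - replace (y + 3 =? x + 3) with false by (symmetry; apply Nat.eqb_neq; lia). apply H3.
Qed.

Lemma wp_sto a e1 e2 h (Q : astate -> Prop) :
  ok h e1 -> ok h e2 -> a < narrays -> val h e1 < lim ->
  Q (seta h a (val h e1) (val h e2)) -> wp (sto cap a e1 e2) h Q.
Proof.
  intros H1 H2 Ha Hi HQ s Hr. do 2 eexists. exists (seta h a (val h e1) (val h e2)), 0.
  split; [constructor|]. split; [cbn [weight sto]; lia|].
  split; [|split; [cbn; lia|exact HQ]].
  rewrite (eval_cell h s a (cx cap e1) (val h e1)) by (auto using eval_cx).
  rewrite (eval_cx h s e2 Hr H2).
  destruct Hr as (R1 & R2 & R3 & R4). unfold rep, seta, update; cbn [reg mem vr ar].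
  repeat split; auto. intros a' i' Ha' Hi'.
  destruct (Nat.eqb_spec (addr a' i') (addr a (val h e1))) as [E|E].
  - apply addr_inj in E as [-> ->]; auto. now rewrite !Nat.eqb_refl.
  - destruct (Nat.eqb_spec a' a) as [->|]; [|auto].
    destruct (Nat.eqb_spec i' (val h e1)) as [->|]; [congruence|auto].
Qed.

Lemma wp_seq c1 c2 h Q : wp c1 h (fun h' => wp c2 h' Q) -> wp (Seq c1 c2) h Q.
Proof.
  intros Hw s Hr. destruct (Hw s Hr) as (t1 & s1 & h1 & i1 & E1 & T1 & R1 & K1 & W1).
  destruct (W1 s1 R1) as (t2 & s2 & h2 & i2 & E2 & T2 & R2 & K2 & HQ).
  exists (t1 + t2), s2, h2, (i1 + i2). split; [econstructor; eauto|].
  split; [cbn [weight]; nia|]. repeat split; try apply R2; auto; lia.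
Qed.

Lemma wp_ite e c1 c2 h Q :
  ok h e -> (val h e <> 0 -> wp c1 h Q) -> (val h e = 0 -> wp c2 h Q) -> wp (ite cap e c1 c2) h Q.
Proof.
  intros Hok H1 H2 s Hr. pose proof (eval_cx h s e Hr Hok) as He.
  destruct (Nat.eq_dec (val h e) 0) as [E|E].
  - destruct (H2 E s Hr) as (t & s' & h' & i & X & T & R).
    exists (S (cost (cx cap e) + t)), s', h', i. split; [apply exec_if_false; auto; congruence|].
    split; [cbn [weight ite]; nia|exact R].
  - destruct (H1 E s Hr) as (t & s' & h' & i & X & T & R).
    exists (S (cost (cx cap e) + t)), s', h', i. split; [apply exec_if_true; auto; congruence|].
    split; [cbn [weight ite]; nia|exact R].
Qed.

(* Termination comes for free from the bound [B] on the number of ticks. *)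
Lemma wp_whl (I : astate -> Prop) B e c h Q :
  I h ->
  (forall h, I h -> ok h e /\ tk h <= B) ->
  (forall h, I h -> val h e <> 0 -> wp c (tick h) I) ->
  (forall h, I h -> val h e = 0 -> Q h) ->
  wp (whl cap e c) h Q.
Proof.
  intros HI Hok Hbody HQ. remember (B - tk h) as d eqn:Hd. revert h HI Hd.
  induction d as [d IH] using lt_wf_ind. intros h HI Hd s Hr.
  destruct (Hok h HI) as [Ho Ht]. pose proof (eval_cx h s e Hr Ho) as He.
  destruct (Nat.eq_dec (val h e) 0) as [E|E].
  - exists (S (cost (cx cap e))), s, h, 0. split; [apply exec_while_false; congruence|].
    split; [cbn [weight whl]; lia|]. split; [auto|]. split; [lia|auto].
  - destruct (Hbody h HI E s Hr) as (t1 & s1 & h1 & i1 & E1 & T1 & R1 & K1 & I1).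
    cbn [tick tk] in K1. destruct (Hok h1 I1) as [_ Ht1].
    destruct (IH (B - tk h1) ltac:(lia) h1 I1 eq_refl s1 R1) as (t2 & s2 & h2 & i2 & E2 & T2 & R2 & K2 & Q2).
    exists (S (cost (cx cap e) + t1 + t2)), s2, h2, (1 + i1 + i2).
    split; [eapply exec_while_true; eauto; congruence|].
    split; [cbn [weight whl] in *; nia|].
    split; [auto|]. split; [lia|auto].
Qed.
End Machine.

(* The floor of 8 log2 s: fine enough to gain 2 from a factor 5/4. *)
Definition lam (s : nat) : nat := Nat.log2 (s ^ 8).

Lemma lam_le x y : x <= y -> lam x <= lam y.
Proof. intros H. apply Nat.log2_le_mono, Nat.pow_le_mono_l, H. Qed.

(** The condition [2 ^ m * q ^ 8 <= p ^ 8] says that the ratio [p / q] is worth at least [m] on the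
    scale of [lam]. Working with eighth powers avoids real logarithms. *)
Lemma lam_step p q m x y :
  2 ^ m * q ^ 8 <= p ^ 8 -> 0 < q -> 0 < x -> p * x <= q * y -> lam x + m <= lam y.
Proof.
  intros Hm Hq Hx H. unfold lam.
  assert (Hx8 : x ^ 8 <> 0) by (apply Nat.pow_nonzero; lia).
  rewrite Nat.add_comm, <- Nat.log2_mul_pow2 by lia.
  apply Nat.log2_le_mono.
  assert (Hp : p ^ 8 * x ^ 8 <= q ^ 8 * y ^ 8).
  { rewrite <- !Nat.pow_mul_l. now apply Nat.pow_le_mono_l. }
  assert (0 < q ^ 8) by (apply Nat.neq_0_lt_0, Nat.pow_nonzero; lia).
  apply (Nat.mul_le_mono_pos_l _ _ (q ^ 8)); [assumption|]. nia.
Qed.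

Lemma lam_double x y : 0 < x -> 2 * x <= y -> lam x + 8 <= lam y.
Proof. intros Hx H. apply (lam_step 2 1); cbn; lia. Qed.
Lemma lam_quad x y : 0 < x -> 4 * x <= y -> lam x + 16 <= lam y.
Proof. intros Hx H. apply (lam_step 4 1); cbn [Nat.pow Nat.mul]; lia. Qed.
(** The eighth power of 5/4 exceeds 4. This ratio arises when a unit is absorbed that is at most
    four times as long as what has been collected before. *)
Lemma lam_54 x y : 0 < x -> 5 * x <= 4 * y -> lam x + 2 <= lam y.
Proof.
  intros Hx H. apply (lam_step 5 4); try lia. apply Nat.leb_le. vm_compute. reflexivity.
Qed.
Lemma lam_double_le x y : y <= 2 * x -> lam y <= lam x + 8.
Proof.
  intros H. destruct (Nat.eq_dec x 0) as [->|Hx].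
  { replace y with 0 by lia. cbn. lia. }
  replace (lam x + 8) with (lam (2 * x)); [now apply lam_le|].
  unfold lam. rewrite Nat.pow_mul_l, (Nat.mul_comm (2 ^ 8)).
  rewrite Nat.log2_mul_pow2; try lia. apply Nat.neq_0_lt_0, Nat.pow_nonzero, Hx.
Qed.

(** * Powers of two and segments of a sequence *)

(** The first index of the block that contains [k]. Since [Nat.log2 0 = 0], also [pw 0 = 1], and the
    bottom entry of a stack is stored with this value. *)
Definition pw (k : nat) : nat := 2 ^ Nat.log2 k.

Lemma pw_spec k : 0 < k -> pw k <= k < 2 * pw k.
Proof. intros H. pose proof (Nat.log2_spec k H). unfold pw. cbn [Nat.pow] in *. lia. Qed.

Lemma pw_unique k b : 2 ^ b <= k < 2 * 2 ^ b -> pw k = 2 ^ b.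
Proof.
  intros H. unfold pw. f_equal. apply Nat.log2_unique; [lia|]. cbn [Nat.pow]. lia.
Qed.

Lemma pw_pos k : 0 < pw k.
Proof. apply Nat.neq_0_lt_0, Nat.pow_nonzero; lia. Qed.

(** Identifies the block just below that of [k]. That block is complete, so all its stored products
    are available. *)
Lemma pw_half k j : 2 <= pw k -> pw k <= 2 * j -> j < pw k -> pw j = pw k / 2 /\ pw k = 2 * (pw k / 2).
Proof.
  intros H2 Hj Hj'. unfold pw in *. destruct (Nat.log2 k) as [|b]; [cbn in H2; lia|].
  rewrite Nat.pow_succ_r' in *. rewrite (Nat.mul_comm 2 (2 ^ b)) in *.
  rewrite Nat.div_mul by lia. split; [|lia]. apply pw_unique. lia.
Qed.

(** Lets a push find its block from that of the previous entry by one comparison, without computing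
    a logarithm. *)
Lemma pw_succ k : pw (S k) = if 2 * pw k =? S k then S k else pw k.
Proof.
  destruct k as [|k]; [reflexivity|].
  pose proof (pw_spec (S k) ltac:(lia)) as H.
  destruct (Nat.eqb_spec (2 * pw (S k)) (S (S k))) as [E|E].
  - unfold pw at 1. unfold pw in E at 1.
    rewrite <- E. change (2 * 2 ^ Nat.log2 (S k)) with (2 ^ S (Nat.log2 (S k))).
    rewrite Nat.log2_pow2 by lia. reflexivity.
  - apply pw_unique. fold (pw (S k)). lia.
Qed.

Definition seg (l : nat -> list nat) (i j : nat) : list nat := flat_map l (seq i (j - i)).

Lemma seg_empty l i j : j <= i -> seg l i j = [].
Proof. intros H. unfold seg. now replace (j - i) with 0 by lia. Qed.

Lemma seg_one l i : seg l i (S i) = l i.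
Proof. unfold seg. replace (S i - i) with 1 by lia. cbn. apply app_nil_r. Qed.

Lemma seg_app l i j k : i <= j <= k -> seg l i j ++ seg l j k = seg l i k.
Proof.
  intros H. unfold seg. rewrite <- flat_map_app. f_equal.
  replace (k - i) with ((j - i) + (k - j)) by lia. rewrite seq_app.
  now replace (i + (j - i)) with j by lia.
Qed.

Lemma seg_head l i j : i < j -> seg l i j = l i ++ seg l (S i) j.
Proof. intros H. rewrite <- (seg_app l i (S i) j) by lia. now rewrite seg_one. Qed.

Lemma seg_last l i j : i <= j -> seg l i (S j) = seg l i j ++ l j.
Proof. intros H. rewrite <- (seg_app l i j (S j)) by lia. now rewrite seg_one. Qed.

Lemma seg_ext l l' i j : (forall x, i <= x < j -> l x = l' x) -> seg l i j = seg l' i j.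
Proof.
  intros H. unfold seg. rewrite !flat_map_concat_map. f_equal. apply map_ext_in.
  intros x Hx. apply in_seq in Hx. apply H. lia.
Qed.

(** * Registers and arrays *)

Notation rI := 0 (only parsing).
Notation rU := 1 (only parsing).
Notation rV := 2 (only parsing).
Notation rSp := 3 (only parsing).
Notation rM := 4 (only parsing).
Notation rNo := 5 (only parsing).
Notation rA := 6 (only parsing).
Notation rB := 7 (only parsing).
Notation rC := 8 (only parsing).
Notation rBs := 9 (only parsing).
Notation rK := 10 (only parsing).
Notation rX := 11 (only parsing).
Notation rZ := 12 (only parsing).
Notation rAcc := 13 (only parsing).
Notation rW := 14 (only parsing).
Notation rH := 15 (only parsing).
Notation rJ := 16 (only parsing).
Notation rQ := 17 (only parsing).
Notation rP := 18 (only parsing).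
Notation rN := 19 (only parsing).
Notation rBs' := 20 (only parsing).
Notation rK' := 21 (only parsing).

Notation aTag := 0 (only parsing).
Notation aFst := 1 (only parsing).
Notation aSnd := 2 (only parsing).
Notation oTag := 3 (only parsing).
Notation oFst := 4 (only parsing).
Notation oSnd := 5 (only parsing).
Notation aLen := 6 (only parsing).
Notation aOrd := 7 (only parsing).
Notation aStk := 8 (only parsing).
Notation aHv := 9 (only parsing).
Notation aLt := 10 (only parsing).
Notation aSd := 11 (only parsing).
Notation aEta := 12 (only parsing).
Notation aLng := 13 (only parsing).
Notation aHd := 14 (only parsing).
Notation aNxt := 15 (only parsing).
Notation aBas := 16 (only parsing).
Notation aKk := 17 (only parsing).
Notation aFull := 18 (only parsing).
Notation aRoot := 20 (only parsing).
(* The arrays [eX] to [eP] hold the stack entries, the others are indexed by nonterminals. *)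
Notation eX := 21 (only parsing).
Notation eS := 22 (only parsing).
Notation eT := 23 (only parsing).
Notation eL := 24 (only parsing).
Notation eR := 25 (only parsing).
Notation eP := 26 (only parsing).
(* Never read: [aEn] only gives the invariants a name for the end of a region. *)
Notation aEn := 27 (only parsing).

Declare Scope prog_scope.
Delimit Scope prog_scope with prog.
Bind Scope prog_scope with aexp.
Notation "# k" := (Cn k) (at level 1, format "# k") : prog_scope.
Notation "$ x" := (Vr x) (at level 1, format "$ x") : prog_scope.
Notation "a @ e" := (Ar a e) (at level 35, e at level 1) : prog_scope.
Infix "+" := Pl : prog_scope.
Infix "-" := Mn : prog_scope.
Infix "*" := Tm : prog_scope.
Infix "=?" := Eqb : prog_scope.
Infix "<?" := Ltb : prog_scope.
Notation "c1 ;; c2" := (Seq c1 c2) (at level 90, right associativity).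

(** * The program *)

Section Program.
Variable cap : nat.
Local Notation "x ::= e" := (asg cap x e%prog) (at level 80).
Local Notation "a ![ i ] ::= e" := (sto cap a i%prog e%prog) (at level 80, i at level 70).
Local Notation "'IF' e 'THEN' c1 'ELSE' c2 'FI'" := (ite cap e%prog c1 c2) (at level 85).
Local Notation "'WHILE' e 'DO' c 'OD'" := (whl cap e%prog c) (at level 85).

(* [d] is the side on which the letters of a stack are appended: the pass
   [d = true] treats the right context, [d = false] the left one, reversed. *)
Definition mul (d : bool) : cmd :=
  IF $rA =? #0 THEN rC ::= $rB ELSE
  IF $rB =? #0 THEN rC ::= $rA ELSE
    oTag ![$rNo] ::= #1;;
    oFst ![$rNo] ::= $(if d then rA else rB);;
    oSnd ![$rNo] ::= $(if d then rB else rA);;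
    rC ::= $rNo;;
    rNo ::= $rNo + #1
  FI FI.

(** Besides extending the product of its own block, position [k] of a block [[p, 2p)] extends by one
    entry the product that ends at [p - 1], downwards to [2p - 1 - k]. When the block is full, every
    product [i..p-1] with [i < p] has thus been stored, at position [2p - 1 - i], at the price of
    one rule per push. Only entries below [k] are read, so popping invalidates nothing. *)
Definition push (d : bool) : cmd :=
  eX ![$rBs + $rK] ::= $rX;;
  eS ![$rBs + $rK] ::= $rZ;;
  eT ![$rBs + $rK] ::= eT @ ($rBs + $rK - #1) + $rZ;;
  rP ::= eP @ ($rBs + $rK - #1);;
  rP ::= $rP + $rP * (#2 * $rP =? $rK);;
  eP ![$rBs + $rK] ::= $rP;;
  IF $rP =? $rK THEN
    eL ![$rBs + $rK] ::= $rX;;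
    eR ![$rBs + $rK] ::= eX @ ($rBs + $rK - #1)
  ELSE
    rA ::= eL @ ($rBs + $rK - #1);; rB ::= $rX;; mul d;;
    eL ![$rBs + $rK] ::= $rC;;
    rA ::= eX @ ($rBs + (#2 * $rP - #1 - $rK));;
    rB ::= eR @ ($rBs + $rK - #1);; mul d;;
    eR ![$rBs + $rK] ::= $rC
  FI.

(** With [p = pw k] and [g = p / 2], the range [i..k] splits into [i..g-1], [g..p-1] and [p..k]. The
    first product is stored at the mirror image [p - 1 - i] of [i], the second at the last entry of
    the block below, the third at the top. *)
Definition suffix (d : bool) : cmd :=
  rP ::= eP @ ($rBs + $rK);;
  rA ::= eL @ ($rBs + $rP - #1);; rB ::= eL @ ($rBs + $rK);; mul d;;
  rA ::= eR @ ($rBs + $rP - #1 - $rH);; rB ::= $rC;; mul d.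

(** The [+ 1] turns the strict test into [<=]. No test for an empty stack is needed: the bottom
    entry is stored with a length above four times that of any reachable nonterminal. *)
Definition letter (d : bool) : cmd :=
  rX ::= aLt @ $rU + #1;;
  rZ ::= aLen @ (aLt @ $rU);;
  rAcc ::= #0;;
  WHILE eS @ ($rBs + $rK) <? #4 * $rZ + #1 DO
    rA ::= eX @ ($rBs + $rK);; rB ::= $rAcc;; mul d;; rAcc ::= $rC;;
    rZ ::= $rZ + eS @ ($rBs + $rK);;
    rK ::= $rK - #1
  OD;;
  rA ::= $rAcc;; rB ::= $rX;; mul d;; rX ::= $rC;;
  rK ::= $rK + #1;;
  push d.

Definition copy : cmd :=
  rJ ::= #0;;
  WHILE $rJ <? $rN DO
    eX ![$rQ + $rJ] ::= eX @ ($rBs + $rJ);;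
    eS ![$rQ + $rJ] ::= eS @ ($rBs + $rJ);;
    eT ![$rQ + $rJ] ::= eT @ ($rBs + $rJ);;
    eL ![$rQ + $rJ] ::= eL @ ($rBs + $rJ);;
    eR ![$rQ + $rJ] ::= eR @ ($rBs + $rJ);;
    eP ![$rQ + $rJ] ::= eP @ ($rBs + $rJ);;
    rJ ::= $rJ + #1
  OD.

(** The threshold serves both cases. Below it the whole stack has at most [8 * rH] entries and can
    be copied; from it on, position [rH] is so far below the top block that [suffix] gives a
    balanced product. *)
Definition branch (d : bool) : cmd :=
  rQ ::= aBas @ $rW;;
  rH ::= aEta @ $rW + #1;;
  IF eP @ ($rBs + $rK) <? #4 * $rH THEN
    rN ::= $rK + #1;;
    copy;;
    aKk ![$rW] ::= $rK
  ELSE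
    rN ::= $rH;;
    copy;;
    suffix d;;
    rX ::= $rC;;
    rZ ::= eT @ ($rBs + $rK) - eT @ ($rBs + $rH - #1);;
    rBs' ::= $rBs;; rK' ::= $rK;;
    rBs ::= $rQ;; rK ::= $rH;;
    push d;;
    rBs ::= $rBs';; rK ::= $rK';;
    aKk ![$rW] ::= $rH
  FI.

(** The child that inherits is handed the stack in place, by its number of entries alone; the stack
    must stay untouched until that child is visited. *)
Definition children (d : bool) : cmd :=
  rW ::= aHd @ $rU;;
  WHILE $rW DO
    rW ::= $rW - #1;;
    IF aLng @ $rU =? $rW + #1 THEN aKk ![$rW] ::= $rK ELSE branch d FI;;
    rW ::= aNxt @ $rW
  OD.

Definition visit (d : bool) : cmd :=
  rBs ::= aBas @ $rU;;
  IF aSd @ $rU =? #2 THEN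
    rK ::= #0;;
    eX ![$rBs] ::= #0;; eS ![$rBs] ::= #4 * aLen @ St + #1;; eT ![$rBs] ::= #0;;
    eL ![$rBs] ::= #0;; eR ![$rBs] ::= #0;; eP ![$rBs] ::= #1
  ELSE
    rK ::= aKk @ $rU;;
    IF aSd @ $rU =? #(Nat.b2n d) THEN letter d ELSE Skip FI
  FI;;
  rH ::= #0;;
  suffix d;;
  (aFull + Nat.b2n d) ![$rU] ::= $rC;;
  children d.

(** A region of [16 * (eta + 1)] cells has room for the bottom entry, up to [8 * (eta + 1)] copied
    ones and one push at each of the [eta + 1] nodes of the path. The same number is put into [aKk]
    as a deposit of potential, which pays for the copying when a branch replaces it by the actual
    stack height. *)
Definition regions : cmd :=
  rI ::= #0;; rQ ::= #0;;
  WHILE $rI <? $rM DO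
    rU ::= aOrd @ $rI;;
    rV ::= aHv @ $rU;;
    IF aLng @ $rV =? $rU + #1 THEN
      aBas ![$rU] ::= aBas @ $rV;; aEn ![$rU] ::= aEn @ $rV;; aKk ![$rU] ::= #0
    ELSE
      aBas ![$rU] ::= $rQ;;
      aKk ![$rU] ::= #16 * (aEta @ $rU + #1);;
      rQ ::= $rQ + #16 * (aEta @ $rU + #1);;
      aEn ![$rU] ::= $rQ
    FI;;
    rI ::= $rI + #1
  OD.

Definition pass (d : bool) : cmd :=
  regions;;
  rI ::= #0;;
  WHILE $rI <? $rM DO
    rU ::= aOrd @ $rI;;
    visit d;;
    rI ::= $rI + #1
  OD.

(** The zeros in the output arrays are terminal rules: they remain the rules of nonterminal 0 and of
    the images of unreached nonterminals, which must expand to something as well. *)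
Definition clear : cmd :=
  oTag ![#0] ::= #0;; oFst ![#0] ::= #0;; oSnd ![#0] ::= #0;;
  rI ::= #0;;
  WHILE $rI <? Sz DO
    aLen ![$rI] ::= #0;; aEta ![$rI] ::= #0;; aLng ![$rI] ::= #0;; aHd ![$rI] ::= #0;;
    oTag ![$rI + #1] ::= #0;; oFst ![$rI + #1] ::= #0;; oSnd ![$rI + #1] ::= #0;;
    rI ::= $rI + #1
  OD.

Definition push_node (e : aexp) : cmd :=
  aStk ![$rSp] ::= e;; rSp ::= $rSp + #1.

Definition finish (e : aexp) : cmd :=
  aLen ![$rU] ::= e;; aOrd ![$rM] ::= $rU;; rM ::= $rM + #1;; rSp ::= $rSp - #1.

(** A length is written only when a nonterminal is finished, so 0 marks the unfinished ones.
    Starting from the start symbol alone keeps every computed length at most that of the generated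
    string. *)
Definition search : cmd :=
  aStk ![#0] ::= St;; rSp ::= #1;; rM ::= #0;;
  WHILE $rSp DO
    rU ::= aStk @ ($rSp - #1);;
    IF aTag @ $rU =? #0 THEN finish #1 ELSE
    rV ::= aFst @ $rU;;
    IF aLen @ $rV =? #0 THEN push_node $rV ELSE
    IF aTag @ $rU =? #2 THEN finish (aLen @ $rV * aSnd @ $rU) ELSE
    rW ::= aSnd @ $rU;;
    IF aLen @ $rW =? #0 THEN push_node $rW ELSE
    finish (aLen @ $rV + aLen @ $rW)
    FI FI FI FI
  OD.

(** The search order puts the longer child before its parent rule. Read backwards, it reaches a node
    after everything that hangs below it, so the height passed on is final. *)
Definition link_forest : cmd :=
  rI ::= $rM;;
  WHILE $rI DO
    rI ::= $rI - #1;;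
    rU ::= aOrd @ $rI;;
    IF aTag @ $rU =? #1 THEN
      IF aLen @ (aFst @ $rU) <? aLen @ (aSnd @ $rU) THEN
        rV ::= aSnd @ $rU;; aLt ![$rU] ::= aFst @ $rU;; aSd ![$rU] ::= #0
      ELSE
        rV ::= aFst @ $rU;; aLt ![$rU] ::= aSnd @ $rU;; aSd ![$rU] ::= #1
      FI;;
      aHv ![$rU] ::= $rV;;
      IF aEta @ $rV <? aEta @ $rU + #1 THEN
        aEta ![$rV] ::= aEta @ $rU + #1;; aLng ![$rV] ::= $rU + #1
      ELSE Skip FI;;
      aNxt ![$rU] ::= aHd @ $rV;; aHd ![$rV] ::= $rU + #1
    ELSE
      aHv ![$rU] ::= $rU;; aSd ![$rU] ::= #2
    FI
  OD.

Definition pair_rule (i : aexp) (r1 r2 : nat) : cmd :=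
  oTag ![i] ::= #1;; oFst ![i] ::= $r1;; oSnd ![i] ::= $r2.

(** Input nonterminals are shifted by one, as 0 denotes the empty word. The root comes from the node
    above, handled earlier, so that no path has to be followed. *)
Definition assemble : cmd :=
  rI ::= #0;;
  WHILE $rI <? $rM DO
    rU ::= aOrd @ $rI;;
    IF aSd @ $rU =? #2 THEN
      aRoot ![$rU] ::= $rU;;
      oTag ![$rU + #1] ::= aTag @ $rU;;
      oFst ![$rU + #1] ::= aFst @ $rU;;
      oSnd ![$rU + #1] ::= aSnd @ $rU;;
      IF aTag @ $rU =? #2 THEN oFst ![$rU + #1] ::= aFst @ $rU + #1 ELSE Skip FI
    ELSE
      aRoot ![$rU] ::= aRoot @ (aHv @ $rU);;
      rC ::= aRoot @ $rU + #1;;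
      rA ::= aFull @ $rU;;
      rB ::= (S aFull) @ $rU;;
      IF $rA =? #0 THEN pair_rule ($rU + #1)%prog rC rB ELSE
      IF $rB =? #0 THEN pair_rule ($rU + #1)%prog rA rC ELSE
        pair_rule $rNo rC rB;;
        pair_rule ($rU + #1)%prog rA rNo;;
        rNo ::= $rNo + #1
      FI FI
    FI;;
    rI ::= $rI + #1
  OD.

Definition core : cmd :=
  clear;; search;; link_forest;;
  rNo ::= Sz + #1;;
  pass false;; pass true;; assemble.

(* The output table is the zone of the arrays 3, 4 and 5. *)
Definition main : cmd :=
  Seq core
    (Assign 0 (Bin Mul (Const (3 * cap)) (Reg 1));;
     Assign 1 (Reg (rNo + 3));;
     Assign 2 (Bin Defs.Add (Reg 2) (Const 1))).
End Program.

(** * Frame conditions *)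

Ltac red1 := cbn [vr ar tk setv seta tick update val ok Nat.eqb Nat.b2n Nat.add Nat.div Nat.divmod fst snd].
Ltac red1in H := cbn [vr ar tk setv seta tick update val ok Nat.eqb Nat.b2n Nat.add] in H.

Ltac keep_tac :=
  let x := fresh "x" in let H := fresh "H" in
  intros x H; cbn [In] in H; red1; unfold update;
  repeat match goal with
  | |- context [x =? ?k] => destruct (Nat.eqb_spec x k); [subst x; exfalso; apply H; auto 20|]
  end; auto.

Ltac w_seq := apply wp_seq.
Ltac w_asg := eapply wp_asg; [eassumption| |].
Ltac w_sto := eapply wp_sto; [eassumption| | | | |].
Ltac w_ite := eapply wp_ite; [eassumption| | |].

(** Rules already issued are final, so derivations recorded earlier survive later commands. *)
Definition grows (h h' : astate) :=
  vr h rNo <= vr h' rNo /\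
  forall j, j < vr h rNo ->
    ar h' oTag j = ar h oTag j /\ ar h' oFst j = ar h oFst j /\ ar h' oSnd j = ar h oSnd j.

Definition keeps (rs as_ : list nat) (h h' : astate) :=
  (forall x, ~ In x rs -> vr h' x = vr h x) /\ (forall a, ~ In a as_ -> ar h' a = ar h a).

Lemma keeps_refl rs as_ h : keeps rs as_ h h.
Proof. split; auto. Qed.

Lemma keeps_trans rs as_ h1 h2 h3 : keeps rs as_ h1 h2 -> keeps rs as_ h2 h3 -> keeps rs as_ h1 h3.
Proof. intros [V1 A1] [V2 A2]. split; intros; [rewrite V2|rewrite A2]; auto. Qed.

Lemma keeps_incl rs rs' as_ as_' h1 h2 :
  incl rs rs' -> incl as_ as_' -> keeps rs as_ h1 h2 -> keeps rs' as_' h1 h2.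
Proof. intros Hr Ha [V A]. split; auto. Qed.

Lemma grows_refl h : grows h h.
Proof. split; auto. Qed.

Lemma grows_trans h1 h2 h3 : grows h1 h2 -> grows h2 h3 -> grows h1 h3.
Proof.
  intros [N1 G1] [N2 G2]. split; [lia|]. intros j Hj.
  destruct (G2 j ltac:(lia)) as (E1 & E2 & E3).
  rewrite E1, E2, E3. apply G1. lia.
Qed.

Lemma grows_same h h' :
  vr h' rNo = vr h rNo -> (forall a, a < 6 -> ar h' a = ar h a) -> grows h h'.
Proof. intros Hn Ha. split; [lia|]. intros j _. rewrite !Ha by lia. auto. Qed.

Ltac arr_tac :=
  red1; unfold update;
  repeat match goal with
  | |- context [?y =? ?k] => destruct (Nat.eqb_spec y k); try (exfalso; lia)
  end; auto; try congruence.

Ltac incl_tac := let x := fresh "x" in intros x; cbn [In]; tauto.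
Ltac keeps_tac := split; keep_tac.

Ltac grows_tac := apply grows_same; [reflexivity|intros ? ?; arr_tac].

(** The second values of [cst], [slack] and [gap] are those of a lump. [suffix] places it two levels
    above its lowest entry, hence 3 for 1. Its length is at most twice that of its lowest entry,
    which costs 8 in [lam], hence 9 for 1, and halves the ratio to the entry below, hence 2 for
    4. *)
Definition cst (eta j : nat) := if j <=? eta then 1 else 3.
Definition slack (eta j : nat) := if j <=? eta then 1 else 9.
Definition gap (eta j : nat) := if j <=? eta then 4 else 2.

Lemma cst_le eta j : 1 <= cst eta j <= 3.
Proof. unfold cst. destruct (_ <=? _); lia. Qed.
Lemma slack_le eta j : slack eta j <= 9.
Proof. unfold slack. destruct (_ <=? _); lia. Qed.
Lemma gap_ge eta j : 2 <= gap eta j <= 4.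
Proof. unfold gap. destruct (_ <=? _); lia. Qed.

Definition upd {T} (f : nat -> T) (k : nat) (v : T) : nat -> T := fun j => if j =? k then v else f j.

Lemma upd_same {T} (f : nat -> T) k v : upd f k v k = v.
Proof. unfold upd. now rewrite Nat.eqb_refl. Qed.
Lemma upd_other {T} (f : nat -> T) k v j : j <> k -> upd f k v j = f j.
Proof. intros H. unfold upd. destruct (Nat.eqb_spec j k); congruence. Qed.

Lemma list_sum_le_change (f g : nat -> nat) x l :
  NoDup l -> In x l -> (forall y, y <> x -> g y = f y) ->
  list_sum (map g l) + f x = list_sum (map f l) + g x.
Proof.
  induction l as [|y l IH]; [easy|]. intros Hn Hx Hfg. inversion_clear Hn as [|? ? Hy Hn'].
  assert (Hno : ~ In x l -> list_sum (map g l) = list_sum (map f l)).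
  { intros H. f_equal. apply map_ext_in. intros z Hz. apply Hfg. congruence. }
  unfold list_sum in *. cbn [map fold_right]. destruct Hx as [->|Hx].
  - specialize (Hno Hy). lia.
  - specialize (IH Hn' Hx Hfg). rewrite (Hfg y) by congruence. lia.
Qed.

(* A linked list whose links are shifted by one, [0] being the end. *)
Fixpoint linked (nxt : nat -> nat) (p : nat) (l : list nat) : Prop :=
  match l with
  | [] => p = 0
  | x :: l => p = S x /\ linked nxt (nxt x) l
  end.

Lemma list_sum_le (f g : nat -> nat) l :
  (forall x, In x l -> f x <= g x) -> list_sum (map f l) <= list_sum (map g l).
Proof.
  induction l as [|y l IH]; [reflexivity|]. intros H. unfold list_sum in *. cbn [map fold_right].
  specialize (H y (or_introl eq_refl)) as H1. specialize (IH ltac:(intros; apply H; cbn; auto)). lia.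
Qed.

Lemma list_sum_lt (f g : nat -> nat) l y :
  In y l -> (forall x, In x l -> f x <= g x) ->
  list_sum (map f l) + (g y - f y) <= list_sum (map g l).
Proof.
  induction l as [|z l IH]; [easy|]. intros Hy H. unfold list_sum in *. cbn [map fold_right].
  specialize (H z (or_introl eq_refl)) as H1.
  pose proof (list_sum_le f g l ltac:(intros; apply H; cbn; auto)) as H2. unfold list_sum in H2.
  destruct Hy as [->|Hy]; [lia|]. specialize (IH Hy ltac:(intros; apply H; cbn; auto)). lia.
Qed.

Lemma list_sum_app' (f : nat -> nat) l l' :
  list_sum (map f (l ++ l')) = list_sum (map f l) + list_sum (map f l').
Proof. now rewrite map_app, list_sum_app. Qed.

Lemma NoDup_length_le n l : NoDup l -> (forall x, In x l -> x < n) -> length l <= n.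
Proof.
  intros Hn Hl. rewrite <- (length_seq n 0). apply NoDup_incl_length; [exact Hn|].
  intros x Hx. apply in_seq. apply Hl in Hx. lia.
Qed.

Definition rule_in (h : astate) (i : nat) (r : rule) : Prop :=
  match r with
  | Term a => ar h aTag i = 0 /\ ar h aFst i = a /\ ar h aSnd i = 0
  | Pair b c => ar h aTag i = 1 /\ ar h aFst i = b /\ ar h aSnd i = c
  | Run b k => ar h aTag i = 2 /\ ar h aFst i = b /\ ar h aSnd i = k
  end.

(** * Derivations, stacks and the routines on them *)

Section Routines.
Variables w cap n st : nat.
Variable ln : nat -> nat.
Variable zmax : nat.
Notation huge := (4 * zmax + 1).
Notation lim := (lim cap n).
Notation wp := (wp w cap n st).

Definition sz (l : list nat) : nat := list_sum (map ln l).
(** The height granted in advance to the image of an input nonterminal. Contexts are built and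
    measured on this assumption; it is confirmed at the end by induction on lengths, since letters
    are shorter than their nodes. *)
Definition bd (A : nat) : nat := 10 * lam (ln A) + 10.
(** Nesting inside a block adds up to [j - pw j] levels. Since [m] drops by 7 per entry, this is
    less than [lam] of the longest entry involved; the eleventh [lam] absorbs it. *)
Definition gd (s : nat) : nat := 11 * lam s + 16.

Lemma sz_app x y : sz (x ++ y) = sz x + sz y.
Proof. unfold sz. now rewrite map_app, list_sum_app. Qed.

(* The rules [K], [B], [C] let [id] derive the word [x] of input nonterminals,
   reversed if [d = false], with height [hx]. *)
Inductive un (d : bool) (K B C : nat -> nat) : nat -> list nat -> nat -> Prop :=
| un_leaf A : A < n -> 0 < ln A -> un d K B C (S A) [A] (bd A)
| un_pair id x y hx hy :
    n < id -> K id = 1 ->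
    (if d then B id else C id) < id -> (if d then C id else B id) < id ->
    un d K B C (if d then B id else C id) x hx ->
    un d K B C (if d then C id else B id) y hy ->
    un d K B C id (x ++ y) (S (Nat.max hx hy)).

Lemma un_pos d K B C id x hx : un d K B C id x hx -> 0 < id.
Proof. destruct 1; lia. Qed.

Lemma un_nonempty d K B C id x hx : un d K B C id x hx -> x <> [].
Proof. induction 1; [discriminate|]. destruct x; [congruence|discriminate]. Qed.

(** Images of input nonterminals are leaves of a derivation, so only rules above [n] have to
    persist. The descending indices in [un] confine them to those below [N]. *)
Lemma un_ext N d K B C K' B' C' id x hx :
  (forall j, n < j < N -> K' j = K j /\ B' j = B j /\ C' j = C j) ->
  un d K B C id x hx -> id < N -> un d K' B' C' id x hx.
Proof.
  intros He. induction 1 as [A HA HA'|id x y hx hy H1 H2 H3 H4 H5 IH5 H6 IH6]; intros Hid.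
  - now constructor.
  - destruct (He id ltac:(lia)) as (E1 & E2 & E3).
    specialize (IH5 ltac:(lia)). specialize (IH6 ltac:(lia)).
    rewrite <- E2, <- E3 in *. rewrite <- E1 in H2. now constructor.
Qed.

(* The nonterminal [0] stands for the empty word. *)
Definition unit_le d (h : astate) id x b :=
  (id = 0 /\ x = []) \/
  exists hx, hx <= b /\ un d (ar h oTag) (ar h oFst) (ar h oSnd) id x hx /\ id < vr h rNo.

(** Local balance concerns auxiliary nonterminals too, even those that no later rule uses. The side
    [d] may differ from rule to rule, as the two passes share one numbering. *)
Definition good (h : astate) :=
  n < vr h rNo /\
  forall id, n < id < vr h rNo -> exists d x hx,
    un d (ar h oTag) (ar h oFst) (ar h oSnd) id x hx /\ hx <= gd (sz x).

Lemma unit_le_mono d h h' id x b b' : grows h h' -> b <= b' -> unit_le d h id x b -> unit_le d h' id x b'.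
Proof.
  intros [Hn Hg] Hb [H|(hx & H1 & H2 & H3)]; [now left|right].
  exists hx. split; [lia|]. split; [|lia].
  apply (un_ext (vr h rNo) d (ar h oTag) (ar h oFst) (ar h oSnd)); auto. intros j Hj. apply Hg. lia.
Qed.

Lemma unit_le_eq d h h' id id' x b b' :
  grows h h' -> id' = id -> b <= b' -> unit_le d h id x b -> unit_le d h' id' x b'.
Proof. intros Hg ->. now apply unit_le_mono. Qed.

Lemma good_same h h' :
  vr h' rNo = vr h rNo -> (forall a, a < 6 -> ar h' a = ar h a) -> good h -> good h'.
Proof. intros Hn Ha Hg. unfold good. rewrite Hn, !Ha by lia. exact Hg. Qed.

(* Entry [j] of a stack is a unit [eX] deriving [l j].  [eL] and [eR] are the
   products of the entries [pw j..j] and of their mirror images [2 pw j - 1 - j..pw j - 1],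
   nested so that entry [i] lies at depth O(i), which its height allows: [m] drops by 7 per entry.
   A copy of the stack for a branch of height [eta] may lump entries above
   position [eta]; these satisfy weaker bounds and are never lumped again. *)
Set Implicit Arguments.
Record level d (h : astate) b eta la (l : nat -> list nat) (m : nat -> nat) j : Prop := Level {
  lv_X : unit_le d h (ar h eX (b + j)) (l j) (10 * m j + 10 + cst eta j);
  lv_S : ar h eS (b + j) = sz (l j);
  lv_pos : 0 < sz (l j);
  lv_T : ar h eT (b + j) = sz (seg l 0 (S j));
  lv_P : ar h eP (b + j) = pw j;
  lv_L : unit_le d h (ar h eL (b + j)) (seg l (pw j) (S j)) (10 * m (pw j) + 13 + (j - pw j));
  lv_R : unit_le d h (ar h eR (b + j)) (seg l (2 * pw j - 1 - j) (pw j))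
           (10 * m (Nat.max 1 (2 * pw j - 1 - j)) + 11 + cst eta (Nat.max 1 (2 * pw j - 1 - j)));
  lv_m : m j <= lam (sz (l j)) <= m j + slack eta j;
  lv_la : m j < la;
  lv_gap : 2 <= j -> m j + 7 <= m (j - 1) /\ gap eta j * sz (l j) <= sz (l (j - 1)) }.
Unset Implicit Arguments.

(** Position 0 holds the empty word. It starts the prefix sums and the mirrored products, and its
    fictitious length [huge] stops the absorption. *)
Definition stack d h b k eta la l m : Prop :=
  (l 0 = [] /\ ar h eX b = 0 /\ ar h eS b = huge /\ ar h eT b = 0 /\
   ar h eL b = 0 /\ ar h eR b = 0 /\ ar h eP b = 1) /\
  forall j, 1 <= j <= k -> level d h b eta la l m j.

Lemma stack_m d h b k eta la l m i j :
  stack d h b k eta la l m -> 1 <= i <= j -> j <= k -> m j + 7 * (j - i) <= m i.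
Proof.
  intros [_ Hs] Hi Hj. induction j as [|j IH]; [lia|].
  destruct (Nat.eq_dec i (S j)) as [->|Hne]; [lia|].
  destruct (lv_gap (Hs (S j) ltac:(lia)) ltac:(lia)) as [Hm _].
  replace (S j - 1) with j in Hm by lia. specialize (IH ltac:(lia) ltac:(lia)). lia.
Qed.

Lemma stack_pop d h b k k' eta la l m :
  k' <= k -> stack d h b k eta la l m -> stack d h b k' eta la l m.
Proof. intros Hk [H0 Hs]. split; [exact H0|]. intros j Hj. apply Hs. lia. Qed.

(** Away from the root, the remaining height [eta] shrinks and the length of the node grows; both
    changes only relax the bounds. *)
Lemma stack_weaken d h b k eta eta' la la' l m :
  eta' <= eta -> la <= la' -> stack d h b k eta la l m -> stack d h b k eta' la' l m.
Proof.
  intros He Hl [H0 Hs]. split; [exact H0|]. intros j Hj.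
  assert (Hc : forall i, cst eta i <= cst eta' i).
  { intros i. unfold cst. destruct (Nat.leb_spec i eta), (Nat.leb_spec i eta'); lia. }
  destruct (Hs j Hj) as [E1 E2 E3 E4 E5 E6 E7 E8 E9 E10].
  constructor; auto; try lia.
  - eapply unit_le_mono; [apply grows_refl| |exact E1]. specialize (Hc j). lia.
  - eapply unit_le_mono; [apply grows_refl| |exact E7]. apply Nat.add_le_mono_l, Hc.
  - split; [lia|]. unfold slack in *. destruct (Nat.leb_spec j eta), (Nat.leb_spec j eta'); lia.
  - intros H2. destruct (E10 H2) as [? Hg]. split; [lia|]. unfold gap in *.
    destruct (Nat.leb_spec j eta), (Nat.leb_spec j eta'); lia.
Qed.

Lemma stack_move d h h' b b' k eta la l l' m m' :
  grows h h' ->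
  (forall a j, eX <= a <= eP -> j <= k -> ar h' a (b' + j) = ar h a (b + j)) ->
  (forall j, j <= k -> l' j = l j /\ m' j = m j) ->
  stack d h b k eta la l m -> stack d h' b' k eta la l' m'.
Proof.
  intros Hg Ha Hlm [H0 Hs].
  assert (Ha0 : forall a, 21 <= a <= 26 -> ar h' a b' = ar h a b).
  { intros a Hr. specialize (Ha a 0 Hr ltac:(lia)). now rewrite !Nat.add_0_r in Ha. }
  split.
  - rewrite !Ha0 by lia. destruct (Hlm 0 ltac:(lia)) as [-> _]. exact H0.
  - intros j Hj. destruct (Hs j Hj) as [E1 E2 E3 E4 E5 E6 E7 E8 E9 E10].
    pose proof (pw_spec j ltac:(lia)) as Hp. pose proof (pw_pos j).
    assert (Hseg : forall i i', i' <= S k -> seg l' i i' = seg l i i').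
    { intros i i' Hi. apply seg_ext. intros x Hx. apply Hlm. lia. }
    destruct (Hlm j ltac:(lia)) as [El Em].
    constructor; rewrite ?Ha, ?Hseg, ?El, ?Em by lia; auto.
    + eapply unit_le_mono; eauto.
    + destruct (Hlm (pw j) ltac:(lia)) as [_ ->]. eapply unit_le_mono; eauto.
    + destruct (Hlm (Nat.max 1 (2 * pw j - 1 - j)) ltac:(lia)) as [_ ->]. eapply unit_le_mono; eauto.
    + intros H2. destruct (Hlm (j - 1) ltac:(lia)) as [-> ->]. auto.
Qed.

Lemma stack_push d h b k eta la l m :
  stack d h b k eta la l m -> level d h b eta la l m (S k) -> stack d h b (S k) eta la l m.
Proof.
  intros [H0 Hs] Hl. split; [exact H0|]. intros j Hj.
  destruct (Nat.eq_dec j (S k)) as [->|]; [exact Hl|apply Hs; lia].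
Qed.

Hypothesis Hfits : fits w cap n.
Hypothesis Hzmax : huge < 2 ^ w.
Hypothesis Hcap : 200 * n + 200 <= lim.

(** A rule is created only if both factors are nonempty. Hence the strict increase of the height and
    the balance of the product are required only in that case. *)
Lemma wp_mul d h x y b1 b2 b (Q : astate -> Prop) :
  good h -> vr h rNo < lim ->
  unit_le d h (vr h rA) x b1 -> unit_le d h (vr h rB) y b2 ->
  b1 <= b -> b2 <= b -> (x <> [] -> y <> [] -> b1 < b /\ b2 < b <= gd (sz (x ++ y))) ->
  (forall h', grows h h' -> good h' -> tk h' = tk h -> vr h' rNo <= S (vr h rNo) ->
     keeps [rC; rNo] [oTag; oFst; oSnd] h h' -> unit_le d h' (vr h' rC) (x ++ y) b -> Q h') ->
  wp (mul cap d) h Q.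
Proof.
  intros Hg Hno Hx Hy H1 H2 Hb HQ. pose proof Hfits as [Hbig Hw].
  unfold mul. w_ite; [red1; lia| |].
  - red1. intros E. destruct (Nat.eqb_spec (vr h rA) 0) as [E0|]; [|cbn in E; lia].
    destruct Hx as [[_ ->]|(hx & _ & Hu & _)]; [|apply un_pos in Hu; lia].
    w_asg; [red1; auto|]. apply HQ.
    + apply grows_same; reflexivity.
    + eapply good_same; [| |exact Hg]; reflexivity.
    + reflexivity.
    + red1; lia.
    + split; keep_tac.
    + red1. eapply unit_le_mono; [apply grows_same; reflexivity| |exact Hy]; lia.
  - red1. intros E. destruct (Nat.eqb_spec (vr h rA) 0) as [|E0]; [discriminate|].
    destruct Hx as [[? _]|(hx & Hhx & Hux & Hix)]; [lia|].
    w_ite; [red1; lia| |].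
    + red1. intros E'. destruct (Nat.eqb_spec (vr h rB) 0) as [E1|]; [|cbn in E'; lia].
      destruct Hy as [[_ ->]|(hy & _ & Hu & _)]; [|apply un_pos in Hu; lia].
      w_asg; [red1; auto|]. apply HQ.
      * apply grows_same; reflexivity.
      * eapply good_same; [| |exact Hg]; reflexivity.
      * reflexivity.
      * red1; lia.
      * split; keep_tac.
      * red1. rewrite app_nil_r. eapply unit_le_mono; [apply grows_same; reflexivity|reflexivity|right; exists hx]. repeat split; auto; lia.
    + red1. intros E'. destruct (Nat.eqb_spec (vr h rB) 0) as [|E1]; [discriminate|].
      destruct Hy as [[? _]|(hy & Hhy & Huy & Hiy)]; [lia|].
      w_seq; w_sto; red1; try lia.
      w_seq; w_sto; red1; try lia.
      w_seq; w_sto; red1; try lia.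
      w_seq; w_asg; red1; try lia.
      w_asg; red1; try lia.
      assert (G : forall h', vr h' rNo = S (vr h rNo) ->
         ar h' oTag = update (ar h oTag) (vr h rNo) 1 ->
         ar h' oFst = update (ar h oFst) (vr h rNo) (vr h (if d then rA else rB)) ->
         ar h' oSnd = update (ar h oSnd) (vr h rNo) (vr h (if d then rB else rA)) ->
         grows h h' /\ unit_le d h' (vr h rNo) (x ++ y) b /\ good h').
      { intros h' En Et Ef Es. destruct Hg as [Hn Hg].
        assert (Hne1 : x <> []) by (eapply un_nonempty; eauto).
        assert (Hne2 : y <> []) by (eapply un_nonempty; eauto).
        specialize (Hb Hne1 Hne2).
        assert (Hgr : grows h h').
        { split; [lia|]. intros j Hj. rewrite Et, Ef, Es. unfold update.
          destruct (Nat.eqb_spec j (vr h rNo)); [lia|auto]. }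
        assert (Hu : un d (ar h' oTag) (ar h' oFst) (ar h' oSnd) (vr h rNo) (x ++ y) (S (Nat.max hx hy))).
        { assert (Hext : forall j, n < j < vr h rNo ->
            ar h' oTag j = ar h oTag j /\ ar h' oFst j = ar h oFst j /\ ar h' oSnd j = ar h oSnd j).
          { intros j Hj. apply Hgr. lia. }
          apply un_pair; rewrite ?Et, ?Ef, ?Es; unfold update; rewrite ?Nat.eqb_refl; auto.
          - destruct d; exact Hix.
          - destruct d; exact Hiy.
          - replace (if d then vr h (if d then rA else rB) else vr h (if d then rB else rA))
              with (vr h rA) by (now destruct d).
            eapply un_ext in Hux; [| exact Hext|exact Hix]. rewrite Et, Ef, Es in Hux. exact Hux.
          - replace (if d then vr h (if d then rB else rA) else vr h (if d then rA else rB))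
              with (vr h rB) by (now destruct d).
            eapply un_ext in Huy; [| exact Hext|exact Hiy]. rewrite Et, Ef, Es in Huy. exact Huy. }
        split; [exact Hgr|]. split.
        - right. exists (S (Nat.max hx hy)). split; [lia|]. split; [exact Hu|lia].
        - split; [lia|]. intros id Hid. destruct (Nat.eq_dec id (vr h rNo)) as [->|Hne].
          + exists d, (x ++ y), (S (Nat.max hx hy)). split; [exact Hu|].
            lia.
          + destruct (Hg id ltac:(lia)) as (d' & z & hz & Hz & Hz').
            exists d', z, hz. split; [|exact Hz'].
            apply (un_ext (vr h rNo) d' (ar h oTag) (ar h oFst) (ar h oSnd)); auto; [|lia].
            intros j Hj. apply Hgr. lia. }
      match goal with |- Q ?h' =>
        destruct (G h') as (G1 & G2 & G3);
          [red1; lia|reflexivity|red1; destruct d; reflexivity|red1; destruct d; reflexivity|]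
      end.
      apply HQ; auto.
      * red1. lia.
      * split; keep_tac.
Qed.

(** In the product of the own block the older entries sink by one level, which the term [j - pw j]
    counts. In the mirrored product the new outermost entry [i] dominates: the rest starts at
    [i + 1], where [m] is smaller by 7, so its bound is about 70 lower and the bound needs no depth
    term. *)
Lemma wp_push d h b k eta la l m x mx (Q : astate -> Prop) :
  good h -> vr h rBs = b -> vr h rK = S k -> stack d h b k eta la l m ->
  unit_le d h (vr h rX) x (10 * mx + 10 + cst eta (S k)) ->
  vr h rZ = sz x -> 0 < sz x -> mx <= lam (sz x) <= mx + slack eta (S k) -> mx < la ->
  (1 <= k -> mx + 7 <= m k /\ gap eta (S k) * sz x <= sz (l k)) ->
  b + S k < lim -> vr h rNo + 2 < lim -> sz (seg l 0 (S k)) + sz x < 2 ^ w ->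
  (forall h', stack d h' b (S k) eta la (upd l (S k) x) (upd m (S k) mx) ->
     grows h h' -> good h' -> tk h' = tk h -> vr h' rNo <= vr h rNo + 2 ->
     keeps [rNo; rA; rB; rC; rP] [oTag; oFst; oSnd; eX; eS; eT; eL; eR; eP] h h' ->
     (forall a i, eX <= a <= eP -> i <> b + S k -> ar h' a i = ar h a i) -> Q h') ->
  wp (push cap d) h Q.
Proof.
  intros Hg Hb Hk Hst Hx Hz Hz0 Hm Hla Hgap Hlim Hno Hsz HQ.
  pose proof Hfits as [Hbig Hw].
  pose proof (cst_le eta (S k)) as Hcst.
  set (l' := upd l (S k) x). set (m' := upd m (S k) mx).
  assert (Hl' : forall j, j <= k -> l' j = l j /\ m' j = m j).
  { intros j Hj. unfold l', m'. now rewrite !upd_other by lia. }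
  assert (HlS : l' (S k) = x) by apply upd_same.
  assert (HmS : m' (S k) = mx) by apply upd_same.
  assert (Hseg : forall i j, j <= S k -> seg l' i j = seg l i j).
  { intros i j Hj. apply seg_ext. intros y Hy. apply Hl'. lia. }
  assert (HsegS : forall i, i <= S k -> seg l' i (S (S k)) = seg l i (S k) ++ x).
  { intros i Hi. rewrite seg_last, HlS, Hseg by lia. reflexivity. }
  assert (HT : ar h eT (b + k) = sz (seg l 0 (S k))).
  { destruct k as [|k'].
    - destruct Hst as [(E0 & _ & _ & E3 & _) _]. rewrite Nat.add_0_r, E3, seg_one, E0. reflexivity.
    - destruct Hst as [_ Hs]. apply (lv_T (Hs (S k') ltac:(lia))). }
  assert (HP : ar h eP (b + k) = pw k).
  { destruct k as [|k'].
    - destruct Hst as [(_ & _ & _ & _ & _ & _ & E) _]. now rewrite Nat.add_0_r.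
    - destruct Hst as [_ Hs]. apply (lv_P (Hs (S k') ltac:(lia))). }
  pose proof (pw_spec (S k) ltac:(lia)) as HpS. pose proof (pw_pos k) as Hpk.
  assert (Hpk' : pw k <= S k) by (destruct k; [cbn; lia|pose proof (pw_spec (S k) ltac:(lia)); lia]).
  assert (Hbk : b + S k - 1 = b + k) by lia.
  unfold push.
  w_seq; w_sto; red1; rewrite ?Hb, ?Hk; try lia.
  w_seq; w_sto; red1; rewrite ?Hb, ?Hk; try lia.
  w_seq; w_sto; red1; rewrite ?Hb, ?Hk, ?Hbk, ?HT, ?Hz; try lia.
  w_seq; w_asg; red1; rewrite ?Hb, ?Hk, ?Hbk; try lia.
  w_seq.
  assert (Hp' : pw k + pw k * Nat.b2n (2 * pw k =? S k) = pw (S k)).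
  { rewrite (pw_succ k). destruct (Nat.eqb_spec (2 * pw k) (S k)); cbn [Nat.b2n]; lia. }
  w_asg; red1; rewrite ?Hb, ?Hk, ?HP, ?Hp'; try lia.
  w_seq; w_sto; red1; rewrite ?Hb, ?Hk; try lia.
  assert (H0 : ar h eX b = 0 /\ ar h eL b = 0 /\ ar h eR b = 0 /\ l 0 = []) by (destruct Hst as [H0 _]; tauto).
  assert (Hlev : forall j, 1 <= j <= k -> level d h b eta la l m j) by apply Hst.
  (* Common end of both branches: the stack invariant follows from what is stored at position [S k]
     and from the frame. *)
  assert (Fin : forall h', grows h h' -> good h' -> tk h' = tk h -> vr h' rNo <= vr h rNo + 2 ->
     keeps [rNo; rA; rB; rC; rP] [oTag; oFst; oSnd; eX; eS; eT; eL; eR; eP] h h' ->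
     (forall a i, eX <= a <= eP -> i <> b + S k -> ar h' a i = ar h a i) ->
     ar h' eX (b + S k) = vr h rX -> ar h' eS (b + S k) = sz x ->
     ar h' eT (b + S k) = sz (seg l 0 (S k)) + sz x -> ar h' eP (b + S k) = pw (S k) ->
     unit_le d h' (ar h' eL (b + S k)) (seg l (pw (S k)) (S k) ++ x) (10 * m' (pw (S k)) + 13 + (S k - pw (S k))) ->
     unit_le d h' (ar h' eR (b + S k)) (seg l (2 * pw (S k) - 1 - S k) (pw (S k)))
       (10 * m' (Nat.max 1 (2 * pw (S k) - 1 - S k)) + 11 + cst eta (Nat.max 1 (2 * pw (S k) - 1 - S k))) ->
     Q h').
  { intros h' P1 P2 P3 P4 P5 P6 VX VS VT VP VL VR. apply HQ; auto.
    apply stack_push.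
    - apply stack_move with (h := h) (b := b) (l := l) (m := m); auto.
      intros a j Ha Hj. apply P6; lia.
    - constructor; fold l' m'; rewrite ?HlS, ?HmS, ?HsegS, ?Hseg by lia; auto.
      + rewrite VX. eapply unit_le_mono; [exact P1|reflexivity|exact Hx].
      + now rewrite sz_app.
      + intros H2. replace (S k - 1) with k by lia. destruct (Hl' k ltac:(lia)) as [-> ->]. apply Hgap. lia. }
  assert (Hone : pw (S k) = S k -> 1 <= k -> 10 * m k + 10 + cst eta k <= 10 * m' (Nat.max 1 k) + 11 + cst eta (Nat.max 1 k)).
  { intros _ H1. replace (Nat.max 1 k) with k by lia. destruct (Hl' k ltac:(lia)) as [_ ->]. lia. }
  w_ite; red1; [lia| |]; intros Ep.
  - destruct (Nat.eqb_spec (pw (S k)) (vr h rK)) as [E|]; [clear Ep|cbn in Ep; lia].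
    rewrite Hk in E.
    w_seq; w_sto; red1; rewrite ?Hb, ?Hk; try lia.
    w_sto; red1; rewrite ?Hb, ?Hk; try lia.
    apply Fin.
    + grows_tac.
    + eapply good_same; [| |exact Hg]; [reflexivity|]. intros a Ha. arr_tac.
    + reflexivity.
    + red1. lia.
    + split; keep_tac.
    + intros a i Ha Hi. arr_tac.
    + arr_tac.
    + arr_tac.
    + arr_tac.
    + arr_tac.
    + assert (Hu : unit_le d h (vr h rX) x (10 * m' (pw (S k)) + 13 + (S k - pw (S k)))).
      { eapply unit_le_mono; [apply grows_refl| |exact Hx]. rewrite E, HmS. lia. }
      rewrite E, (seg_empty l (S k) (S k)) by lia. rewrite E in Hu.
      eapply unit_le_eq; [| |reflexivity|exact Hu]; [grows_tac|arr_tac].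
    + replace (2 * pw (S k) - 1 - S k) with k by lia. rewrite E, seg_one.
      destruct (Nat.eq_dec k 0) as [->|Hk0].
      * destruct H0 as (E0 & _ & _ & ->). left. split; [|reflexivity]. rewrite Nat.add_0_r in Hbk. arr_tac.
      * eapply unit_le_eq; [| |apply Hone; auto; lia|apply (lv_X (Hlev k ltac:(lia)))];
          [grows_tac|rewrite <- Hbk; arr_tac].
  - destruct (Nat.eqb_spec (pw (S k)) (vr h rK)) as [|E]; [discriminate|clear Ep].
    rewrite Hk in E.
    assert (Hk1 : 1 <= k) by (destruct k; [now destruct E|lia]).
    assert (Epw : pw (S k) = pw k).
    { rewrite pw_succ. destruct (Nat.eqb_spec (2 * pw k) (S k)) as [E'|]; [|reflexivity].
      rewrite pw_succ, E', Nat.eqb_refl in E. lia. }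
    rewrite Epw in *. pose proof (pw_spec k ltac:(lia)) as Hpk2.
    destruct (Hlev k ltac:(lia)) as [X1 X2 X3 X4 X5 X6 X7 X8 X9 X10].
    pose proof (stack_m d h b k eta la l m (pw k) k Hst ltac:(lia) ltac:(lia)) as Hmp.
    destruct (Hl' (pw k) ltac:(lia)) as [_ Emp]. destruct (Hgap ltac:(lia)) as [Hmk _].
    w_seq; w_asg; red1; rewrite ?Hb, ?Hk; try lia.
    w_seq; w_asg; red1; rewrite ?Hb, ?Hk; try lia.
    w_seq.
    eapply wp_mul with (x := seg l (pw k) (S k)) (y := x) (b := 10 * m (pw k) + 13 + (S k - pw k)).
    1: { eapply good_same; [| |exact Hg]; [reflexivity|]. intros a Ha. arr_tac. }
    1: { red1. lia. }
    1: { eapply unit_le_eq; [| |reflexivity|exact X6]; [grows_tac|]. rewrite <- Hbk. arr_tac. }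
    1: { eapply unit_le_eq; [| |reflexivity|exact Hx]; [grows_tac|]. arr_tac. }
    1: { lia. }
    1: { lia. }
    1: { intros _ _. split; [lia|]. split; [lia|]. unfold gd.
         assert (lam (sz (l (pw k))) <= lam (sz (seg l (pw k) (S k) ++ x))).
         { apply lam_le. rewrite seg_head, !sz_app by lia. lia. }
         pose proof (lv_m (Hlev (pw k) ltac:(lia))). lia. }
    intros h2 G2 Go2 T2 N2 [K2 A2] U2. red1in N2. red1in T2.
    assert (Ga : grows h h2).
    { eapply grows_trans; [|exact G2]. grows_tac. }
    assert (V9 : vr h2 rBs = b) by (rewrite K2 by (cbn; lia); exact Hb).
    assert (V10 : vr h2 rK = S k) by (rewrite K2 by (cbn; lia); exact Hk).
    assert (V18 : vr h2 rP = pw k) by (rewrite K2 by (cbn; lia); reflexivity).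
    assert (F2 : forall a j, eX <= a <= eP -> j <> b + S k -> ar h2 a j = ar h a j).
    { intros a j Ha Hj. rewrite A2 by (cbn; lia). arr_tac. }
    w_seq; w_sto; red1; rewrite ?V9, ?V10; try lia.
    w_seq; w_asg; red1; rewrite ?V9, ?V10, ?V18; try lia.
    w_seq; w_asg; red1; rewrite ?V9, ?V10; try lia.
    (* The mirror image of [S k]. It is 0 at the last position of a block; entry 0 being empty, the
       height bound is then taken at index 1. *)
    set (i := 2 * pw k - 1 - S k).
    assert (Hi : i < pw k) by lia.
    w_seq.
    eapply wp_mul with (x := l i) (y := seg l (S i) (pw k)) (b := 10 * m (Nat.max 1 i) + 11 + cst eta (Nat.max 1 i))
      (b1 := 10 * m (Nat.max 1 i) + 10 + cst eta (Nat.max 1 i)) (b2 := 10 * m (Nat.max 1 (S i)) + 11 + cst eta (Nat.max 1 (S i))).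
    1: { eapply good_same; [| |exact Go2]; [reflexivity|]. intros a Ha. arr_tac. }
    1: { red1. lia. }
    1: { red1. destruct (Nat.eq_dec i 0) as [Ei|Ei].
         - left. rewrite Ei. split; [|apply H0]. rewrite Nat.add_0_r, F2 by lia. apply H0.
         - replace (Nat.max 1 i) with i by lia.
           eapply unit_le_eq; [| |reflexivity|apply (lv_X (Hlev i ltac:(lia)))].
           + eapply grows_trans; [exact Ga|]. grows_tac.
           + apply F2; lia. }
    1: { replace (2 * pw k - 1 - k) with (S i) in X7 by lia.
         eapply unit_le_eq; [| |reflexivity|exact X7].
         - eapply grows_trans; [exact Ga|]. grows_tac.
         - red1. rewrite Hbk. apply F2; lia. }
    1: { lia. }
    1: { destruct (Nat.eq_dec i 0) as [Ei|Ei].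
         - rewrite Ei. cbn [Nat.max]. lia.
         - pose proof (stack_m d h b k eta la l m i (S i) Hst ltac:(lia) ltac:(lia)).
           replace (Nat.max 1 i) with i by lia. replace (Nat.max 1 (S i)) with (S i) by lia.
           pose proof (cst_le eta i). pose proof (cst_le eta (S i)). lia. }
    1: { intros Hne _. destruct (Nat.eq_dec i 0) as [Ei|Ei]; [rewrite Ei in Hne; tauto|].
         pose proof (cst_le eta i). pose proof (cst_le eta (S i)).
         replace (Nat.max 1 i) with i by lia. replace (Nat.max 1 (S i)) with (S i) by lia.
         split; [lia|]. split.
         - assert (S i <= k) by lia.
           pose proof (stack_m d h b k eta la l m i (S i) Hst ltac:(lia) ltac:(lia)). lia.
         - unfold gd.
           assert (lam (sz (l i)) <= lam (sz (l i ++ seg l (S i) (pw k)))) by (apply lam_le; rewrite sz_app; lia).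
           pose proof (lv_m (Hlev i ltac:(lia))). lia. }
    rewrite <- seg_head by exact Hi.
    intros h3 G3 Go3 T3 N3 [K3 A3] U3. red1in N3. red1in T3.
    assert (Gb : grows h h3).
    { eapply grows_trans; [exact Ga|]. eapply grows_trans; [|exact G3]. grows_tac. }
    assert (W9 : vr h3 rBs = b) by (rewrite K3 by (cbn; lia); exact V9).
    assert (W10 : vr h3 rK = S k) by (rewrite K3 by (cbn; lia); exact V10).
    w_sto; red1; rewrite ?W9, ?W10; try lia.
    assert (Gc : grows h (seta h3 eR (b + S k) (vr h3 rC))).
    { eapply grows_trans; [exact Gb|]. grows_tac. }
    assert (Gd : grows h3 (seta h3 eR (b + S k) (vr h3 rC))) by grows_tac.
    assert (F3 : forall a, eX <= a <= eP -> ar h3 a = ar (seta h2 eL (b + S k) (vr h2 rC)) a).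
    { intros a Ha. rewrite A3 by (cbn; lia). reflexivity. }
    assert (F4 : forall a, eX <= a <= eP -> a <> eL -> a <> eR -> 
      ar (seta h3 eR (b + S k) (vr h3 rC)) a (b + S k) = ar h2 a (b + S k)).
    { intros a Ha Ha1 Ha2. red1. destruct (Nat.eqb_spec a 25); [lia|]. rewrite F3 by lia. arr_tac. }
    apply Fin.
    + exact Gc.
    + eapply good_same; [| |exact Go3]; [reflexivity|]. intros a Ha. arr_tac.
    + red1. lia.
    + red1. lia.
    + split.
      * intros y Hy. red1. rewrite K3 by (cbn in *; lia). red1. unfold update.
        destruct (Nat.eqb_spec y 7); [cbn in Hy; lia|]. destruct (Nat.eqb_spec y 6); [cbn in Hy; lia|].
        rewrite K2 by (cbn in *; lia). red1. unfold update.
        repeat match goal with |- context [y =? ?k] => destruct (Nat.eqb_spec y k); [cbn in Hy; lia|] end. auto.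
      * intros a Ha. red1. destruct (Nat.eqb_spec a 25); [cbn in Ha; lia|].
        rewrite A3 by (cbn in *; lia). red1. destruct (Nat.eqb_spec a 24); [cbn in Ha; lia|].
        rewrite A2 by (cbn in *; lia). red1.
        repeat match goal with |- context [a =? ?k] => destruct (Nat.eqb_spec a k); [cbn in Ha; lia|] end. auto.
    + intros a j Ha Hj. transitivity (ar h2 a j); [|apply F2; lia].
      red1. destruct (Nat.eqb_spec a 25) as [->|].
      * unfold update. destruct (Nat.eqb_spec j (b + S k)); [lia|]. rewrite F3 by lia. arr_tac.
      * rewrite F3 by lia. arr_tac.
    + rewrite F4 by lia. rewrite A2 by (cbn; lia). arr_tac.
    + rewrite F4 by lia. rewrite A2 by (cbn; lia). arr_tac.
    + rewrite F4 by lia. rewrite A2 by (cbn; lia). arr_tac.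
    + rewrite F4 by lia. rewrite A2 by (cbn; lia). red1. unfold update. now rewrite Nat.eqb_refl.
    + rewrite Emp. eapply unit_le_eq; [| |reflexivity|exact U2].
      * eapply grows_trans; [|exact Gd]. eapply grows_trans; [|exact G3]. grows_tac.
      * red1. rewrite F3 by lia. arr_tac.
    + fold i. destruct (Hl' (Nat.max 1 i) ltac:(lia)) as [_ ->].
      eapply unit_le_eq; [exact Gd| |reflexivity|exact U3]. arr_tac.
Qed.

(** The block [g..p-1] is nested up to [g] levels deep. The condition [4 * i <= pw k] leaves at
    least [g / 2] entries between [i] and [g], over which [m] drops by 7 each, so entry [i]
    outweighs this depth and only constants remain. *)
Lemma wp_suffix d h b k eta la l m i (Q : astate -> Prop) :
  good h -> vr h rBs = b -> vr h rK = k -> vr h rH = i -> stack d h b k eta la l m ->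
  i = 0 \/ 4 * i <= pw k -> b + k < lim -> vr h rNo + 2 < lim ->
  (forall h',
     unit_le d h' (vr h' rC) (seg l i (S k))
       (10 * m (Nat.max 1 i) + 12 + if i =? 0 then 3 else cst eta i) ->
     grows h h' -> good h' -> tk h' = tk h -> vr h' rNo <= vr h rNo + 2 ->
     keeps [rNo; rA; rB; rC; rP] [oTag; oFst; oSnd] h h' -> Q h') ->
  wp (suffix cap d) h Q.
Proof.
  intros Hg Hb Hk Hi Hst Hik Hlim Hno HQ.
  pose proof Hfits as [Hbig Hw].
  pose proof Hst as [(Z1 & Z2 & Z3 & Z4 & Z5 & Z6 & Z7) Hlev].
  assert (HP : ar h eP (b + k) = pw k).
  { destruct k as [|k']; [now rewrite Nat.add_0_r|].
    apply (lv_P (Hlev (S k') ltac:(lia))). }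
  pose proof (pw_pos k) as Hp0.
  assert (Hpk : k = 0 /\ pw k = 1 \/ 1 <= k /\ pw k <= k < 2 * pw k).
  { destruct k as [|k']; [now left|right]. split; [lia|]. apply pw_spec. lia. }
  remember (pw k) as p eqn:Ep. set (g := p / 2).
  (* If [p = 1], both lower products are those stored at the bottom entry, hence empty, and [i] must
     be 0. *)
  assert (Hgp : p = 1 /\ g = 0 \/ 1 <= g /\ p = 2 * g /\ 1 <= k).
  { destruct (Nat.eq_dec p 1) as [->|]; [left; auto|right].
    destruct (pw_half k (p - 1)) as [_ E]; rewrite <- ?Ep in *; try lia. }
  assert (Hgap : forall x y, 1 <= x <= y -> y <= k -> m y + 7 * (y - x) <= m x).
  { intros x y. now apply (stack_m d h b k eta la l m). }
  assert (Hlam : forall x y z, 1 <= x <= k -> y <= x < z -> m x <= lam (sz (seg l y z))).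
  { intros x y z Hx Hyz. pose proof (lv_m (Hlev x Hx)).
    assert (lam (sz (l x)) <= lam (sz (seg l y z))); [|lia]. apply lam_le.
    rewrite <- (seg_app l y x z), (seg_head l x z), !sz_app by lia. lia. }
  assert (U1 : unit_le d h (ar h eL (b + p - 1)) (seg l g p) (10 * m (Nat.max 1 g) + 12 + g)).
  { destruct Hgp as [[E1 E2]|(E1 & E2 & E3)].
    - left. rewrite E1, E2. replace (b + 1 - 1) with b by lia. now rewrite seg_one.
    - destruct (pw_half k (p - 1)) as [E _]; rewrite <- ?Ep in *; try lia. fold g in E.
      pose proof (lv_L (Hlev (p - 1) ltac:(lia))) as X. rewrite E in X.
      replace (S (p - 1)) with p in X by lia. replace (b + p - 1) with (b + (p - 1)) by lia.
      eapply unit_le_mono; [apply grows_refl| |exact X]. replace (Nat.max 1 g) with g by lia. lia. }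
  assert (U2 : unit_le d h (ar h eL (b + k)) (seg l p (S k)) (10 * m p + 13 + (k - p))).
  { destruct Hpk as [[E1 E2]|[E1 E2]].
    - left. rewrite E1, E2, Nat.add_0_r. split; [exact Z5|apply seg_empty; lia].
    - rewrite Ep. apply (lv_L (Hlev k ltac:(lia))). }
  set (c := if i =? 0 then 3 else cst eta i) in *.
  assert (U3 : unit_le d h (ar h eR (b + p - 1 - i)) (seg l i g) (10 * m (Nat.max 1 i) + 11 + c)).
  { destruct Hgp as [[E1 E2]|(E1 & E2 & E3)].
    - left. assert (i = 0) as -> by lia. rewrite E1, E2. replace (b + 1 - 1 - 0) with b by lia. auto.
    - destruct (pw_half k (p - 1 - i)) as [E _]; rewrite <- ?Ep in *; try lia. fold g in E.
      pose proof (lv_R (Hlev (p - 1 - i) ltac:(lia))) as X. rewrite E in X.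
      replace (2 * g - 1 - (p - 1 - i)) with i in X by lia.
      replace (b + p - 1 - i) with (b + (p - 1 - i)) by lia.
      eapply unit_le_mono; [apply grows_refl| |exact X].
      unfold c. destruct (Nat.eqb_spec i 0) as [->|].
      + pose proof (cst_le eta (Nat.max 1 0)). lia.
      + replace (Nat.max 1 i) with i by lia. lia. }
  assert (Hc : 1 <= c <= 3) by (pose proof (cst_le eta i); unfold c; destruct (i =? 0); lia).
  unfold suffix.
  w_seq; w_asg; red1; rewrite ?Hb, ?Hk, ?HP; try lia.
  w_seq; w_asg; red1; rewrite ?Hb, ?Hk; try lia.
  w_seq; w_asg; red1; rewrite ?Hb, ?Hk; try lia.
  w_seq.
  eapply wp_mul with (x := seg l g p) (y := seg l p (S k)) (b := 10 * m (Nat.max 1 g) + 13 + g).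
  1: { eapply good_same; [| |exact Hg]; [reflexivity|]. intros a Ha. arr_tac. }
  1: { red1. lia. }
  1: { eapply unit_le_eq; [| |reflexivity|exact U1]; [grows_tac|]. reflexivity. }
  1: { eapply unit_le_eq; [| |reflexivity|exact U2]; [grows_tac|]. reflexivity. }
  1: { lia. }
  1: { destruct Hgp as [[E1 E2]|(E1 & E2 & E3)].
       - rewrite E1, E2. cbn [Nat.max]. lia.
       - replace (Nat.max 1 g) with g by lia. specialize (Hgap g p ltac:(lia) ltac:(lia)). lia. }
  1: { intros Hne _. destruct Hgp as [[E1 E2]|(E1 & E2 & E3)].
       - rewrite E1, E2, seg_one in Hne. tauto.
       - replace (Nat.max 1 g) with g by lia. split; [lia|].
         pose proof (Hgap g p ltac:(lia) ltac:(lia)). split; [lia|].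
         rewrite seg_app by lia. specialize (Hlam g g (S k) ltac:(lia) ltac:(lia)).
         unfold gd. lia. }
  rewrite seg_app by lia.
  intros h2 G2 Go2 T2 N2 [K2 A2] W2. red1in N2. red1in T2.
  assert (V9 : vr h2 rBs = b) by (rewrite K2 by (cbn; lia); exact Hb).
  assert (V15 : vr h2 rH = i) by (rewrite K2 by (cbn; lia); exact Hi).
  assert (V18 : vr h2 rP = p) by (rewrite K2 by (cbn; lia); reflexivity).
  assert (F2 : forall j, ar h2 eR j = ar h eR j).
  { intros j. rewrite A2 by (cbn; lia). reflexivity. }
  assert (Ga : grows h h2) by (eapply grows_trans; [|exact G2]; grows_tac).
  w_seq; w_asg; red1; rewrite ?V9, ?V15, ?V18; try lia.
  w_seq; w_asg; red1; try lia.
  eapply wp_mul with (x := seg l i g) (y := seg l g (S k)) (b := 10 * m (Nat.max 1 i) + 12 + c).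
  1: { eapply good_same; [| |exact Go2]; [reflexivity|]. intros a Ha. arr_tac. }
  1: { red1. lia. }
  1: { eapply unit_le_eq; [| |reflexivity|exact U3].
       - eapply grows_trans; [exact Ga|]. grows_tac.
       - red1. apply F2. }
  1: { eapply unit_le_eq; [| |reflexivity|exact W2]; [grows_tac|]. reflexivity. }
  1: { lia. }
  1: { destruct Hgp as [[E1 E2]|(E1 & E2 & E3)].
       - assert (i = 0) as -> by lia. rewrite E2. cbn [Nat.max]. unfold c. cbn [Nat.eqb]. lia.
       - replace (Nat.max 1 g) with g by lia. pose proof (Hgap (Nat.max 1 i) g ltac:(lia) ltac:(lia)).
         destruct (Nat.eq_dec i 0) as [->|]; [|lia]. unfold c. cbn [Nat.eqb Nat.max] in *. lia. }
  1: { intros Hne _. destruct Hgp as [[E1 E2]|(E1 & E2 & E3)].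
       - rewrite E2, seg_empty in Hne by lia. tauto.
       - split; [lia|]. pose proof (Hgap (Nat.max 1 i) g ltac:(lia) ltac:(lia)). split.
         + replace (Nat.max 1 g) with g by lia.
           destruct (Nat.eq_dec i 0) as [->|]; [|lia]. unfold c. cbn [Nat.eqb Nat.max] in *. lia.
         + rewrite seg_app by lia. specialize (Hlam (Nat.max 1 i) i (S k) ltac:(lia) ltac:(lia)).
           unfold gd. lia. }
  rewrite seg_app by lia.
  intros h3 G3 Go3 T3 N3 [K3 A3] W3. red1in N3. red1in T3.
  apply HQ; auto; try lia.
  - eapply grows_trans; [exact Ga|]. eapply grows_trans; [|exact G3]. grows_tac.
  - split.
    + intros y Hy. rewrite K3 by (cbn in *; lia). red1. unfold update.
      repeat match goal with |- context [y =? ?k] => destruct (Nat.eqb_spec y k); [cbn in Hy; lia|] end.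
      rewrite K2 by (cbn in *; lia). red1. unfold update.
      repeat match goal with |- context [y =? ?k] => destruct (Nat.eqb_spec y k); [cbn in Hy; lia|] end. auto.
    + intros a Ha. rewrite A3 by (cbn in *; lia). red1. rewrite A2 by (cbn in *; lia). reflexivity.
Qed.

(** A unit of length [s] is absorbed when the collected length is at least [s / 4], so the result
    has length at least [5 s / 4]. This gains 2 in [lam], or 20 in height, more than the added
    levels cost. Iterations and rules are paid by the entries popped. *)
Lemma wp_letter d h u x b k eta l m (Q : astate -> Prop) :
  good h -> vr h rBs = b -> vr h rK = k -> vr h rU = u -> u < lim -> x < n ->
  ar h aLt u = x -> ar h aLen x = ln x -> 0 < ln x -> 2 * ln x <= ln u ->
  stack d h b k eta (lam (ln u)) l m ->
  sz (seg l 0 (S k)) + ln x <= ln u -> ln u <= zmax ->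
  b + S k < lim -> vr h rNo + k + 6 < lim ->
  (forall h' k' l' m', k' <= k -> vr h' rK = S k' ->
     stack d h' b (S k') eta (lam (ln u)) l' m' -> seg l' 0 (S (S k')) = seg l 0 (S k) ++ [x] ->
     grows h h' -> good h' -> tk h' + k' = tk h + k -> vr h' rNo + k' <= vr h rNo + k + 3 ->
     keeps [rNo; rA; rB; rC; rK; rX; rZ; rAcc; rP] [oTag; oFst; oSnd; eX; eS; eT; eL; eR; eP] h h' ->
     (forall a i, eX <= a <= eP -> ~ b <= i <= b + S k -> ar h' a i = ar h a i) -> Q h') ->
  wp (letter cap d) h Q.
Proof.
  intros Hg Hb Hk Hu Hul Hxn Hlt Hlen Hx0 Hx2 Hst Hsz Hz Hbl Hno HQ.
  pose proof Hfits as [Hbig Hw].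
  pose proof Hst as [(Z1 & Z2 & Z3 & Z4 & Z5 & Z6 & Z7) Hlev].
  assert (Hsplit : forall i, i <= k -> sz (seg l 0 (S i)) + sz (seg l (S i) (S k)) = sz (seg l 0 (S k))).
  { intros i Hi. rewrite <- (seg_app l 0 (S i) (S k)), sz_app by lia. reflexivity. }
  unfold letter.
  w_seq; w_asg; red1; rewrite ?Hu, ?Hlt; try lia.
  w_seq; w_asg; red1; rewrite ?Hu, ?Hlt, ?Hlen; try lia.
  w_seq; w_asg; red1; try lia.
  w_seq.
  match goal with |- wp _ ?h0 _ => set (h1 := h0) end.
  (* The unit absorbed last is outermost and has the largest [m]; it determines the height of
     everything collected so far. *)
  pose (bnd := fun k' => if k' =? k then 0 else 10 * m (S k') + 14).
  apply wp_whl with (B := tk h + k) (I := fun h2 => exists k', k' <= k /\ vr h2 rK = k' /\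
      vr h2 rZ = ln x + sz (seg l (S k') (S k)) /\
      unit_le d h2 (vr h2 rAcc) (seg l (S k') (S k)) (bnd k') /\
      (k' < k -> 5 * sz (l (S k')) <= 4 * vr h2 rZ) /\
      grows h h2 /\ good h2 /\ tk h2 + k' = tk h + k /\ vr h2 rNo + k' <= vr h rNo + k /\
      keeps [rNo; rA; rB; rC; rK; rZ; rAcc] [oTag; oFst; oSnd] h1 h2).
  1: exact Hfits.
  - exists k. rewrite seg_empty by lia. unfold h1. red1. change (sz []) with 0.
    split; [lia|]. split; [exact Hk|]. split; [lia|]. split; [left; auto|]. split; [lia|].
    split; [grows_tac|]. split; [eapply good_same; [| |exact Hg]; [reflexivity|]; intros; arr_tac|].
    split; [lia|]. split; [lia|]. apply keeps_refl.
  - intros h2 (k' & H1 & H2 & H3 & H4 & H5 & H6 & H7 & H8 & H9 & V & A).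
    assert (V9 : vr h2 rBs = b) by (rewrite V by (cbn; lia); exact Hb).
    specialize (Hsplit k' H1). red1. rewrite V9, H2. split; lia.
  - intros h2 (k' & H1 & H2 & H3 & H4 & H5 & H6 & H7 & H8 & H9 & K). pose proof K as [V A].
    assert (V9 : vr h2 rBs = b) by (rewrite V by (cbn; lia); exact Hb).
    assert (A1 : forall a, ~ In a [oTag; oFst; oSnd] -> ar h2 a = ar h a).
    { intros a Ha. rewrite A by exact Ha. reflexivity. }
    red1. rewrite V9, H2, A1 by (cbn; lia). intros Hgd.
    destruct (Nat.ltb_spec (ar h eS (b + k')) (4 * vr h2 rZ + 1)) as [Hlt'|]; [clear Hgd|now destruct Hgd].
    pose proof (Hsplit k' H1) as Hs1.
    assert (Hk' : 1 <= k').
    { destruct k' as [|k']; [|lia]. rewrite Nat.add_0_r, Z3 in Hlt'. lia. }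
    destruct (Hlev k' ltac:(lia)) as [X1 X2 X3 X4 X5 X6 X7 X8 X9 X10].
    pose proof (cst_le eta k') as Hc.
    w_seq; w_asg; red1; rewrite ?V9, ?H2; try lia.
    w_seq; w_asg; red1; try lia.
    w_seq.
    eapply wp_mul with (x := l k') (y := seg l (S k') (S k)) (b := 10 * m k' + 14).
    1: { eapply good_same; [| |exact H7]; [reflexivity|]. intros; arr_tac. }
    1: { red1. lia. }
    1: { eapply unit_le_eq; [| |reflexivity|exact X1].
         - eapply grows_trans; [exact H6|]. grows_tac.
         - red1. now rewrite A1 by (cbn; lia). }
    1: { eapply unit_le_eq; [| |reflexivity|exact H4]; [grows_tac|reflexivity]. }
    1: { lia. }
    1: { unfold bnd. destruct (Nat.eqb_spec k' k); [lia|].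
         pose proof (stack_m d h b k eta _ l m k' (S k') Hst ltac:(lia) ltac:(lia)). lia. }
    1: { intros _ _. split; [lia|]. split.
         - unfold bnd. destruct (Nat.eqb_spec k' k); [lia|].
           pose proof (stack_m d h b k eta _ l m k' (S k') Hst ltac:(lia) ltac:(lia)). lia.
         - unfold gd.
           assert (lam (sz (l k')) <= lam (sz (l k' ++ seg l (S k') (S k)))) by (apply lam_le; rewrite sz_app; lia).
           lia. }
    rewrite <- seg_head by lia.
    intros h3 G3 Go3 T3 N3 K3 W3. red1in N3. red1in T3. pose proof K3 as [V3 A3].
    assert (V39 : vr h3 rBs = b) by (rewrite V3 by (cbn; lia); exact V9).
    assert (V310 : vr h3 rK = k') by (rewrite V3 by (cbn; lia); exact H2).
    assert (V312 : vr h3 rZ = vr h2 rZ) by (rewrite V3 by (cbn; lia); reflexivity).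
    assert (A31 : ar h3 eS (b + k') = sz (l k')).
    { rewrite A3 by (cbn; lia). red1. rewrite A1 by (cbn; lia). exact X2. }
    assert (Hs0 : seg l k' (S k) = l k' ++ seg l (S k') (S k)) by (apply seg_head; lia).
    assert (Hs2 : sz (seg l k' (S k)) = sz (l k') + sz (seg l (S k') (S k))) by (now rewrite Hs0, sz_app).
    assert (Hs3 : sz (seg l k' (S k)) <= sz (seg l 0 (S k))).
    { rewrite <- (seg_app l 0 k' (S k)), sz_app by lia. lia. }
    w_seq; w_asg; red1; try lia.
    w_seq; w_asg; red1; rewrite ?V39, ?V310, ?V312, ?A31; try lia.
    w_asg; red1; rewrite ?V310; try lia.
    exists (k' - 1). replace (S (k' - 1)) with k' by lia. red1.
    split; [lia|]. split; [reflexivity|]. split; [lia|].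
    split.
    { eapply unit_le_eq; [| | |exact W3]; [grows_tac|reflexivity|].
      unfold bnd. destruct (Nat.eqb_spec (k' - 1) k); [lia|]. replace (S (k' - 1)) with k' by lia. lia. }
    split; [intros _; lia|].
    split; [eapply grows_trans; [exact H6|]; eapply grows_trans; [|eapply grows_trans; [exact G3|]]; grows_tac|].
    split; [eapply good_same; [| |exact Go3]; [reflexivity|]; intros; arr_tac|].
    split; [lia|]. split; [lia|].
    eapply keeps_trans; [exact K|]. eapply keeps_trans; [|eapply keeps_trans].
    2: { eapply keeps_incl; [| |exact K3]; incl_tac. }
    + keeps_tac.
    + keeps_tac.
  - intros h2 (k' & H1 & H2 & H3 & H4 & H5 & H6 & H7 & H8 & H9 & K). pose proof K as [V A].
    assert (V9 : vr h2 rBs = b) by (rewrite V by (cbn; lia); exact Hb).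
    assert (V11 : vr h2 rX = S x) by (rewrite V by (cbn; lia); unfold h1; red1; lia).
    assert (A1 : forall a, ~ In a [oTag; oFst; oSnd] -> ar h2 a = ar h a).
    { intros a Ha. rewrite A by exact Ha. reflexivity. }
    red1. rewrite V9, H2, A1 by (cbn; lia). intros Hgd.
    destruct (Nat.ltb_spec (ar h eS (b + k')) (4 * vr h2 rZ + 1)) as [|Hge]; [discriminate|clear Hgd].
    pose proof (Hsplit k' H1) as Hs1.
    set (y := seg l (S k') (S k) ++ [x]).
    assert (Hy : sz y = vr h2 rZ).
    { unfold y. rewrite sz_app, H3. unfold sz. cbn. lia. }
    assert (Hlx : lam (ln x) + 8 <= lam (ln u)) by (apply lam_double; lia).
    assert (Hly : lam (sz y) <= lam (ln u)) by (apply lam_le; lia).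
    assert (Hxy : lam (ln x) <= lam (sz y)) by (apply lam_le; lia).
    (* The new unit is shorter than [u] but may have the same [lam]. The cap keeps [m] strictly
       below [lam (ln u)] at a slack of 1, and does not undercut the letter, whose [lam] is smaller
       by 8. *)
    set (mx := Nat.min (lam (sz y)) (lam (ln u) - 1)).
    assert (Hmx : mx <= lam (sz y) <= mx + 1 /\ mx < lam (ln u) /\ lam (ln x) <= mx) by lia.
    pose proof (cst_le eta (S k')) as Hc.
    w_seq; w_asg; red1; try lia.
    w_seq; w_asg; red1; try lia.
    w_seq.
    eapply wp_mul with (x := seg l (S k') (S k)) (y := [x]) (b := 10 * mx + 10 + cst eta (S k'))
      (b2 := 10 * lam (ln x) + 10).
    1: { eapply good_same; [| |exact H7]; [reflexivity|]. intros; arr_tac. }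
    1: { red1. lia. }
    1: { eapply unit_le_eq; [| |reflexivity|exact H4]; [grows_tac|reflexivity]. }
    1: { right. exists (bd x). split; [reflexivity|]. red1. rewrite V11.
         split; [now constructor|]. destruct H7 as [H7 _]. lia. }
    1: { unfold bnd. destruct (Nat.eqb_spec k' k); [lia|].
         pose proof (lv_m (Hlev (S k') ltac:(lia))).
         pose proof (lv_pos (Hlev (S k') ltac:(lia))).
         assert (lam (sz (l (S k'))) + 2 <= lam (sz y)); [|lia]. apply lam_54; lia. }
    1: { lia. }
    1: { intros _ _. split; [|split; [lia|]].
         - unfold bnd. destruct (Nat.eqb_spec k' k); [lia|].
           pose proof (lv_m (Hlev (S k') ltac:(lia))).
           pose proof (lv_pos (Hlev (S k') ltac:(lia))).
           assert (lam (sz (l (S k'))) + 2 <= lam (sz y)); [|lia]. apply lam_54; lia.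
         - fold y. unfold gd. lia. }
    fold y. intros h3 G3 Go3 T3 N3 K3 W3. red1in N3. red1in T3. pose proof K3 as [V3 A3].
    assert (V39 : vr h3 rBs = b) by (rewrite V3 by (cbn; lia); exact V9).
    assert (V310 : vr h3 rK = k') by (rewrite V3 by (cbn; lia); exact H2).
    assert (V312 : vr h3 rZ = sz y) by (rewrite V3 by (cbn; lia); red1; lia).
    assert (A31 : forall a, ~ In a [oTag; oFst; oSnd] -> ar h3 a = ar h a).
    { intros a Ha. rewrite A3, <- A1 by exact Ha. reflexivity. }
    w_seq; w_asg; red1; try lia.
    w_seq; w_asg; red1; try lia. rewrite V310. replace (k' + 1) with (S k') by lia.
    match goal with |- wp _ ?h0 _ => set (h4 := h0) end.
    assert (G4 : grows h h4).
    { eapply grows_trans; [exact H6|]; eapply grows_trans; [|eapply grows_trans; [exact G3|]]; unfold h4; grows_tac. }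
    eapply wp_push with (k := k') (x := y) (mx := mx) (eta := eta) (la := lam (ln u)) (l := l) (m := m) (b := b)
     .
    1: { eapply good_same; [| |exact Go3]; [reflexivity|]. intros; unfold h4; arr_tac. }
    1: { exact V39. }
    1: { reflexivity. }
    1: { eapply stack_pop; [exact H1|]. eapply stack_move; [exact G4| | |exact Hst]; [|auto].
         intros a j Ha _. unfold h4. red1. now rewrite A31 by (cbn; lia). }
    1: { unfold h4. eapply unit_le_eq; [| |reflexivity|exact W3]; [grows_tac|reflexivity]. }
    1: { exact V312. }
    1: { lia. }
    1: { unfold slack. destruct (_ <=? _); lia. }
    1: { lia. }
    (* The absorption stopped because the entry below is at least four times as long. This is worth
       16, of which that entry may lose 9 as slack; the drop of 7 in [m] is what remains. *)
    1: { intros Hk1. destruct (Hlev k' ltac:(lia)) as [X1 X2 X3 X4 X5 X6 X7 X8 X9 X10].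
         rewrite X2 in Hge. pose proof (gap_ge eta (S k')). pose proof (slack_le eta k').
         assert (lam (sz y) + 16 <= lam (sz (l k'))) by (apply lam_quad; lia). split; [lia|].
         assert (gap eta (S k') * sz y <= 4 * sz y) by (apply Nat.mul_le_mono_r; lia). lia. }
    1: { lia. }
    1: { unfold h4. red1. lia. }
    1: { lia. }
    intros h5 S5 G5 Go5 T5 N5 K5 F5. unfold h4 in T5, N5. red1in T5. red1in N5.
    eapply HQ with (k' := k'); [exact H1| |exact S5| | |exact Go5|lia|lia| |].
    + destruct K5 as [V5 _]. rewrite V5 by (cbn; lia). reflexivity.
    + rewrite seg_last, upd_same by lia. unfold y. rewrite app_assoc. f_equal.
      rewrite <- (seg_app l 0 (S k') (S k)) by lia. f_equal.
      apply seg_ext. intros j Hj. apply upd_other. lia.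
    + eapply grows_trans; [exact G4|exact G5].
    + eapply keeps_trans with (h2 := h1); [unfold h1; keeps_tac|].
      eapply keeps_trans with (h2 := h2); [eapply keeps_incl; [| |exact K]; incl_tac|].
      eapply keeps_trans with (h2 := h4).
      * eapply keeps_trans with (h2 := h3); [|unfold h4; keeps_tac].
        eapply keeps_trans; [|eapply keeps_incl; [| |exact K3]; incl_tac]. keeps_tac.
      * eapply keeps_incl; [| |exact K5]; incl_tac.
    + intros a i Ha Hi. rewrite F5 by lia. unfold h4. red1. now rewrite A31 by (cbn; lia).
Qed.

Lemma wp_copy h q b c (Q : astate -> Prop) :
  vr h rQ = q -> vr h rBs = b -> vr h rN = c -> q + c <= b \/ b + c <= q ->
  q + c <= lim -> b + c <= lim ->
  (forall h', (forall a j, eX <= a <= eP -> j < c -> ar h' a (q + j) = ar h a (b + j)) ->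
     (forall a i, eX <= a <= eP -> ~ q <= i < q + c -> ar h' a i = ar h a i) ->
     keeps [rJ] [eX; eS; eT; eL; eR; eP] h h' -> tk h' = tk h + c -> Q h') ->
  wp (copy cap) h Q.
Proof.
  intros Hq Hb Hc Hd Hql Hbl HQ. pose proof Hfits as [Hbig Hw].
  unfold copy. w_seq; w_asg; red1; try lia.
  eapply wp_whl with (B := tk h + c) (I := fun h1 => exists j, j <= c /\ vr h1 rJ = j /\ tk h1 = tk h + j /\
    (forall a x, eX <= a <= eP -> x < j -> ar h1 a (q + x) = ar h a (b + x)) /\
    (forall a i, eX <= a <= eP -> ~ q <= i < q + j -> ar h1 a i = ar h a i) /\
    keeps [rJ] [eX; eS; eT; eL; eR; eP] h h1).
  1: exact Hfits.
  - exists 0. red1. split; [lia|]. split; [reflexivity|]. split; [lia|]. split; [intros; lia|].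
    split; [auto|keeps_tac].
  - intros h1 (j & Hj & Ej & Et & _ & _ & K). red1. split; auto; lia.
  - intros h1 (j & Hj & Ej & Et & E1 & E2 & K). pose proof K as [V _].
    assert (V1 : vr h1 rQ = q) by (rewrite V by (cbn; lia); exact Hq).
    assert (V2 : vr h1 rBs = b) by (rewrite V by (cbn; lia); exact Hb).
    assert (V3 : vr h1 rN = c) by (rewrite V by (cbn; lia); exact Hc).
    red1. rewrite V3, Ej. intros Hlt.
    destruct (Nat.ltb_spec j c) as [Hjc|]; [clear Hlt|now destruct Hlt].
    assert (Hr : forall a, eX <= a <= eP -> ar h1 a (b + j) = ar h a (b + j)) by (intros; apply E2; lia).
    do 6 (w_seq; w_sto; red1; rewrite ?V1, ?V2, ?Ej, ?Hr; try lia).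
    w_asg; red1; try lia. rewrite Ej.
    exists (j + 1). red1. split; [lia|]. split; [reflexivity|]. split; [lia|]. split; [|split].
    + intros a x Ha Hx. destruct (Nat.eq_dec x j) as [->|Hne].
      * assert (a = 21 \/ a = 22 \/ a = 23 \/ a = 24 \/ a = 25 \/ a = 26) as Hc6 by lia.
        destruct Hc6 as [-> |[-> |[-> |[-> |[-> | ->]]]]]; red1; unfold update; now rewrite Nat.eqb_refl.
      * transitivity (ar h1 a (q + x)); [|apply E1; lia]. arr_tac.
    + intros a i Ha Hi. transitivity (ar h1 a i); [|apply E2; lia]. arr_tac.
    + eapply keeps_trans; [exact K|]. keeps_tac.
  - intros h1 (j & Hj & Ej & Et & E1 & E2 & K). pose proof K as [V _].
    assert (V3 : vr h1 rN = c) by (rewrite V by (cbn; lia); exact Hc).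
    red1. rewrite V3, Ej. intros Hge.
    destruct (Nat.ltb_spec j c) as [|Hjc]; [discriminate|].
    assert (j = c) as -> by lia. apply HQ; auto.
Qed.

(** A geometric series with ratio at most 1/2. It bounds a lump by twice its lowest entry. *)
Lemma stack_total d h b k eta la l m i :
  stack d h b k eta la l m -> 1 <= i <= k -> sz (seg l i (S k)) + sz (l k) <= 2 * sz (l i).
Proof.
  intros [_ Hs] Hi. induction k as [|k IH]; [lia|].
  destruct (Nat.eq_dec i (S k)) as [->|Hne]; [rewrite seg_one; lia|].
  rewrite seg_last, sz_app by lia.
  destruct (lv_gap (Hs (S k) ltac:(lia)) ltac:(lia)) as [_ Hg].
  replace (S k - 1) with k in Hg by lia. pose proof (gap_ge eta (S k)).
  assert (2 * sz (l (S k)) <= gap eta (S k) * sz (l (S k))) by (apply Nat.mul_le_mono_r; lia).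
  specialize (IH ltac:(intros; apply Hs; lia) ltac:(lia)). lia.
Qed.

Lemma stack_T d h b k eta la l m i :
  stack d h b k eta la l m -> i <= k -> ar h eT (b + i) = sz (seg l 0 (S i)).
Proof.
  intros [(E0 & _ & _ & E3 & _) Hs] Hi. destruct i as [|i].
  - rewrite Nat.add_0_r, E3, seg_one, E0. reflexivity.
  - apply (lv_T (Hs (S i) ltac:(lia))).
Qed.

Lemma stack_P d h b k eta la l m i :
  stack d h b k eta la l m -> i <= k -> ar h eP (b + i) = pw i.
Proof.
  intros [(_ & _ & _ & _ & _ & _ & E) Hs] Hi. destruct i as [|i].
  - now rewrite Nat.add_0_r.
  - apply (lv_P (Hs (S i) ltac:(lia))).
Qed.

(** The lump keeps the [m] of its lowest entry, at position [e + 1]. Since [e < eta], that entry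
    still satisfies the strong bounds, which are just enough for the weak bounds of the lump with
    respect to [e]; so the loss does not accumulate over repeated branching. *)
Lemma wp_branch d h x b k eta e la l m q (Q : astate -> Prop) :
  good h -> vr h rBs = b -> vr h rK = k -> vr h rW = x -> x < lim ->
  ar h aBas x = q -> ar h aEta x = e -> e < eta ->
  stack d h b k eta la l m -> sz (seg l 0 (S k)) < 2 ^ w ->
  q + 16 * (e + 1) <= b \/ b + k < q -> q + 16 * (e + 1) <= lim -> b + k < lim -> vr h rNo + 4 < lim ->
  (forall h' k' l' m', k' <= 8 * (e + 1) -> ar h' aKk x = k' ->
     stack d h' q k' e la l' m' -> seg l' 0 (S k') = seg l 0 (S k) ->
     grows h h' -> good h' -> tk h' <= tk h + 8 * (e + 1) -> vr h' rNo <= vr h rNo + 4 ->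
     (forall i, i <> x -> ar h' aKk i = ar h aKk i) ->
     keeps [rNo; rA; rB; rC; rX; rZ; rH; rJ; rQ; rP; rN; rBs'; rK']
       [oTag; oFst; oSnd; aKk; eX; eS; eT; eL; eR; eP] h h' ->
     (forall a i, eX <= a <= eP -> ~ q <= i < q + 16 * (e + 1) -> ar h' a i = ar h a i) -> Q h') ->
  wp (branch cap d) h Q.
Proof.
  intros Hg Hb Hk Hx Hxl Hq He Heta Hst Hsz Hdis Hql Hbl Hno HQ.
  pose proof Hfits as [Hbig Hw].
  pose proof (stack_P d h b k eta la l m k Hst ltac:(lia)) as HP.
  pose proof (stack_T d h b k eta la l m) as HT.
  unfold branch.
  w_seq; w_asg; red1; rewrite ?Hx, ?Hq; try lia.
  w_seq; w_asg; red1; rewrite ?Hx, ?He; try lia.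
  w_ite; red1; rewrite ?Hb, ?Hk, ?HP; [lia| |]; intros Hgd.
  - destruct (Nat.ltb_spec (pw k) (4 * (e + 1))) as [Hlt|]; [clear Hgd|now destruct Hgd].
    assert (Hk8 : k < 8 * (e + 1)).
    { destruct k as [|k']; [lia|]. pose proof (pw_spec (S k') ltac:(lia)). lia. }
    w_seq; w_asg; red1; rewrite ?Hk; try lia.
    w_seq. eapply wp_copy with (q := q) (b := b) (c := k + 1); [reflexivity|red1; exact Hb|reflexivity|lia|lia|lia|].
    intros h2 C1 C2 K2 T2. pose proof K2 as [V2 A2]. red1in T2.
    assert (W10 : vr h2 rK = k) by (rewrite V2 by (cbn; lia); exact Hk).
    assert (W14 : vr h2 rW = x) by (rewrite V2 by (cbn; lia); exact Hx).
    w_sto; red1; rewrite ?W10, ?W14; try lia.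
    assert (G2 : grows h (seta h2 aKk x k)).
    { split; [red1; rewrite V2 by (cbn; lia); reflexivity|].
      intros j _. red1. rewrite !A2 by (cbn; lia). auto. }
    eapply HQ with (k' := k) (l' := l) (m' := m); try lia; auto.
    + red1. unfold update. now rewrite Nat.eqb_refl.
    + apply stack_weaken with (eta := eta) (la := la); [lia|lia|].
      eapply stack_move; [exact G2| |auto|exact Hst].
      intros a j Ha Hj. red1. transitivity (ar h2 a (q + j)); [arr_tac|apply C1; lia].
    + eapply good_same; [| |exact Hg]; [red1; rewrite V2 by (cbn; lia); reflexivity|].
      intros a Ha. transitivity (ar h2 a); [arr_tac|]. rewrite A2 by (cbn; lia). reflexivity.
    + red1. lia.
    + red1. rewrite V2 by (cbn; lia). red1. lia.
    + intros i Hi. red1. rewrite A2 by (cbn; lia). arr_tac.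
    + eapply keeps_trans with (h2 := h2); [|keeps_tac].
      eapply keeps_trans; [|eapply keeps_incl; [| |exact K2]; incl_tac]. keeps_tac.
    + intros a i Ha Hi. transitivity (ar h2 a i); [arr_tac|apply C2; lia].
  - destruct (Nat.ltb_spec (pw k) (4 * (e + 1))) as [|Hge]; [discriminate|clear Hgd].
    pose proof (pw_pos k).
    assert (Hpk : pw k <= k).
    { destruct k as [|k']; [cbn in *; lia|]. apply pw_spec. lia. }
    w_seq; w_asg; red1; try lia.
    w_seq. eapply wp_copy with (q := q) (b := b) (c := e + 1); [reflexivity|red1; exact Hb|reflexivity|lia|lia|lia|].
    intros h2 C1 C2 K2 T2. pose proof K2 as [V2 A2]. red1in T2.
    assert (G2 : grows h h2).
    { split; [rewrite V2 by (cbn; lia); reflexivity|].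
      intros j _. rewrite !A2 by (cbn; lia). auto. }
    assert (Go2 : good h2).
    { eapply good_same; [| |exact Hg]; [rewrite V2 by (cbn; lia); reflexivity|].
      intros a Ha. rewrite A2 by (cbn; lia). reflexivity. }
    assert (S2 : stack d h2 b k eta la l m).
    { eapply stack_move; [exact G2| |auto|exact Hst].
      intros a j Ha Hj. apply C2; lia. }
    assert (S2' : stack d h2 q e e la l m).
    { apply stack_weaken with (eta := eta) (la := la); [lia|lia|].
      eapply stack_move; [exact G2| |auto|eapply stack_pop; [|exact Hst]; lia].
      intros a j Ha Hj. apply C1; lia. }
    assert (N2 : vr h2 rNo = vr h rNo) by (rewrite V2 by (cbn; lia); reflexivity).
    assert (W17 : vr h2 rQ = q) by (rewrite V2 by (cbn; lia); reflexivity).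
    assert (W15 : vr h2 rH = e + 1) by (rewrite V2 by (cbn; lia); reflexivity).
    assert (W9 : vr h2 rBs = b) by (rewrite V2 by (cbn; lia); exact Hb).
    assert (W10 : vr h2 rK = k) by (rewrite V2 by (cbn; lia); exact Hk).
    assert (W14 : vr h2 rW = x) by (rewrite V2 by (cbn; lia); exact Hx).
    w_seq. eapply wp_suffix; [exact Go2|exact W9|exact W10|exact W15|exact S2|lia|lia|lia|].
    intros h3 U3 G3 Go3 T3 N3 K3. pose proof K3 as [V3 A3].
    assert (Y9 : vr h3 rBs = b) by (rewrite V3 by (cbn; lia); exact W9).
    assert (Y10 : vr h3 rK = k) by (rewrite V3 by (cbn; lia); exact W10).
    assert (Y15 : vr h3 rH = e + 1) by (rewrite V3 by (cbn; lia); exact W15).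
    assert (Y17 : vr h3 rQ = q) by (rewrite V3 by (cbn; lia); exact W17).
    assert (Y14 : vr h3 rW = x) by (rewrite V3 by (cbn; lia); exact W14).
    assert (B3 : forall a, 6 <= a -> ar h3 a = ar h2 a) by (intros; apply A3; cbn; lia).
    pose proof (stack_T d h2 b k eta la l m k S2 ltac:(lia)) as T2k.
    pose proof (stack_T d h2 b k eta la l m e S2 ltac:(lia)) as T2e.
    assert (Hsp : sz (seg l 0 (S k)) = sz (seg l 0 (S e)) + sz (seg l (S e) (S k))).
    { rewrite <- (seg_app l 0 (S e) (S k)), sz_app by lia. reflexivity. }
    replace (e + 1) with (S e) in * by lia.
    destruct Hst as [Hst0 Hlev].
    destruct (Hlev (S e) ltac:(lia)) as [X1 X2 X3 X4 X5 X6 X7 X8 X9 X10].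
    pose proof (stack_total d h b k eta la l m (S e) (conj Hst0 Hlev) ltac:(lia)) as Htot.
    assert (Hh : sz (seg l (S e) (S k)) = sz (l (S e)) + sz (seg l (S (S e)) (S k))).
    { rewrite seg_head, sz_app by lia. reflexivity. }
    assert (Hc1 : cst eta (S e) = 1) by (unfold cst; destruct (Nat.leb_spec (S e) eta); lia).
    assert (Hs1 : slack eta (S e) = 1) by (unfold slack; destruct (Nat.leb_spec (S e) eta); lia).
    assert (Hg1 : gap eta (S e) = 4) by (unfold gap; destruct (Nat.leb_spec (S e) eta); lia).
    assert (Hc2 : cst e (S e) = 3) by (unfold cst; destruct (Nat.leb_spec (S e) e); lia).
    assert (Hs2 : slack e (S e) = 9) by (unfold slack; destruct (Nat.leb_spec (S e) e); lia).
    assert (Hg2 : gap e (S e) = 2) by (unfold gap; destruct (Nat.leb_spec (S e) e); lia).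
    w_seq; w_asg; red1; try lia.
    w_seq; w_asg; red1; rewrite ?Y9, ?Y10, ?Y15, ?B3 by lia;
      replace (b + S e - 1) with (b + e) by lia; rewrite ?T2k, ?T2e; try lia.
    replace (sz (seg l 0 (S k)) - sz (seg l 0 (S e))) with (sz (seg l (S e) (S k))) by lia.
    w_seq; w_asg; red1; rewrite ?Y9; try lia.
    w_seq; w_asg; red1; rewrite ?Y10; try lia.
    w_seq; w_asg; red1; rewrite ?Y17; try lia.
    w_seq; w_asg; red1; rewrite ?Y15; try lia.
    w_seq.
    match goal with |- wp _ ?h0 _ => set (h4 := h0) end.
    assert (K4 : keeps [rX; rZ; rBs; rK; rBs'; rK'] [] h3 h4) by (unfold h4; keeps_tac).
    assert (G4 : grows h3 h4) by (unfold h4; grows_tac).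
    eapply wp_push with (k := e) (x := seg l (S e) (S k)) (mx := m (S e)) (eta := e) (la := la) (l := l) (m := m)
      (b := q).
    1: { eapply good_same; [| |exact Go3]; reflexivity. }
    1: { reflexivity. }
    1: { reflexivity. }
    1: { eapply stack_move; [eapply grows_trans; [exact G3|exact G4]| |auto|exact S2'].
         intros a j Ha Hj. unfold h4. red1. now rewrite B3 by lia. }
    1: { unfold h4. eapply unit_le_eq; [exact G4| | |exact U3]; [reflexivity|].
         cbn [Nat.eqb Nat.max]. rewrite Hc1, Hc2. lia. }
    1: { reflexivity. }
    1: { lia. }
    1: { rewrite Hs2. split.
         - assert (lam (sz (l (S e))) <= lam (sz (seg l (S e) (S k)))) by (apply lam_le; lia). lia.
         - assert (lam (sz (seg l (S e) (S k))) <= lam (sz (l (S e))) + 8) by (apply lam_double_le; lia). lia. }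
    1: { exact X9. }
    1: { intros He1. destruct (X10 ltac:(lia)) as [E1 E2]. replace (S e - 1) with e in * by lia.
         rewrite Hg1 in E2. rewrite Hg2. split; lia. }
    1: { lia. }
    1: { unfold h4. red1. lia. }
    1: { lia. }
    intros h5 S5 G5 Go5 T5 N5 K5 F5. pose proof K5 as [V5 A5]. pose proof K4 as [V4 A4].
    assert (Z20 : vr h5 rBs' = b) by (rewrite V5 by (cbn; lia); reflexivity).
    assert (Z21 : vr h5 rK' = k) by (rewrite V5 by (cbn; lia); reflexivity).
    assert (Z15 : vr h5 rH = S e) by (rewrite V5 by (cbn; lia); exact Y15).
    assert (Z14 : vr h5 rW = x) by (rewrite V5 by (cbn; lia); exact Y14).
    w_seq; w_asg; red1; rewrite ?Z20; try lia.
    w_seq; w_asg; red1; rewrite ?Z21; try lia.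
    w_sto; red1; rewrite ?Z14, ?Z15; try lia.
    match goal with |- Q ?h0 => set (h6 := h0) end.
    assert (G6 : grows h5 h6) by (unfold h6; grows_tac).
    change (tk h4) with (tk h3) in T5. change (vr h4 5) with (vr h3 5) in N5.
    eapply HQ with (k' := S e) (h' := h6).
    + lia.
    + unfold h6. red1. unfold update. now rewrite Nat.eqb_refl.
    + eapply stack_move; [exact G6| |auto|exact S5]. intros a j Ha Hj. unfold h6. arr_tac.
    + rewrite seg_last, upd_same by lia. rewrite <- (seg_app l 0 (S e) (S k)) by lia. f_equal.
      apply seg_ext. intros j Hj. apply upd_other. lia.
    + eapply grows_trans; [exact G2|]. eapply grows_trans; [exact G3|]. eapply grows_trans; [exact G4|].
      eapply grows_trans; [exact G5|exact G6].
    + eapply good_same; [| |exact Go5]; [reflexivity|]. intros a Ha. unfold h6. arr_tac.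
    + unfold h6. red1. lia.
    + unfold h6. red1. lia.
    + intros i Hi. unfold h6. red1. rewrite A5 by (cbn; lia). unfold h4. red1. rewrite B3, A2 by (cbn; lia). arr_tac.
    + apply keeps_trans with (h2 := h2).
      { eapply keeps_trans; [|eapply keeps_incl; [| |exact K2]; incl_tac]. keeps_tac. }
      apply keeps_trans with (h2 := h3); [eapply keeps_incl; [| |exact K3]; incl_tac|].
      split.
      * intros y Hy. unfold h6. red1. unfold update.
        destruct (Nat.eqb_spec y 10) as [->|H10]; [now rewrite Y10|].
        destruct (Nat.eqb_spec y 9) as [->|H9]; [now rewrite Y9|].
        rewrite V5 by (cbn in *; lia). apply V4. cbn in *; lia.
      * intros a Ha. unfold h6. red1. destruct (Nat.eqb_spec a 17) as [->|]; [cbn in Ha; lia|].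
        rewrite A5 by (cbn in *; lia). apply A4. cbn. tauto.
    + intros a i Ha Hi. unfold h6. transitivity (ar h5 a i); [arr_tac|].
      rewrite F5 by lia. unfold h4. red1. rewrite B3 by lia. apply C2; lia.
Qed.

(** * The forest of longer children *)

Variable O : list nat.
Variables hv lt sd eta lng hd nxt : nat -> nat.

(* [u] hangs below [hv u], its longer child; [lt u] is the shorter one and [sd u]
   the side of the latter, 2 marking the roots.  [eta u] is the height of the
   subtree of [u], [lng u - 1] the child of [u] at which it is attained, and
   [hd], [nxt] link the children of each node. *)
Record forest : Prop := Forest {
  fo_n : forall u, In u O -> u < n;
  fo_nodup : NoDup O;
  fo_ln : forall u, In u O -> 0 < ln u <= zmax;
  fo_st : In st O /\ ln st = zmax;
  fo_root : forall u, In u O -> ~ sd u < 2 -> sd u = 2 /\ hv u = u;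
  fo_pair : forall u, In u O -> sd u < 2 ->
    In (lt u) O /\ In (hv u) O /\ ln u = ln (hv u) + ln (lt u) /\ ln (lt u) <= ln (hv u) /\ eta u < eta (hv u);
  fo_ord : forall dn u rs, O = dn ++ u :: rs -> sd u < 2 -> In (hv u) dn;
  fo_lng : forall u v, In v O -> lng v = S u -> In u O /\ sd u < 2 /\ hv u = v /\ eta v = S (eta u);
  fo_ch : forall u, In u O -> exists ch, linked nxt (hd u) ch /\ NoDup ch /\
    forall x, In x ch <-> In x O /\ sd x < 2 /\ hv x = u }.

Record static (h : astate) : Prop := Static {
  st_m : vr h rM = length O;
  st_ord : forall i, i < length O -> ar h aOrd i = nth i O 0;
  st_len : forall u, In u O -> ar h aLen u = ln u;
  st_hv : forall u, In u O -> ar h aHv u = hv u;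
  st_lt : forall u, In u O -> sd u < 2 -> ar h aLt u = lt u;
  st_sd : forall u, In u O -> ar h aSd u = sd u;
  st_eta : forall u, In u O -> ar h aEta u = eta u;
  st_lng : forall u, In u O -> ar h aLng u = lng u;
  st_hd : forall u, In u O -> ar h aHd u = hd u;
  st_nxt : forall u, In u O -> sd u < 2 -> ar h aNxt u = nxt u }.
Arguments st_m {h}.
Arguments st_ord {h}.
Arguments st_len {h}.
Arguments st_hv {h}.
Arguments st_lt {h}.
Arguments st_sd {h}.
Arguments st_eta {h}.
Arguments st_lng {h}.
Arguments st_hd {h}.
Arguments st_nxt {h}.

Lemma static_same h h' :
  vr h' rM = vr h rM -> (forall a, aLen <= a <= aNxt -> ar h' a = ar h a) -> static h -> static h'.
Proof.
  intros Hm Ha [S1 S2 S3 S4 S5 S6 S7 S8 S9 S10].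
  constructor; intros; rewrite ?Hm, ?Ha by lia; auto.
Qed.

(* Such a [u] works on a stack of its own; the others inherit the one of [hv u]. *)
Definition opens u := lng (hv u) <> S u.

(* The potential that pays for pops and for copying stacks. *)
Definition pot (h : astate) (rs : list nat) : nat := list_sum (map (fun x => 2 * ar h aKk x) rs).

(** Reserve for the inheriting child while it is still ahead in the list: [2 * k] for the potential
    it receives with the stack, 1 for its loop iteration. *)
Definition extra u k (ch : list nat) : nat :=
  if existsb (fun x => lng u =? S x) ch then 2 * k + 1 else 0.

Lemma extra_not u k ch : (forall x, In x ch -> lng u <> S x) -> extra u k ch = 0.
Proof.
  intros H. unfold extra. destruct (existsb _ ch) eqn:E; [|reflexivity].
  apply existsb_exists in E as (x & Hx & Ex). apply Nat.eqb_eq in Ex. now apply H in Hx.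
Qed.

Lemma extra_tail u k x ch : lng u <> S x -> extra u k (x :: ch) = extra u k ch.
Proof. intros H. unfold extra. cbn. now destruct (Nat.eqb_spec (lng u) (S x)). Qed.

Hypothesis Hfo : forest.

(** Letters are listed from the root outwards, so this is the right context itself but the reverse
    of the left one. *)
Inductive lets (d : bool) : nat -> list nat -> Prop :=
| lets_root u : sd u = 2 -> lets d u []
| lets_pair u ls : sd u < 2 -> lets d (hv u) ls ->
    lets d u (ls ++ if sd u =? Nat.b2n d then [lt u] else []).

Lemma lets_size d u ls : lets d u ls -> In u O -> sz ls < ln u.
Proof.
  induction 1 as [u Hu|u ls Hu Hl IH]; intros HO.
  - apply (fo_ln Hfo) in HO. cbn. lia.
  - destruct (fo_pair Hfo u HO Hu) as (H1 & H2 & H3 & H4 & _). specialize (IH H2).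
    rewrite sz_app. destruct (_ =? _); unfold sz in *; cbn; lia.
Qed.

Lemma unit_le_nil d h id b b' : unit_le d h id [] b -> unit_le d h id [] b'.
Proof. intros [H|(hx & _ & H & _)]; [now left|]. now apply un_nonempty in H. Qed.

(** * Visiting a node *)

Section Visit.
Variables bas en : nat -> nat.

(** The state in which the node above leaves [u]: the stack is that of [hv u], before the letter of
    [u]. The summand [eta u + 2] leaves room for one push at each of the [eta u + 1] nodes still on
    the path. *)
Definition pending d h u la (ls : list nat) : Prop :=
  exists l m, stack d h (bas u) (ar h aKk u) (eta u) la l m /\
    seg l 0 (S (ar h aKk u)) = ls /\ bas u + ar h aKk u + eta u + 2 <= en u.

Lemma wp_children d h u b k l m ch rs (Q : astate -> Prop) :
  static h -> good h -> In u O -> (forall x, In x O -> x < n) ->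
  ar h aBas = bas ->
  vr h rU = u -> vr h rBs = b -> b = bas u -> vr h rK = k ->
  stack d h b k (eta u) (lam (ln u)) l m -> sz (seg l 0 (S k)) < 2 ^ w ->
  linked nxt (hd u) ch -> NoDup ch -> incl ch rs -> NoDup rs ->
  (forall x, In x ch -> In x O /\ sd x < 2 /\ hv x = u /\ eta x < eta u) ->
  (forall x, In x ch -> ~ opens x -> bas x = bas u /\ en x = en u) ->
  (forall x, In x ch -> opens x -> en x = bas x + 16 * (eta x + 1) /\ en x <= lim /\
     (en x <= bas u \/ en u <= bas x) /\ ar h aKk x = 16 * (eta x + 1)) ->
  (forall x y, In x ch -> In y ch -> opens x -> opens y -> x <> y -> en x <= bas y \/ en y <= bas x) ->
  b + k < lim -> b + k + eta u + 1 <= en u -> vr h rNo + pot h rs + extra u k ch + 10 < lim ->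
  (forall h', static h' -> good h' -> grows h h' -> 
     (forall x, In x ch -> pending d h' x (lam (ln u)) (seg l 0 (S k))) ->
     (forall x, ~ In x ch -> ar h' aKk x = ar h aKk x) ->
     (forall a i, eX <= a <= eP -> (forall x, In x ch -> opens x -> ~ bas x <= i < en x) -> ar h' a i = ar h a i) ->
     tk h' + pot h' rs <= tk h + pot h rs + extra u k ch ->
     vr h' rNo + pot h' rs <= vr h rNo + pot h rs + extra u k ch ->
     keeps [rNo; rA; rB; rC; rX; rZ; rW; rH; rJ; rQ; rP; rN; rBs'; rK']
       [oTag; oFst; oSnd; aKk; eX; eS; eT; eL; eR; eP] h h' -> Q h') ->
  wp (children cap d) h Q.
Proof.
  intros Hs Hg HuO HO Hbas Hu Hb Hbu Hk Hst Hsz Hlk Hnd Hinc Hndr Hch Hlong Hstart Hdisj Hbl Hen Hno HQ.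
  pose proof Hfits as [Hbig Hw].
  assert (HuL : u < lim) by (specialize (HO u HuO); lia).
  unfold children.
  w_seq; w_asg; red1; rewrite ?Hu; try lia. rewrite (st_hd Hs u HuO).
  set (keep1 := keeps [rNo; rA; rB; rC; rX; rZ; rW; rH; rJ; rQ; rP; rN; rBs'; rK']
       [oTag; oFst; oSnd; aKk; eX; eS; eT; eL; eR; eP] h).
  eapply wp_whl with (B := tk h + pot h rs + extra u k ch) (I := fun h1 => exists ch1 ch2, ch = ch1 ++ ch2 /\
     linked nxt (vr h1 rW) ch2 /\ good h1 /\ grows h h1 /\
     (forall x, In x ch1 -> pending d h1 x (lam (ln u)) (seg l 0 (S k))) /\
     (forall x, ~ In x ch1 -> ar h1 aKk x = ar h aKk x) /\
     (forall a i, eX <= a <= eP -> (forall x, In x ch1 -> opens x -> ~ bas x <= i < en x) -> ar h1 a i = ar h a i) /\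
     tk h1 + pot h1 rs + extra u k ch2 <= tk h + pot h rs + extra u k ch /\
     vr h1 rNo + pot h1 rs + extra u k ch2 <= vr h rNo + pot h rs + extra u k ch /\
     keep1 h1).
  1: exact Hfits.
  - exists [], ch. red1. split; [reflexivity|]. split; [exact Hlk|].
    split; [eapply good_same; [| |exact Hg]; reflexivity|]. split; [grows_tac|].
    split; [easy|]. split; [reflexivity|]. split; [reflexivity|].
    split; [reflexivity|]. split; [reflexivity|]. unfold keep1. keeps_tac.
  - intros h1 (ch1 & ch2 & H1 & H2 & H3 & H4 & H5 & H6 & H7 & H8 & H9 & H10). red1. split; [exact I|lia].
  - intros h1 (ch1 & ch2 & H1 & H2 & H3 & H4 & H5 & H6 & H7 & H8 & H9 & H10).
    red1. intros Hne. destruct ch2 as [|x ch2]; [cbn in H2; lia|].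
    destruct H2 as [H2 H2'].
    pose proof H10 as [V1 A1].
    assert (Hxch : In x ch) by (rewrite H1; apply in_elt).
    destruct (Hch x Hxch) as (HxO & Hxsd & Hxhv & Hxeta).
    assert (HxL : x < lim) by (specialize (HO x HxO); lia).
    assert (Hnd' : ~ In x ch1 /\ ~ In x ch2).
    { rewrite H1 in Hnd. apply NoDup_remove_2 in Hnd. rewrite in_app_iff in Hnd. tauto. }
    assert (Ss : static h1).
    { eapply static_same; [| |exact Hs]; [apply V1; cbn; lia|]. intros a Ha. apply A1. cbn; lia. }
    assert (W1 : vr h1 rU = u) by (rewrite V1 by (cbn; lia); exact Hu).
    assert (W9 : vr h1 rBs = b) by (rewrite V1 by (cbn; lia); exact Hb).
    assert (W10 : vr h1 rK = k) by (rewrite V1 by (cbn; lia); exact Hk).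
    assert (Hpend : forall h2, (forall y, y <> x -> ar h2 aKk y = ar h1 aKk y) -> grows h1 h2 ->
       (forall a i, eX <= a <= eP -> ~ (opens x /\ bas x <= i < en x) -> ar h2 a i = ar h1 a i) ->
       forall y, In y ch1 -> pending d h2 y (lam (ln u)) (seg l 0 (S k))).
    { intros h2 P1 P2 P3 y Hy. destruct (H5 y Hy) as (l' & m' & Q1 & Q2 & Q3).
      assert (Hyx : y <> x) by (intros ->; tauto).
      assert (Hych : In y ch) by (rewrite H1; apply in_app_iff; auto).
      exists l', m'. rewrite (P1 y Hyx). split; [|auto].
      eapply stack_move; [exact P2| |auto|exact Q1].
      intros a j Ha Hj. apply P3; [exact Ha|]. intros [Hsx Hr].
      destruct (Hstart x Hxch Hsx) as (_ & _ & D1 & _).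
      destruct (Nat.eq_dec (lng (hv y)) (S y)) as [E|E].
      - destruct (Hlong y Hych ltac:(unfold opens; tauto)) as [E1 E2]. lia.
      - destruct (Hdisj x y Hxch Hych Hsx E ltac:(congruence)); lia. }
    assert (HpotE : forall h2, (forall y, y <> x -> ar h2 aKk y = ar h1 aKk y) ->
       pot h2 rs + 2 * ar h1 aKk x = pot h1 rs + 2 * ar h2 aKk x).
    { intros h2 P1. unfold pot. apply (list_sum_le_change (fun y => 2 * ar h1 aKk y) (fun y => 2 * ar h2 aKk y)); auto. }
    assert (Hkk : ar h1 aKk x = ar h aKk x) by (apply H6; tauto).
    w_seq; w_asg; red1; [lia|]. rewrite H2. replace (S x - 1) with x by lia.
    w_seq; w_ite; red1; rewrite ?W1, ?(st_lng Ss u HuO); [lia| |]; intros Hl.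
    + destruct (Nat.eqb_spec (lng u) (x + 1)) as [El|]; [clear Hl|now destruct Hl].
      assert (Hns : ~ opens x) by (unfold opens; rewrite Hxhv; lia).
      w_sto; red1; rewrite ?W10; try lia.
      w_asg; red1; try lia. rewrite (st_nxt Ss x HxO Hxsd).
      match goal with |- ?P => match P with context [setv ?h0 14 ?v] => set (h2 := setv h0 14 v) end end.
      assert (P1 : forall y, y <> x -> ar h2 aKk y = ar h1 aKk y) by (intros; unfold h2; arr_tac).
      assert (P1x : ar h2 aKk x = k) by (unfold h2; arr_tac).
      assert (P2 : grows h1 h2) by (unfold h2; grows_tac).
      assert (P3 : forall a i, eX <= a <= eP -> ar h2 a i = ar h1 a i) by (intros; unfold h2; arr_tac).
      assert (Hex : extra u k (x :: ch2) = 2 * k + 1 /\ extra u k ch2 = 0).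
      { split; [unfold extra; cbn; replace (lng u) with (S x) by lia; now rewrite Nat.eqb_refl|].
        apply extra_not. intros y Hy E. assert (y = x) as -> by lia. tauto. }
      exists (ch1 ++ [x]), ch2. split; [rewrite <- app_assoc; exact H1|]. split; [exact H2'|].
      split; [eapply good_same; [| |exact H3]; [reflexivity|]; intros; unfold h2; arr_tac|].
      split; [eapply grows_trans; [exact H4|exact P2]|]. split; [|split; [|split; [|split; [|split]]]].
      * intros y Hy. apply in_app_iff in Hy as [Hy|[<-|[]]]; [now apply Hpend; auto|].
        destruct (Hlong x Hxch Hns) as [E1 E2]. exists l, m. rewrite P1x. split; [|split; [reflexivity|lia]].
        rewrite E1, <- Hbu. eapply stack_weaken; [| |eapply stack_move; [| |auto|exact Hst]]; [lia|lia| |].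
        -- eapply grows_trans; [exact H4|exact P2].
        -- intros a j Ha Hj. rewrite P3 by exact Ha. apply H7; [exact Ha|].
           intros y Hy Hsy. assert (Hych : In y ch) by (rewrite H1; apply in_app_iff; auto).
           destruct (Hstart y Hych Hsy) as (_ & _ & D1 & _). lia.
      * intros y Hy. rewrite in_app_iff in Hy. cbn in Hy. transitivity (ar h1 aKk y); [apply P1; intros ->; tauto|apply H6; tauto].
      * intros a i Ha Hi. transitivity (ar h1 a i); [now apply P3|]. apply H7; [exact Ha|].
        intros y Hy. apply Hi, in_app_iff. auto.
      * change (tk h2) with (S (tk h1)). specialize (HpotE h2 P1). lia.
      * change (vr h2 5) with (vr h1 5). specialize (HpotE h2 P1). lia.
      * unfold keep1. eapply keeps_trans; [exact H10|]. unfold h2. keeps_tac.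
    + destruct (Nat.eqb_spec (lng u) (x + 1)) as [|El]; [discriminate|clear Hl].
      assert (Hsx : opens x) by (unfold opens; rewrite Hxhv; lia).
      destruct (Hstart x Hxch Hsx) as (E1 & E2 & E3 & E4).
      rewrite (extra_tail u k x ch2) in * by lia.
      assert (Hb1 : bas x < en x) by lia.
      match goal with |- wp _ ?h0 _ => set (h2 := h0) end.
      assert (G2 : grows h1 h2) by (unfold h2; grows_tac).
      eapply wp_branch with (x := x) (b := b) (k := k) (e := eta x) (eta := eta u) (la := lam (ln u)) (l := l) (m := m)
        (q := bas x).
      1: { eapply good_same; [| |exact H3]; reflexivity. }
      1: exact W9.
      1: exact W10.
      1: reflexivity.
      1: exact HxL.
      1: { unfold h2. red1. rewrite A1 by (cbn; lia). now rewrite Hbas. }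
      1: { exact (st_eta Ss x HxO). }
      1: exact Hxeta.
      1: { eapply stack_move; [| |auto|exact Hst].
           - eapply grows_trans; [exact H4|exact G2].
           - intros a j Ha Hj. unfold h2. red1. apply H7; [exact Ha|].
             intros y Hy Hsy. assert (Hych : In y ch) by (rewrite H1; apply in_app_iff; auto).
             destruct (Hstart y Hych Hsy) as (_ & _ & D1 & _). lia. }
      1: exact Hsz.
      1: lia.
      1: lia.
      1: exact Hbl.
      1: { unfold h2. red1. lia. }
      intros h3 k' l' m' B1 B2 B3 B4 B5 B6 B7 B8 B9 B10 B11.
      change (tk h2) with (S (tk h1)) in B7. change (vr h2 5) with (vr h1 5) in B8.
      pose proof B10 as [V3 A3].
      assert (W14 : vr h3 rW = x) by (rewrite V3 by (cbn; lia); reflexivity).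
      w_asg; red1; rewrite ?W14; try lia.
      rewrite A3 by (cbn; lia). change (ar h2 aNxt) with (ar h1 aNxt). rewrite (st_nxt Ss x HxO Hxsd).
      match goal with |- ?P => match P with context [setv ?h0 14 ?v] => set (h4 := setv h0 14 v) end end.
      assert (G4 : grows h3 h4) by (unfold h4; grows_tac).
      assert (P1 : forall y, y <> x -> ar h4 aKk y = ar h1 aKk y).
      { intros y Hy. unfold h4. red1. rewrite B9 by exact Hy. reflexivity. }
      assert (P2 : grows h1 h4).
      { eapply grows_trans; [exact G2|]. eapply grows_trans; [exact B5|exact G4]. }
      assert (P3 : forall a i, eX <= a <= eP -> ~ bas x <= i < en x -> ar h4 a i = ar h1 a i).
      { intros a i Ha Hi. unfold h4. red1. rewrite B11 by lia. reflexivity. }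
      exists (ch1 ++ [x]), ch2. split; [rewrite <- app_assoc; exact H1|]. split; [exact H2'|].
      split; [eapply good_same; [| |exact B6]; [reflexivity|]; intros; unfold h4; arr_tac|].
      split; [eapply grows_trans; [exact H4|exact P2]|]. split; [|split; [|split; [|split; [|split]]]].
      * intros y Hy. apply in_app_iff in Hy as [Hy|[<-|[]]].
        { apply Hpend; auto. }
        exists l', m'. change (ar h4 aKk x) with (ar h3 aKk x). rewrite B2. split; [|split; [exact B4|lia]].
        eapply stack_move; [exact G4| |auto|exact B3]. reflexivity.
      * intros y Hy. rewrite in_app_iff in Hy. cbn in Hy. transitivity (ar h1 aKk y); [apply P1; intros ->; tauto|apply H6; tauto].
      * intros a i Ha Hi. transitivity (ar h1 a i).
        { apply P3; [exact Ha|]. apply Hi; auto. apply in_app_iff; cbn; auto. }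
        apply H7; [exact Ha|]. intros y Hy. apply Hi, in_app_iff. auto.
      * change (tk h4) with (tk h3). specialize (HpotE h4 P1). change (ar h4 aKk x) with (ar h3 aKk x) in HpotE. lia.
      * change (vr h4 5) with (vr h3 5). specialize (HpotE h4 P1). change (ar h4 aKk x) with (ar h3 aKk x) in HpotE. lia.
      * unfold keep1. eapply keeps_trans; [exact H10|]. eapply keeps_trans with (h2 := h2); [unfold h2; keeps_tac|].
        eapply keeps_trans; [eapply keeps_incl; [| |exact B10]; incl_tac|]. unfold h4. keeps_tac.
  - intros h1 (ch1 & ch2 & H1 & H2 & H3 & H4 & H5 & H6 & H7 & H8 & H9 & H10).
    red1. intros E0. destruct ch2 as [|x ch2]; [|destruct H2; lia].
    rewrite app_nil_r in H1. subst ch1. pose proof H10 as [V1 A1].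
    assert (extra u k [] = 0) by reflexivity.
    apply HQ; auto; try lia.
    eapply static_same; [| |exact Hs]; [apply V1; cbn; lia|]. intros a Ha. apply A1. cbn; lia.
Qed.

Record layout : Prop := Layout {
  la_long : forall u, In u O -> ~ opens u -> bas u = bas (hv u) /\ en u = en (hv u);
  la_start : forall u, In u O -> opens u -> en u = bas u + 16 * (eta u + 1);
  la_lim : forall u, In u O -> en u <= lim;
  la_disj : forall u v, In u O -> In v O -> opens u -> opens v -> u <> v -> en u <= bas v \/ en v <= bas u }.

Hypothesis Hla : layout.

(** Two height bounds are kept for a context. The one by [ln u] comes from [m 1 < lam (ln u)] and
    balances the image of [u]. The one by the context alone balances the auxiliary rule that joins
    root and right context. *)
Lemma wp_visit d h u ch rs (Q : astate -> Prop) :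
  static h -> good h -> In u O -> ar h aBas = bas -> vr h rU = u ->
  linked nxt (hd u) ch -> NoDup ch -> (forall x, In x ch <-> In x O /\ sd x < 2 /\ hv x = u) ->
  incl ch rs -> NoDup rs ->
  (sd u < 2 -> exists ls, lets d (hv u) ls /\ pending d h u (lam (ln (hv u))) ls) ->
  (sd u = 2 -> opens u) ->
  (forall x, In x ch -> opens x -> (en x <= bas u \/ en u <= bas x) /\ ar h aKk x = 16 * (eta x + 1)) ->
  vr h rNo + pot h rs + 2 * ar h aKk u + 30 < lim ->
  (forall h' ls, static h' -> good h' -> grows h h' -> lets d u ls ->
     unit_le d h' (ar h' (aFull + Nat.b2n d) u) ls (Nat.min (10 * lam (ln u) + 5) (10 * lam (sz ls) + 15)) ->
     (forall x, In x ch -> pending d h' x (lam (ln u)) ls) ->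
     (forall x, ~ In x ch -> ar h' aKk x = ar h aKk x) ->
     (forall a i, eX <= a <= eP -> ~ bas u <= i < en u ->
        (forall x, In x ch -> opens x -> ~ bas x <= i < en x) -> ar h' a i = ar h a i) ->
     (forall x, x <> u -> ar h' (aFull + Nat.b2n d) x = ar h (aFull + Nat.b2n d) x) ->
     tk h' + pot h' rs <= tk h + pot h rs + 2 * ar h aKk u + 10 ->
     vr h' rNo + pot h' rs <= vr h rNo + pot h rs + 2 * ar h aKk u + 10 ->
     keeps [rNo; rA; rB; rC; rBs; rK; rX; rZ; rAcc; rW; rH; rJ; rQ; rP; rN; rBs'; rK']
       [oTag; oFst; oSnd; aKk; aFull + Nat.b2n d; eX; eS; eT; eL; eR; eP] h h' -> Q h') ->
  wp (visit cap d) h Q.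
Proof.
  intros Hs Hg HuO Hbas Hu Hlk Hnd Hch Hinc Hndr Hpre Hroot Hst Hno HQ.
  pose proof Hfits as [Hbig Hw].
  assert (HuL : u < lim) by (pose proof (fo_n Hfo u HuO); lia).
  pose proof (fo_st Hfo) as [HstO Hlst].
  assert (HstL : st < lim) by (pose proof (fo_n Hfo st HstO); lia).
  pose proof (fo_ln Hfo u HuO) as Hlu.
  assert (Hdn : aFull + Nat.b2n d = 18 \/ aFull + Nat.b2n d = 19) by (destruct d; auto).
  unfold visit. remember (aFull + Nat.b2n d) as fa eqn:Hfa. clear Hfa.
  set (b := bas u).
  (* The part of a visit common to a root, a node with a letter on side [d] and a node with its
     letter on the other side. *)
  assert (Hmid : forall h1 k l m ls,
    static h1 -> good h1 -> grows h h1 -> vr h1 rBs = b -> vr h1 rK = k ->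
    stack d h1 b k (eta u) (lam (ln u)) l m -> seg l 0 (S k) = ls -> lets d u ls ->
    b + k + eta u + 1 <= en u -> ar h1 aKk = ar h aKk ->
    (forall a i, eX <= a <= eP -> ~ bas u <= i < en u -> ar h1 a i = ar h a i) ->
    tk h1 + 2 * k <= tk h + 2 * ar h aKk u + 3 -> vr h1 rNo + 2 * k <= vr h rNo + 2 * ar h aKk u + 5 ->
    keeps [rNo; rA; rB; rC; rBs; rK; rX; rZ; rAcc; rP] [oTag; oFst; oSnd; eX; eS; eT; eL; eR; eP] h h1 ->
    wp (asg cap rH (Cn 0);; suffix cap d;; sto cap fa (Vr rU) (Vr rC);; children cap d) h1 Q).
  { intros h1 k l m ls M1 M2 M3 M4 M5 M6 M7 M8 M9 M10 M11 M12 M13 M14.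
    pose proof M14 as [V1 A1].
    pose proof (la_lim Hla u HuO) as Hlim.
    assert (Hexb : extra u k ch <= 2 * k + 1) by (unfold extra; destruct (existsb _ _); lia).
    assert (Hpot1 : pot h1 rs = pot h rs) by (unfold pot; now rewrite M10).
    pose proof (lets_size d u ls M8 HuO) as Hls.
    w_seq; w_asg; red1; [lia|].
    w_seq. eapply wp_suffix with (b := b) (k := k) (i := 0) (eta := eta u) (la := lam (ln u)) (l := l) (m := m)
     .
    1: { eapply good_same; [| |exact M2]; reflexivity. }
    1: exact M4.
    1: exact M5.
    1: reflexivity.
    1: { eapply stack_move; [| |auto|exact M6]; [grows_tac|reflexivity]. }
    1: now left.
    1: lia.
    1: { red1. lia. }
    intros h2 U2 G2 Go2 T2 N2 K2. pose proof K2 as [V2 A2]. red1in T2. red1in N2.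
    assert (W1 : vr h2 rU = u).
    { rewrite V2 by (cbn; lia). red1. rewrite V1 by (cbn; lia). exact Hu. }
    w_seq. w_sto; cbn [ok val]; rewrite ?W1; try lia.
    match goal with |- wp _ ?h0 _ => set (h3 := h0) end.
    assert (K3 : keeps [] [fa] h2 h3).
    { unfold h3. split; [reflexivity|]. intros a Ha. cbn [ar seta].
      destruct (Nat.eqb_spec a fa); [subst a; cbn [In] in Ha; tauto|reflexivity]. }
    pose proof K3 as [V3 A3].
    assert (G3 : grows h2 h3).
    { apply grows_same; [reflexivity|]. intros a Ha. apply A3. cbn [In]. lia. }
    assert (A23 : forall a, ~ In a [oTag; oFst; oSnd; fa] -> ar h3 a = ar h1 a).
    { intros a Ha. rewrite A3 by (cbn [In] in *; tauto). rewrite A2 by (cbn [In] in *; tauto). reflexivity. }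
    assert (Gh1 : grows h1 h3).
    { eapply grows_trans; [|exact G3]. eapply grows_trans; [|exact G2]. grows_tac. }
    assert (Hpot3 : pot h3 rs = pot h rs).
    { unfold pot. rewrite A23 by (cbn [In]; lia). now rewrite M10. }
    change (tk h3) with (tk h2) in *. 
    eapply wp_children with (u := u) (b := b) (k := k) (l := l) (m := m) (ch := ch) (rs := rs).
    1: { eapply static_same; [| |exact M1].
         - rewrite V3, V2 by (cbn; lia). reflexivity.
         - intros a Ha. apply A23. cbn [In]. lia. }
    1: { eapply good_same; [| |exact Go2]; [reflexivity|]. intros a Ha. apply A3. cbn [In]; lia. }
    1: exact HuO.
    1: exact (fo_n Hfo).
    1: { rewrite A23 by (cbn [In]; lia). rewrite A1 by (cbn; lia). exact Hbas. }
    1: { rewrite V3 by (cbn; lia). exact W1. }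
    1: { rewrite V3, V2 by (cbn; lia). exact M4. }
    1: reflexivity.
    1: { rewrite V3, V2 by (cbn; lia). exact M5. }
    1: { eapply stack_move; [exact Gh1| |auto|exact M6]. intros a j Ha Hj. rewrite A23 by (cbn [In]; lia). reflexivity. }
    1: { rewrite M7. lia. }
    1: exact Hlk.
    1: exact Hnd.
    1: exact Hinc.
    1: exact Hndr.
    1: { intros x Hx. apply Hch in Hx as (X1 & X2 & X3). destruct (fo_pair Hfo x X1 X2) as (_ & _ & _ & _ & X4).
         rewrite X3 in X4. auto. }
    1: { intros x Hx Hsx. apply Hch in Hx as (X1 & X2 & X3). rewrite <- X3. now apply (la_long Hla). }
    1: { intros x Hx Hsx. pose proof Hx as Hx'. apply Hch in Hx' as (X1 & X2 & X3).
         destruct (Hst x Hx Hsx) as [E1 E2]. rewrite A23, M10 by (cbn [In]; lia).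
         pose proof (la_start Hla x X1 Hsx). pose proof (la_lim Hla x X1). auto. }
    1: { intros x y Hx Hy Hsx Hsy Hxy. apply Hch in Hx as (X1 & _). apply Hch in Hy as (Y1 & _).
         now apply (la_disj Hla). }
    1: lia.
    1: exact M9.
    1: { rewrite V3 by (cbn; lia). lia. }
    intros h4 S4 Go4 G4 P4 KK4 F4 T4 N4 K4. pose proof K4 as [V4 A4].
    rewrite (V3 rNo) in N4 by (cbn; lia). change (tk h3) with (tk h2) in T4.
    assert (F34 : ar h4 fa = ar h3 fa) by (apply A4; destruct d; cbn; lia).
    eapply HQ with (ls := ls); auto.
    - eapply grows_trans; [exact M3|]. eapply grows_trans; [exact Gh1|exact G4].
    - rewrite F34. unfold h3 at 1. cbn [ar seta]. rewrite Nat.eqb_refl. unfold update. rewrite Nat.eqb_refl.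
      rewrite M7 in U2. destruct k as [|k'].
      + rewrite seg_one in M7. destruct M6 as [(E0 & _) _]. rewrite E0 in M7. subst ls.
        eapply unit_le_nil. eapply unit_le_mono; [|reflexivity|exact U2]. eapply grows_trans; [exact G3|exact G4].
      + eapply unit_le_mono; [eapply grows_trans; [exact G3|exact G4]| |exact U2].
        cbn [Nat.eqb Nat.max]. destruct M6 as [_ Hlev].
        pose proof (lv_la (Hlev 1 ltac:(lia))).
        pose proof (lv_m (Hlev 1 ltac:(lia))).
        assert (lam (sz (l 1)) <= lam (sz ls)); [|lia]. apply lam_le.
        rewrite <- M7, <- (seg_app l 0 1), (seg_head l 1), !sz_app by lia. lia.
    - intros x Hx. rewrite M7 in P4. auto.
    - intros x Hx. rewrite KK4, A23, M10 by (auto; cbn [In]; lia). reflexivity.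
    - intros a i Ha Hi Hx. rewrite F4, A23, M11 by (auto; cbn [In]; lia). reflexivity.
    - intros x Hx. rewrite F34. unfold h3. cbn [ar seta]. rewrite Nat.eqb_refl. unfold update.
      destruct (Nat.eqb_spec x u); [tauto|]. rewrite A2 by (cbn; lia). red1.
      rewrite A1 by (cbn; lia). reflexivity.
    - lia.
    - lia.
    - eapply keeps_trans with (h2 := h1); [eapply keeps_incl; [| |exact M14]; incl_tac|].
      eapply keeps_trans with (h2 := h2).
      { eapply keeps_trans; [|eapply keeps_incl; [| |exact K2]; incl_tac]. keeps_tac. }
      eapply keeps_trans with (h2 := h3); [eapply keeps_incl; [| |exact K3]; incl_tac|].
      eapply keeps_incl; [| |exact K4]; incl_tac. }
  w_seq; w_asg; red1; rewrite ?Hu, ?Hbas; try lia. fold b.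
  w_seq; w_ite; red1; rewrite ?Hu, ?(st_sd Hs u HuO); [lia| |]; intros Hsd.
  - destruct (Nat.eqb_spec (sd u) 2) as [E|]; [clear Hsd|now destruct Hsd].
    pose proof (la_start Hla u HuO (Hroot E)) as Hen. fold b in Hen.
    pose proof (la_lim Hla u HuO) as Hlim.
    w_seq; w_asg; red1; try lia.
    w_seq; w_sto; red1; try lia.
    w_seq; w_sto; red1; rewrite ?(st_len Hs st HstO), ?Hlst; try lia.
    do 3 (w_seq; w_sto; red1; try lia).
    w_sto; red1; try lia.
    match goal with |- wp _ ?h0 _ => set (h1 := h0) end.
    assert (G1 : grows h h1) by (unfold h1; grows_tac).
    apply (Hmid h1 0 (fun _ => []) (fun _ => 0) []).
    + eapply static_same; [| |exact Hs]; [reflexivity|]. intros a Ha. unfold h1. arr_tac.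
    + eapply good_same; [| |exact Hg]; [reflexivity|]. intros a Ha. unfold h1. arr_tac.
    + exact G1.
    + reflexivity.
    + reflexivity.
    + split; [|lia]. unfold h1. red1. unfold update. rewrite Nat.eqb_refl. auto 10.
    + reflexivity.
    + now constructor.
    + lia.
    + unfold h1. reflexivity.
    + intros a i Ha Hi. fold b in Hi. unfold h1. arr_tac.
    + unfold h1. red1. lia.
    + unfold h1. red1. lia.
    + unfold h1. keeps_tac.
  - destruct (Nat.eqb_spec (sd u) 2) as [|E]; [discriminate|clear Hsd].
    assert (Hsd : sd u < 2).
    { destruct (Nat.lt_ge_cases (sd u) 2); [auto|]. destruct (fo_root Hfo u HuO ltac:(lia)). lia. }
    destruct (Hpre Hsd) as (ls & Hls & l & m & S1 & S2 & S3). fold b in S1, S3.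
    destruct (fo_pair Hfo u HuO Hsd) as (P1 & P2 & P3 & P4 & P5).
    pose proof (fo_ln Hfo _ P1) as Plt. pose proof (la_lim Hla u HuO) as Hlim.
    pose proof (lets_size d _ _ Hls P2) as Hsz.
    set (k := ar h aKk u) in *.
    w_seq; w_asg; red1; rewrite ?Hu; try lia. fold k.
    w_ite; red1; rewrite ?Hu, ?(st_sd Hs u HuO);
      [destruct d; cbn; lia| |]; intros Hd.
    + destruct (Nat.eqb_spec (sd u) (Nat.b2n d)) as [Ed|]; [clear Hd|now destruct Hd].
      match goal with |- wp _ ?h0 _ => set (h1 := h0) end.
      assert (G1 : grows h h1) by (unfold h1; grows_tac).
      eapply wp_letter with (u := u) (x := lt u) (b := b) (k := k) (eta := eta u) (l := l) (m := m).
      1: { eapply good_same; [| |exact Hg]; reflexivity. }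
      1: reflexivity.
      1: reflexivity.
      1: exact Hu.
      1: exact HuL.
      1: exact (fo_n Hfo _ P1).
      1: exact (st_lt Hs u HuO Hsd).
      1: exact (st_len Hs _ P1).
      1: lia.
      1: lia.
      1: { eapply stack_weaken with (la := lam (ln (hv u))); [reflexivity|apply lam_le; lia|].
           eapply stack_move; [exact G1| |auto|exact S1]. reflexivity. }
      1: { rewrite S2. lia. }
      1: lia.
      1: lia.
      1: { change (vr h1 5) with (vr h 5). lia. }
      intros h2 k' l' m' L1 L2 L3 L4 L5 L6 L7 L8 L9 L10. pose proof L9 as [V2 A2].
      change (tk h1) with (tk h) in L7. change (vr h1 5) with (vr h 5) in L8.
      apply (Hmid h2 (S k') l' m' (ls ++ [lt u])).
      * eapply static_same; [| |exact Hs]; [rewrite V2 by (cbn; lia); reflexivity|].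
        intros a Ha. rewrite A2 by (cbn [In]; lia). reflexivity.
      * exact L6.
      * eapply grows_trans; [exact G1|exact L5].
      * rewrite V2 by (cbn; lia). reflexivity.
      * exact L2.
      * exact L3.
      * now rewrite L4, S2.
      * pose proof (lets_pair d u ls Hsd Hls) as X. rewrite Ed, Nat.eqb_refl in X. exact X.
      * lia.
      * rewrite A2 by (cbn; lia). reflexivity.
      * intros a i Ha Hi. rewrite L10 by (fold b in Hi; lia). reflexivity.
      * lia.
      * lia.
      * eapply keeps_trans; [|eapply keeps_incl; [| |exact L9]; incl_tac]. unfold h1. keeps_tac.
    + destruct (Nat.eqb_spec (sd u) (Nat.b2n d)) as [|Ed]; [discriminate|clear Hd].
      apply wp_skip.
      match goal with |- wp _ ?h0 _ => set (h1 := h0) end.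
      assert (G1 : grows h h1) by (unfold h1; grows_tac).
      apply (Hmid h1 k l m ls).
      * eapply static_same; [| |exact Hs]; reflexivity.
      * eapply good_same; [| |exact Hg]; reflexivity.
      * exact G1.
      * reflexivity.
      * reflexivity.
      * eapply stack_weaken with (la := lam (ln (hv u))); [reflexivity|apply lam_le; lia|].
        eapply stack_move; [exact G1| |auto|exact S1]. reflexivity.
      * exact S2.
      * pose proof (lets_pair d u ls Hsd Hls) as X.
        destruct (Nat.eqb_spec (sd u) (Nat.b2n d)); [tauto|]. now rewrite app_nil_r in X.
      * lia.
      * reflexivity.
      * reflexivity.
      * unfold h1. red1. lia.
      * unfold h1. red1. lia.
      * unfold h1. keeps_tac.
Qed.
End Visit.
Arguments la_long {bas en}.
Arguments la_start {bas en}.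
Arguments la_lim {bas en}.
Arguments la_disj {bas en}.

(** * Regions and the cost of a pass *)

Hypothesis Hlng0 : forall v, In v O -> 0 < eta v -> lng v <> 0.

(** The number of nodes on the inheritance path that begins at [x], 0 if none does. Its sum bounds
    both the memory for stacks and the initial potential. *)
Definition heads (x : nat) : nat := if lng (hv x) =? S x then 0 else eta x + 1.

Lemma O_length : length O <= n.
Proof. apply NoDup_length_le; [exact (fo_nodup Hfo)|exact (fo_n Hfo)]. Qed.

(* A node with [eta v > 0] has exactly one long parent, whose [eta] is one less; the sum telescopes along each long path. *)
Lemma heads_sum : list_sum (map heads O) <= length O.
Proof.
  set (nh := fun x => if lng (hv x) =? S x then eta x + 1 else 0).
  assert (E1 : list_sum (map heads O) + list_sum (map nh O) = list_sum (map eta O) + length O).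
  { generalize O as l. induction l as [|x l IH]; [reflexivity|].
    unfold list_sum in *. cbn [map fold_right length]. unfold heads at 1, nh at 1.
    destruct (_ =? _); lia. }
  enough (list_sum (map eta O) <= list_sum (map nh O)) by lia.
  set (F := fun l x => if in_dec Nat.eq_dec (hv x) l then nh x else 0).
  assert (Hl : forall l, NoDup l -> incl l O ->
    list_sum (map eta l) <= list_sum (map (F l) O)).
  { induction l as [|v l IH]; intros Hnd Hinc; [cbn; lia|].
    inversion_clear Hnd as [|? ? Hv Hnd']. specialize (IH Hnd' ltac:(intros x Hx; apply Hinc; cbn; auto)).
    assert (HvO : In v O) by (apply Hinc; cbn; auto).
    assert (Hle : forall x, In x O -> F l x <= F (v :: l) x).
    { intros x _. unfold F. destruct (in_dec Nat.eq_dec (hv x) l) as [i|i], (in_dec Nat.eq_dec (hv x) (v :: l)) as [j|j]; try lia.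
      exfalso. apply j. now right. }
    pose proof (list_sum_le _ _ O Hle) as H2.
    destruct (Nat.eq_dec (eta v) 0) as [E0|E0].
    - unfold list_sum in *. cbn [map fold_right]. lia.
    - pose proof (Hlng0 v HvO ltac:(lia)) as Hl0. destruct (lng v) as [|u] eqn:Ev; [lia|].
      destruct (fo_lng Hfo u v HvO Ev) as (H3 & H4 & H5 & H6).
      pose proof (list_sum_lt _ _ O u H3 Hle) as H7. 
      assert (F0 : F l u = 0) by (unfold F; rewrite H5; destruct (in_dec Nat.eq_dec v l); tauto).
      assert (F1 : F (v :: l) u = eta v).
      { unfold F, nh. rewrite H5, Ev, Nat.eqb_refl.
        destruct (in_dec Nat.eq_dec v (v :: l)) as [_|H8]; [lia|exfalso; apply H8; now left]. }
      rewrite F0, F1 in H7.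
      unfold list_sum in *. cbn [map fold_right]. lia. }
  specialize (Hl O (fo_nodup Hfo) (incl_refl _)).
  etransitivity; [exact Hl|]. apply list_sum_le. intros x _. unfold F. destruct (in_dec _ _ _); lia.
Qed.

Lemma wp_regions h (Q : astate -> Prop) :
  static h ->
  (forall h' bas en, layout bas en -> static h' -> ar h' aBas = bas ->
     (forall u, In u O -> ar h' aKk u = 16 * heads u) -> tk h' = tk h + length O ->
     keeps [rI; rU; rV; rQ] [aBas; aKk; aEn] h h' -> Q h') ->
  wp (regions cap) h Q.
Proof.
  intros Hs HQ. pose proof Hfits as [Hbig Hw].
  pose proof O_length as HOn. pose proof heads_sum as Hsum.
  assert (HOl : forall u, In u O -> u < lim).
  { intros u Hu. pose proof (fo_n Hfo u Hu). lia. }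
  assert (HhvO : forall u, In u O -> In (hv u) O).
  { intros u Hu. destruct (Nat.lt_ge_cases (sd u) 2) as [H|H].
    - apply (fo_pair Hfo); auto.
    - destruct (fo_root Hfo u Hu ltac:(lia)) as [_ ->]. exact Hu. }
  unfold regions.
  w_seq; w_asg; red1; [lia|]. w_seq; w_asg; red1; [lia|].
  eapply wp_whl with (B := tk h + length O) (I := fun h1 => exists dn rs, O = dn ++ rs /\ vr h1 rI = length dn /\
     vr h1 rQ = 16 * list_sum (map heads dn) /\ tk h1 = tk h + length dn /\ static h1 /\
     keeps [rI; rU; rV; rQ] [aBas; aKk; aEn] h h1 /\
     (forall u, In u dn -> ar h1 aEn u <= vr h1 rQ /\ ar h1 aKk u = 16 * heads u) /\
     (forall u, In u dn -> ~ opens u -> ar h1 aBas u = ar h1 aBas (hv u) /\ ar h1 aEn u = ar h1 aEn (hv u)) /\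
     (forall u, In u dn -> opens u -> ar h1 aEn u = ar h1 aBas u + 16 * (eta u + 1)) /\
     (forall u v, In u dn -> In v dn -> opens u -> opens v -> u <> v ->
        ar h1 aEn u <= ar h1 aBas v \/ ar h1 aEn v <= ar h1 aBas u)).
  1: exact Hfits.
  - exists [], O. red1. split; [reflexivity|]. split; [reflexivity|]. split; [reflexivity|].
    split; [cbn; lia|]. split; [eapply static_same; [| |exact Hs]; reflexivity|].
    split; [keeps_tac|]. cbn. tauto.
  - intros h1 (dn & rs & E & Ei & Eq & Et & Hs1 & K & _). red1. split; [auto|].
    rewrite Et, E, length_app. lia.
  - intros h1 (dn & rs & E & Ei & Eq & Et & Hs1 & K & I1 & I2 & I3 & I4).
    red1. rewrite Ei, (st_m Hs1). intros Hlt.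
    destruct (Nat.ltb_spec (length dn) (length O)) as [Hlen|]; [clear Hlt|now destruct Hlt].
    destruct rs as [|u rs]; [rewrite E, length_app in Hlen; cbn in Hlen; lia|].
    assert (HuO : In u O) by (rewrite E; apply in_elt).
    assert (Hnu : ~ In u dn).
    { pose proof (fo_nodup Hfo) as Hnd. rewrite E in Hnd.
      apply NoDup_remove_2 in Hnd. rewrite in_app_iff in Hnd. tauto. }
    assert (Hord : ar h1 aOrd (length dn) = u).
    { rewrite (st_ord Hs1) by lia. rewrite E, app_nth2, Nat.sub_diag by lia. reflexivity. }
    pose proof (HOl u HuO) as Hul. pose proof (HOl _ (HhvO u HuO)) as Hvl.
    pose proof (st_hv Hs1 u HuO) as Ehv.
    pose proof (st_lng Hs1 _ (HhvO u HuO)) as Elng.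
    pose proof (st_eta Hs1 u HuO) as Eeta.
    assert (Hq : list_sum (map heads (dn ++ [u])) = list_sum (map heads dn) + heads u).
    { rewrite list_sum_app'. unfold list_sum; cbn [map fold_right]. lia. }
    assert (Hsub : list_sum (map heads dn) + heads u <= length O).
    { rewrite <- Hq. etransitivity; [|exact Hsum]. rewrite E. rewrite !list_sum_app'.
      unfold list_sum; cbn [map fold_right]. lia. }
    w_seq; w_asg; red1; rewrite ?Ei, ?Hord; try lia.
    w_seq; w_asg; red1; rewrite ?Ehv; try lia.
    w_seq; w_ite; red1; rewrite ?Elng; [lia| |]; intros Hl.
    + destruct (Nat.eqb_spec (lng (hv u)) (u + 1)) as [El|]; [clear Hl|now destruct Hl].
      assert (Hns : ~ opens u) by (unfold opens; lia).
      assert (Hh0 : heads u = 0) by (unfold heads; replace (S u) with (u + 1) by lia; now rewrite El, Nat.eqb_refl).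
      assert (Hsd : sd u < 2) by (apply (fo_lng Hfo u (hv u)); auto; lia).
      pose proof (fo_ord Hfo dn u rs E Hsd) as Hvdn.
      assert (Hvu : hv u <> u) by (intros Ev; rewrite Ev in Hvdn; tauto).
      destruct (I1 _ Hvdn) as [J1 J2].
      w_seq; w_sto; red1; try lia.
      w_seq; w_sto; red1; try lia.
      w_sto; red1; try lia.
      w_asg; [red1; rewrite ?Ei; lia|].
      match goal with |- context [setv ?h0 0 ?v] => set (h2 := setv h0 0 v) end.
      assert (P1 : forall a x, x <> u -> ar h2 a x = ar h1 a x) by (intros; unfold h2; arr_tac).
      assert (P2 : ar h2 aBas u = ar h1 aBas (hv u)) by (unfold h2; arr_tac).
      assert (P3 : ar h2 aEn u = ar h1 aEn (hv u)) by (unfold h2; arr_tac).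
      assert (P4 : ar h2 aKk u = 0) by (unfold h2; arr_tac).
      assert (Hne : forall x, In x dn -> x <> u) by (intros x Hx ->; tauto).
      exists (dn ++ [u]), rs. split; [now rewrite <- app_assoc|]. split; [unfold h2; red1; rewrite length_app, Ei; cbn; lia|].
      split; [rewrite Hq, Hh0; change (vr h2 17) with (vr h1 17); lia|].
      split; [rewrite length_app; change (tk h2) with (S (tk h1)); cbn; lia|].
      split; [eapply static_same; [| |exact Hs1]; [reflexivity|]; intros a Ha; unfold h2; arr_tac|].
      split; [eapply keeps_trans; [exact K|]; unfold h2; keeps_tac|].
      split; [|split; [|split]].
      * intros x Hx. apply in_app_iff in Hx as [Hx|[<-|[]]]; change (vr h2 17) with (vr h1 17).
        -- rewrite !P1 by (auto). apply I1; exact Hx.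
        -- rewrite P3, P4. lia.
      * intros x Hx Hsx. apply in_app_iff in Hx as [Hx|[<-|[]]].
        -- assert (In (hv x) dn \/ hv x = x) as Hvx.
           { destruct (Nat.lt_ge_cases (sd x) 2) as [H|H].
             - left. apply in_split in Hx as (d1 & d2 & ->). rewrite <- app_assoc in E. cbn in E.
               apply in_app_iff. left. exact (fo_ord Hfo d1 x _ E H).
             - right. apply (fo_root Hfo); [|lia]. rewrite E. apply in_app_iff. auto. }
           assert (hv x <> u) by (destruct Hvx as [Hvx|Hvx]; [auto|rewrite Hvx; auto]).
           rewrite !P1 by auto. now apply I2.
        -- rewrite !P2, P3. rewrite !P1 by exact Hvu. auto.
      * intros x Hx Hsx. apply in_app_iff in Hx as [Hx|[<-|[]]]; [|tauto]. rewrite !P1 by auto. now apply I3.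
      * intros x y Hx Hy Hsx Hsy Hxy. apply in_app_iff in Hx as [Hx|[<-|[]]], Hy as [Hy|[<-|[]]]; try tauto.
        rewrite !P1 by auto. now apply I4.
    + destruct (Nat.eqb_spec (lng (hv u)) (u + 1)) as [|El]; [discriminate|clear Hl].
      assert (Hsu : opens u) by (unfold opens; lia).
      assert (Hh0 : heads u = eta u + 1).
      { unfold heads. destruct (Nat.eqb_spec (lng (hv u)) (S u)); [lia|reflexivity]. }
      w_seq; w_sto; red1; try lia.
      w_seq; w_sto; red1; rewrite ?Eeta; try lia.
      w_seq; w_asg; red1; rewrite ?Eeta; try lia.
      w_sto; red1; try lia.
      w_asg; [red1; rewrite ?Ei; lia|].
      match goal with |- context [setv ?h0 0 ?v] => set (h2 := setv h0 0 v) end.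
      assert (P1 : forall a x, x <> u -> ar h2 a x = ar h1 a x) by (intros; unfold h2; arr_tac).
      assert (P2 : ar h2 aBas u = vr h1 rQ) by (unfold h2; arr_tac).
      assert (P3 : ar h2 aEn u = vr h1 rQ + 16 * (eta u + 1)) by (unfold h2; arr_tac).
      assert (P4 : ar h2 aKk u = 16 * (eta u + 1)) by (unfold h2; arr_tac).
      assert (P5 : vr h2 rQ = vr h1 rQ + 16 * (eta u + 1)) by reflexivity.
      assert (Hne : forall x, In x dn -> x <> u) by (intros x Hx ->; tauto).
      exists (dn ++ [u]), rs. split; [now rewrite <- app_assoc|]. split; [unfold h2; red1; rewrite length_app, Ei; cbn; lia|].
      split; [rewrite Hq, Hh0, P5; lia|].
      split; [rewrite length_app; change (tk h2) with (S (tk h1)); cbn; lia|].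
      split; [eapply static_same; [| |exact Hs1]; [reflexivity|]; intros a Ha; unfold h2; arr_tac|].
      split; [eapply keeps_trans; [exact K|]; unfold h2; keeps_tac|].
      split; [|split; [|split]].
      * intros x Hx. rewrite P5. apply in_app_iff in Hx as [Hx|[<-|[]]].
        -- rewrite !P1 by (auto). destruct (I1 x Hx). lia.
        -- rewrite P3, P4. lia.
      * intros x Hx Hsx. apply in_app_iff in Hx as [Hx|[<-|[]]]; [|tauto].
        assert (In (hv x) dn) as Hvx.
        { assert (HxO : In x O) by (rewrite E; apply in_app_iff; auto).
          assert (H : sd x < 2).
          { apply (fo_lng Hfo x (hv x)); [now apply HhvO|]. unfold opens in Hsx.
            destruct (Nat.eq_dec (lng (hv x)) (S x)); tauto. }
          apply in_split in Hx as (d1 & d2 & ->). rewrite <- app_assoc in E. cbn in E.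
          apply in_app_iff. left. exact (fo_ord Hfo d1 x _ E H). }
        rewrite !P1 by auto. now apply I2.
      * intros x Hx Hsx. apply in_app_iff in Hx as [Hx|[<-|[]]].
        -- rewrite !P1 by auto. now apply I3.
        -- now rewrite P2, P3.
      * intros x y Hx Hy Hsx Hsy Hxy. apply in_app_iff in Hx as [Hx|[<-|[]]], Hy as [Hy|[<-|[]]]; try tauto.
        -- rewrite !P1 by auto. now apply I4.
        -- rewrite !(P1 _ x), P2 by auto. left. now apply I1.
        -- rewrite !(P1 _ y), P2 by auto. right. now apply I1.
  - intros h1 (dn & rs & E & Ei & Eq & Et & Hs1 & K & I1 & I2 & I3 & I4).
    red1. rewrite Ei, (st_m Hs1). intros Hge.
    destruct (Nat.ltb_spec (length dn) (length O)) as [|Hlen]; [discriminate|clear Hge].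
    assert (rs = []) as -> by (rewrite E, length_app in Hlen; destruct rs; cbn in Hlen; [auto|lia]).
    rewrite app_nil_r in E. subst dn.
    apply HQ with (bas := ar h1 aBas) (en := ar h1 aEn); auto.
    + constructor; auto. intros u Hu. destruct (I1 u Hu). lia.
    + intros u Hu. now apply I1.
Qed.

(** Iterations and new rules obey the same amortised inequality with the same potential, so the two
    accounts are carried side by side. *)
Lemma wp_pass d h (Q : astate -> Prop) :
  static h -> good h -> vr h rNo + 60 * n + 60 < lim ->
  (forall h', static h' -> good h' -> grows h h' ->
     (forall u, In u O -> exists ls, lets d u ls /\
        unit_le d h' (ar h' (aFull + Nat.b2n d) u) ls (Nat.min (10 * lam (ln u) + 5) (10 * lam (sz ls) + 15))) ->
     tk h' <= tk h + 60 * n -> vr h' rNo <= vr h rNo + 60 * n ->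
     (forall a, a < aBas \/ a = aFull + (1 - Nat.b2n d) -> ~ In a [oTag; oFst; oSnd] -> ar h' a = ar h a) -> Q h') ->
  wp (pass cap d) h Q.
Proof.
  intros Hs Hg Hno HQ. pose proof Hfits as [Hbig Hw].
  pose proof O_length as HOn. pose proof heads_sum as Hsum.
  pose proof (fo_nodup Hfo) as HndO.
  assert (Hfa : ~ In (aFull + Nat.b2n d) [oTag; oFst; oSnd; aBas; aKk; eX; eS; eT; eL; eR; eP; aEn]
     /\ aNxt < aFull + Nat.b2n d /\ aFull + (1 - Nat.b2n d) <> aFull + Nat.b2n d
     /\ 18 <= aFull + (1 - Nat.b2n d) <= 19) by (destruct d; cbn; lia).
  unfold pass. remember (aFull + Nat.b2n d) as fa eqn:Efa.
  remember (aFull + (1 - Nat.b2n d)) as fb eqn:Efb.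
  w_seq. apply wp_regions; [exact Hs|].
  intros h0 bas en La Hs0 Hbas0 Hkk0 Ht0 K0. pose proof K0 as [V0 A0].
  assert (Hg0 : good h0).
  { eapply good_same; [| |exact Hg]; [apply V0; cbn; lia|]. intros a Ha. apply A0. cbn. lia. }
  assert (G0 : grows h h0).
  { apply grows_same; [apply V0; cbn; lia|]. intros a Ha. apply A0. cbn. lia. }
  assert (N0 : vr h0 rNo = vr h rNo) by (apply V0; cbn; lia).
  clear Hs Hg.
  w_seq; w_asg; red1; [lia|].
  (* All nodes of an inheritance path share one region. Among the unvisited ones only the next in
     turn owns it: the one that opens it, or the one whose node above has been visited. Disjointness
     can be claimed for these only. *)
  set (alive := fun dn u => opens u \/ In (hv u) dn).
  assert (Hinitpot : list_sum (map (fun x => 2 * ar h0 aKk x) O) <= 32 * length O).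
  { etransitivity; [apply list_sum_le with (g := fun x => 32 * heads x)|].
    - intros x Hx. rewrite Hkk0 by exact Hx. lia.
    - assert (E : list_sum (map (fun x => 32 * heads x) O) = 32 * list_sum (map heads O)); [|lia].
      generalize O as l. induction l as [|y l IH]; [reflexivity|].
      unfold list_sum in *. cbn [map fold_right]. lia. }
  (* The 53 per node consists of 1 for laying out the regions, 32 for the initial potential by
     [heads_sum], and 20 reserved for the visit. *)
  eapply wp_whl with (B := tk h + 60 * n) (I := fun h1 => exists dn rs, O = dn ++ rs /\ vr h1 rI = length dn /\
     static h1 /\ good h1 /\ grows h h1 /\ ar h1 aBas = bas /\
     (forall u, In u dn -> exists ls, lets d u ls /\ unit_le d h1 (ar h1 fa u) ls (Nat.min (10 * lam (ln u) + 5) (10 * lam (sz ls) + 15))) /\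
     (forall u, In u rs -> sd u < 2 -> In (hv u) dn ->
        exists ls, lets d (hv u) ls /\ pending bas en d h1 u (lam (ln (hv u))) ls) /\
     (forall u, In u rs -> opens u -> In (hv u) dn \/ ar h1 aKk u = 16 * (eta u + 1)) /\
     (forall u v, In u rs -> In v rs -> alive dn u -> alive dn v -> u <> v -> en u <= bas v \/ en v <= bas u) /\
     tk h1 + pot h1 rs + 20 * length rs <= tk h + 53 * length O /\
     vr h1 rNo + pot h1 rs + 20 * length rs <= vr h rNo + 53 * length O /\
     (forall a, a < aBas \/ a = fb -> ~ In a [oTag; oFst; oSnd] -> ar h1 a = ar h a)).
  1: exact Hfits.
  - exists [], O. split; [reflexivity|]. split; [reflexivity|].
    split; [eapply static_same; [| |exact Hs0]; reflexivity|].
    split; [eapply good_same; [| |exact Hg0]; reflexivity|].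
    split; [eapply grows_trans; [exact G0|]; grows_tac|]. split; [exact Hbas0|].
    split; [easy|]. split; [easy|]. split; [|split; [|split; [|split]]].
    + intros u Hu Hst. right. red1. rewrite Hkk0 by exact Hu. unfold heads. unfold opens in Hst.
      destruct (Nat.eqb_spec (lng (hv u)) (S u)); [tauto|reflexivity].
    + intros u v Hu Hv [Au|[]] [Av|[]] Huv. now apply (la_disj La).
    + unfold pot. red1. lia.
    + unfold pot. red1. lia.
    + intros a Ha Hn3. red1. apply A0. cbn; lia.
  - intros h1 (dn & rs & E & Ei & H). red1. split; [auto|]. lia.
  - intros h1 (dn & rs & E & Ei & Hs1 & Hg1 & G1 & B1 & I1 & I2 & I3 & I4 & I5 & I6 & I7).
    red1. rewrite Ei, (st_m Hs1). intros Hlt.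
    destruct (Nat.ltb_spec (length dn) (length O)) as [Hlen|]; [clear Hlt|now destruct Hlt].
    destruct rs as [|u rs]; [rewrite E, length_app in Hlen; cbn in Hlen; lia|].
    assert (HuO : In u O) by (rewrite E; apply in_elt).
    assert (Hnd : NoDup (dn ++ u :: rs)) by (now rewrite <- E).
    assert (Hnu : ~ In u dn /\ ~ In u rs).
    { apply NoDup_remove_2 in Hnd. rewrite in_app_iff in Hnd. tauto. }
    assert (Hndr : NoDup rs).
    { apply NoDup_remove_1 in Hnd. now apply NoDup_app_remove_l in Hnd. }
    assert (Hord : ar h1 aOrd (length dn) = u).
    { rewrite (st_ord Hs1) by lia. rewrite E, app_nth2, Nat.sub_diag by lia. reflexivity. }
    assert (Hbefore : forall x, In x dn -> sd x < 2 -> In (hv x) dn).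
    { intros x Hx Hsd. apply in_split in Hx as (d1 & d2 & ->). rewrite <- app_assoc in E. cbn in E.
      apply in_app_iff. left. exact (fo_ord Hfo d1 x _ E Hsd). }
    destruct (fo_ch Hfo u HuO) as (ch & C1 & C2 & C3).
    assert (Hchrs : incl ch rs).
    { intros x Hx. apply C3 in Hx as (X1 & X2 & X3).
      destruct (fo_pair Hfo x X1 X2) as (_ & _ & _ & _ & X4).
      rewrite E in X1. apply in_app_iff in X1 as [X1|[X1|X1]]; [| |exact X1].
      - apply Hbefore in X1; [|exact X2]. rewrite X3 in X1. tauto.
      - rewrite X3, X1 in X4. lia. }
    assert (Hpotu : pot h1 (u :: rs) = 2 * ar h1 aKk u + pot h1 rs) by reflexivity.
    rewrite Hpotu in *. cbn [length] in *.
    assert (Hlrs : length O = length dn + S (length rs)) by (rewrite E, length_app; reflexivity).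
    assert (Hroot : sd u = 2 -> opens u).
    { intros H2 H3. destruct (fo_root Hfo u HuO ltac:(lia)) as [_ H4].
      destruct (fo_lng Hfo u (hv u)); [now rewrite H4|exact H3|lia]. }
    assert (Hau : alive dn u).
    { destruct (Nat.lt_ge_cases (sd u) 2) as [H2|H2].
      - right. exact (fo_ord Hfo dn u rs E H2).
      - left. apply Hroot. apply (fo_root Hfo u HuO). lia. }
    w_seq; w_asg; red1; rewrite ?Ei, ?Hord; try lia.
    w_seq.
    match goal with |- wp _ ?h0 _ => set (h2 := h0) end.
    assert (G2 : grows h1 h2) by (unfold h2; grows_tac).
    eapply wp_visit with (u := u) (ch := ch) (rs := rs) (bas := bas) (en := en).
    1: exact La.
    1: { eapply static_same; [| |exact Hs1]; reflexivity. }
    1: { eapply good_same; [| |exact Hg1]; reflexivity. }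
    1: exact HuO.
    1: exact B1.
    1: reflexivity.
    1: exact C1.
    1: exact C2.
    1: exact C3.
    1: exact Hchrs.
    1: exact Hndr.
    1: { intros Hsd. pose proof (fo_ord Hfo dn u rs E Hsd) as Hvdn.
         destruct (I2 u (or_introl eq_refl) Hsd Hvdn) as (ls & L1 & l & m & L2 & L3 & L4).
         exists ls. split; [exact L1|]. exists l, m. split; [|auto].
         eapply stack_move; [exact G2| |auto|exact L2]. reflexivity. }
    1: exact Hroot.
    1: { intros x Hx Hsx. pose proof (Hchrs x Hx) as Hxr. split.
         - apply I4; [now right|now left|now left|exact Hau|intros ->; tauto].
         - destruct (I3 x (or_intror Hxr) Hsx) as [H3|H3]; [|exact H3].
           apply C3 in Hx as (_ & _ & X3). rewrite X3 in H3. tauto. }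
    1: { change (pot h2 rs) with (pot h1 rs). change (vr h2 5) with (vr h1 5). change (ar h2) with (ar h1). lia. }
    intros h3 ls S3 Go3 G3 L3 U3 P3 KK3 F3 Fu3 T3 N3 K3. pose proof K3 as [V3 A3].
    change (vr h2 5) with (vr h1 5) in N3. change (tk h2) with (S (tk h1)) in T3.
    change (pot h2 rs) with (pot h1 rs) in N3, T3. rewrite <- Efa in *.
    change (ar h2) with (ar h1) in KK3, F3, Fu3, T3, N3, A3.
    assert (V3i : vr h3 rI = length dn) by (rewrite V3 by (cbn; lia); exact Ei).
    w_asg; [red1; lia|].
    match goal with |- context [setv ?h0 0 ?v] => set (h4 := setv h0 0 v) end.
    assert (G4 : grows h3 h4) by (unfold h4; grows_tac).
    assert (G24 : grows h1 h4).
    { eapply grows_trans; [exact G2|]. eapply grows_trans; [exact G3|exact G4]. }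
    exists (dn ++ [u]), rs. split; [now rewrite <- app_assoc|].
    split; [unfold h4; red1; rewrite V3i, length_app; cbn; lia|].
    split; [eapply static_same; [| |exact S3]; reflexivity|].
    split; [eapply good_same; [| |exact Go3]; reflexivity|].
    split; [eapply grows_trans; [exact G1|exact G24]|].
    split; [change (ar h4) with (ar h3); rewrite A3 by (cbn [In] in *; lia); exact B1|].
    split; [|split; [|split; [|split; [|split; [|split]]]]].
    + intros x Hx. apply in_app_iff in Hx as [Hx|[<-|[]]].
      * destruct (I1 x Hx) as (lx & X1 & X2). exists lx. split; [exact X1|].
        eapply unit_le_eq; [exact G24| |reflexivity|exact X2]. apply Fu3. intros ->; tauto.
      * exists ls. split; [exact L3|]. eapply unit_le_mono; [exact G4|reflexivity|exact U3].
    + intros x Hx Hsd Hv. assert (HxO : In x O) by (rewrite E; apply in_app_iff; right; now right).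
      assert (Hxu : x <> u) by (intros ->; tauto).
      apply in_app_iff in Hv as [Hv|[Hv|[]]].
      * assert (Hxch : ~ In x ch) by (intros Hc; apply C3 in Hc as (_ & _ & Hc); rewrite Hc in Hv; tauto).
        destruct (I2 x (or_intror Hx) Hsd Hv) as (lx & X1 & l & m & X2 & X3 & X4).
        exists lx. split; [exact X1|]. exists l, m. change (ar h4 aKk x) with (ar h3 aKk x).
        rewrite KK3 by exact Hxch. split; [|auto].
        eapply stack_move; [exact G24| |auto|exact X2].
        intros a j Ha Hj. change (ar h4) with (ar h3). apply F3; [exact Ha| |].
        -- destruct (I4 x u (or_intror Hx) (or_introl eq_refl) (or_intror Hv) Hau Hxu); lia.
        -- intros y Hy Hsy.
           destruct (I4 x y (or_intror Hx) (or_intror (Hchrs y Hy)) (or_intror Hv) (or_introl Hsy) ltac:(intros ->; tauto)); lia.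
      * rewrite <- Hv. exists ls. split; [exact L3|].
        assert (Hxch : In x ch) by (apply C3; auto).
        destruct (P3 x Hxch) as (l & m & X2 & X3 & X4). exists l, m. split; [|auto].
        eapply stack_move; [exact G4| |auto|exact X2]. reflexivity.
    + intros x Hx Hsx. destruct (I3 x (or_intror Hx) Hsx) as [H3|H3]; [left; apply in_app_iff; auto|].
      destruct (in_dec Nat.eq_dec x ch) as [Hc|Hc].
      * left. apply C3 in Hc as (_ & _ & ->). apply in_app_iff. right. now left.
      * right. change (ar h4 aKk x) with (ar h3 aKk x). rewrite KK3 by exact Hc. exact H3.
    + assert (Hal : forall x, In x rs -> alive (dn ++ [u]) x -> alive dn x \/ lng u = S x /\ bas x = bas u /\ en x = en u).
      { intros x Hx [Hsx|Hv]; [left; now left|]. apply in_app_iff in Hv as [Hv|[Hv|[]]]; [left; now right|].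
        destruct (Nat.eq_dec (lng (hv x)) (S x)) as [Ex|Ex]; [|left; now left].
        right. rewrite <- Hv in Ex. split; [exact Ex|].
        assert (HxO : In x O) by (rewrite E; apply in_app_iff; right; now right).
        rewrite Hv. apply (la_long La); [exact HxO|]. unfold opens. rewrite <- Hv. tauto. }
      intros x y Hx Hy Ax Ay Hxy.
      assert (Hxu : x <> u) by (intros ->; tauto). assert (Hyu : y <> u) by (intros ->; tauto).
      destruct (Hal x Hx Ax) as [Ax'|(X1 & X2 & X3)], (Hal y Hy Ay) as [Ay'|(Y1 & Y2 & Y3)].
      * apply I4; auto; now right.
      * rewrite Y2, Y3. apply I4; auto; [now right|now left].
      * rewrite X2, X3. apply I4; auto; [now left|now right].
      * lia.
    + change (tk h4) with (tk h3). change (pot h4 rs) with (pot h3 rs). lia.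
    + change (vr h4 5) with (vr h3 5). change (pot h4 rs) with (pot h3 rs). lia.
    + intros a Ha Hn3. change (ar h4) with (ar h3). rewrite A3 by (cbn [In] in *; lia). now apply I7.
  - intros h1 (dn & rs & E & Ei & Hs1 & Hg1 & G1 & B1 & I1 & I2 & I3 & I4 & I5 & I6 & I7).
    red1. rewrite Ei, (st_m Hs1). intros Hge.
    destruct (Nat.ltb_spec (length dn) (length O)) as [|Hlen]; [discriminate|clear Hge].
    assert (rs = []) as -> by (rewrite E, length_app in Hlen; destruct rs; cbn in Hlen; [auto|lia]).
    rewrite app_nil_r in E. subst dn. cbn [length] in *.
    apply HQ; auto; lia.
Qed.

(** * The rules of the output *)

Section Assemble.
Variable rl : nat -> rule.
Hypothesis Hroot : forall u, In u O -> sd u = 2 ->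
  match rl u with Term _ => True | Run b _ => b < n | Pair _ _ => False end.

Inductive root_of : nat -> nat -> Prop :=
| root_of_root u : sd u = 2 -> root_of u u
| root_of_step u r : sd u < 2 -> root_of (hv u) r -> root_of u r.

(** Weaker than [grows]: the placeholders up to index [n] are now overwritten, which derivations do
    not notice. *)
Definition extends (h h' : astate) : Prop :=
  vr h rNo <= vr h' rNo /\
  forall j, n < j < vr h rNo ->
    ar h' oTag j = ar h oTag j /\ ar h' oFst j = ar h oFst j /\ ar h' oSnd j = ar h oSnd j.

Lemma extends_trans h1 h2 h3 : extends h1 h2 -> extends h2 h3 -> extends h1 h3.
Proof.
  intros [N1 E1] [N2 E2]. split; [lia|]. intros j Hj.
  destruct (E2 j ltac:(lia)) as (-> & -> & ->). now apply E1.
Qed.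

Lemma unit_le_extends d h h' id x b : extends h h' -> unit_le d h id x b -> unit_le d h' id x b.
Proof.
  intros [Hno He] [H|(hx & H1 & H2 & H3)]; [now left|right]. exists hx. split; [exact H1|].
  split; [|lia]. eapply un_ext; [|exact H2|exact H3]. intros j Hj. now apply He.
Qed.

Lemma good_extends h h' : extends h h' -> vr h' rNo = vr h rNo -> good h -> good h'.
Proof.
  intros [_ He] Hno [H1 H2]. split; [lia|]. intros id Hid. rewrite Hno in Hid.
  destruct (H2 id Hid) as (d & x & hx & U & B). exists d, x, hx. split; [|exact B].
  eapply un_ext; [|exact U|apply Hid]. intros j Hj. now apply He.
Qed.

Definition full_le (d : bool) h u id x : Prop :=
  lets d u x /\ unit_le d h id x (Nat.min (10 * lam (ln u) + 5) (10 * lam (sz x) + 15)).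

Definition rule_out (h : astate) i a b c : Prop := ar h oTag i = a /\ ar h oFst i = b /\ ar h oSnd i = c.

Definition root_done h u : Prop :=
  match rl u with
  | Term a => rule_out h (S u) 0 a 0
  | Run b k => rule_out h (S u) 2 (S b) k
  | Pair _ _ => False
  end.

Definition pair_done h u : Prop :=
  exists r id1 x1 id2 x2, root_of u r /\ In r O /\
    full_le false h u id1 x1 /\ full_le true h u id2 x2 /\
    (id1 = 0 /\ rule_out h (S u) 1 (S r) id2 \/
     id2 = 0 /\ rule_out h (S u) 1 id1 (S r) \/
     id1 <> 0 /\ id2 <> 0 /\ exists q, n < q < vr h rNo /\ rule_out h (S u) 1 id1 q /\ rule_out h q 1 (S r) id2).

Lemma pair_done_extends h h' u :
  extends h h' -> (forall a, oTag <= a <= oSnd -> ar h' a (S u) = ar h a (S u)) -> pair_done h u -> pair_done h' u.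
Proof.
  intros He Ha (r & id1 & x1 & id2 & x2 & H1 & H2 & [H3 H3'] & [H4 H4'] & H5).
  exists r, id1, x1, id2, x2. split; [exact H1|]. split; [exact H2|].
  split; [split; [exact H3|eapply unit_le_extends; eauto]|].
  split; [split; [exact H4|eapply unit_le_extends; eauto]|].
  unfold rule_out in *. rewrite !Ha by lia. destruct H5 as [H5|[H5|(Z1 & Z2 & q & Q1 & Q2 & Q3)]]; auto.
  right. right. destruct He as [Hno He]. split; [exact Z1|]. split; [exact Z2|]. exists q. split; [lia|]. split; [exact Q2|].
  destruct (He q Q1) as (-> & -> & ->). exact Q3.
Qed.

(** Each of the three stores evaluates the index anew, so its value must survive the preceding
    ones. *)
Lemma wp_pair_rule i r1 r2 h (Q : astate -> Prop) :
  ok w cap n st h i -> val n st h i < lim ->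
  (forall a e, val n st (seta h a (val n st h i) e) i = val n st h i /\ ok w cap n st (seta h a (val n st h i) e) i) ->
  (forall a b e e', val n st (seta (seta h a (val n st h i) e) b (val n st h i) e') i = val n st h i /\
     ok w cap n st (seta (seta h a (val n st h i) e) b (val n st h i) e') i) ->
  Q (seta (seta (seta h oTag (val n st h i) 1) oFst (val n st h i) (vr h r1)) oSnd (val n st h i) (vr h r2)) ->
  wp (pair_rule cap i r1 r2) h Q.
Proof.
  intros Hok Hv H1 H2 HQ. pose proof Hfits as [Hbig Hw]. unfold pair_rule.
  w_seq. w_sto; [exact Hok|cbn; lia|lia|exact Hv|]. change (val n st h (Cn 1)) with 1.
  destruct (H1 oTag 1) as [E1 O1].
  w_seq. w_sto; [exact O1|cbn; auto|lia|lia|]. rewrite E1.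
  change (val n st (seta h 3 (val n st h i) 1) (Vr r1)) with (vr h r1).
  destruct (H2 oTag oFst 1 (vr h r1)) as [E2 O2].
  w_sto; [exact O2|cbn; auto|lia|lia|]. rewrite E2. exact HQ.
Qed.

Definition assembling (h h1 : astate) : Prop := exists dn rs, O = dn ++ rs /\ vr h1 rI = length dn /\
  vr h1 rM = length O /\ tk h1 = tk h + length dn /\
  (forall a, ~ In a [oTag; oFst; oSnd; aRoot] -> ar h1 a = ar h a) /\
  good h1 /\ extends h h1 /\ vr h1 rNo <= vr h rNo + length dn /\
  (forall u, In u dn -> exists r, ar h1 aRoot u = r /\ root_of u r /\ In r O) /\
  (forall u, In u dn -> sd u = 2 -> root_done h1 u) /\
  (forall u, In u dn -> sd u < 2 -> pair_done h1 u) /\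
  (forall j, j <= n -> (forall u, In u dn -> j <> S u) -> rule_out h1 j 0 0 0).

Lemma wp_assemble h (Q : astate -> Prop) :
  vr h rM = length O ->
  (forall i, i < length O -> ar h aOrd i = nth i O 0) ->
  (forall u, In u O -> ar h aSd u = sd u /\ ar h aHv u = hv u) ->
  (forall u, In u O -> rule_in h u (rl u)) ->
  good h -> vr h rNo + n + 2 < lim ->
  (forall d u, In u O -> exists x, full_le d h u (ar h (aFull + Nat.b2n d) u) x) ->
  (forall j, j <= n -> rule_out h j 0 0 0) ->
  (forall h', good h' -> vr h' rNo <= vr h rNo + n -> tk h' <= tk h + n ->
     (forall u, In u O -> sd u = 2 -> root_done h' u) ->
     (forall u, In u O -> sd u < 2 -> pair_done h' u) ->
     (forall j, j <= n -> (forall u, In u O -> j <> S u) -> rule_out h' j 0 0 0) -> Q h') ->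
  wp (assemble cap) h Q.
Proof.
  intros Hm Ho Hs Hr Hg Hno Hfull Hz HQ. pose proof Hfits as [Hbig Hw].
  pose proof O_length as HOl. pose proof (fo_nodup Hfo) as HOnd.
  assert (HOn : forall u, In u O -> u < n /\ 0 < ln u).
  { intros u Hu. split; [exact (fo_n Hfo u Hu)|apply (fo_ln Hfo u Hu)]. }
  unfold assemble. w_seq; w_asg; red1; [lia|].
  eapply wp_whl with (B := tk h + length O) (I := assembling h).
  1: exact Hfits.
  - exists [], O. red1. split; [reflexivity|]. split; [reflexivity|]. split; [exact Hm|]. split; [cbn; lia|].
    split; [reflexivity|]. split; [eapply good_same; [| |exact Hg]; reflexivity|].
    split; [split; [reflexivity|auto]|]. split; [cbn; lia|].
    split; [easy|]. split; [easy|]. split; [easy|]. intros j Hj _. exact (Hz j Hj).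
  - intros h1 (dn & rs & E & Ei & Em & Et & _). red1. split; [auto|]. rewrite Et, E, length_app. lia.
  - intros h1 (dn & rs & E & Ei & Em & Et & A1 & Hg1 & He1 & Hno1 & I1 & I2 & I3 & I4).
    red1. rewrite Ei, Em. intros Hlt.
    destruct (Nat.ltb_spec (length dn) (length O)) as [Hlen|]; [clear Hlt|now destruct Hlt].
    destruct rs as [|u rs]; [rewrite E, length_app in Hlen; cbn in Hlen; lia|].
    assert (HuO : In u O) by (rewrite E; apply in_elt). destruct (HOn u HuO) as [Hun Hlu].
    assert (Hnu : ~ In u dn).
    { rewrite E in HOnd. apply NoDup_remove_2 in HOnd. rewrite in_app_iff in HOnd. tauto. }
    assert (Hou : ar h aOrd (length dn) = u).
    { rewrite Ho by lia. rewrite E, app_nth2, Nat.sub_diag by lia. reflexivity. }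
    destruct (Hs u HuO) as [Esd Ehv].
    assert (Hne : forall y, In y dn -> S y <> S u) by (intros y Hy [= ->]; tauto).
    assert (Hyn : forall y, In y dn -> y < n).
    { intros y Hy. apply HOn. rewrite E. apply in_app_iff. auto. }
    destruct Hg1 as [Hng Hg1].
    assert (Hend : forall h2 r, tk h2 = S (tk h1) -> vr h2 rI = length dn -> vr h2 rM = length O ->
      (forall a, ~ In a [oTag; oFst; oSnd; aRoot] -> ar h2 a = ar h a) ->
      good h2 -> extends h1 h2 -> vr h2 rNo <= S (vr h1 rNo) ->
      ar h2 aRoot = update (ar h1 aRoot) u r -> root_of u r -> In r O ->
      (forall a j, oTag <= a <= oSnd -> j <= n -> j <> S u -> ar h2 a j = ar h1 a j) ->
      (sd u = 2 -> root_done h2 u) -> (sd u < 2 -> pair_done h2 u) ->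
      wp (asg cap rI (Pl (Vr rI) (Cn 1))) h2 (assembling h)).
    { intros h2 r T2 V2i V2m A2 G2 E2 N2 R2 R2' R2O F2 D2 D2'.
      w_asg; [red1; lia|].
      match goal with |- context [setv ?h0 0 ?v] => set (h3 := setv h0 0 v) end.
      assert (E3 : extends h1 h3) by exact E2.
      exists (dn ++ [u]), rs. rewrite length_app. cbn [length].
      split; [now rewrite <- app_assoc|]. split; [unfold h3; red1; lia|]. split; [exact V2m|].
      split; [change (tk h3) with (tk h2); lia|]. split; [exact A2|].
      split; [eapply good_same; [| |exact G2]; reflexivity|].
      split; [eapply extends_trans; [exact He1|exact E3]|].
      split; [change (vr h3 5) with (vr h2 5); lia|].
      change (ar h3 aRoot) with (ar h2 aRoot). rewrite R2. split; [|split; [|split]].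
      - intros y Hy. apply in_app_iff in Hy as [Hy|[<-|[]]].
        + destruct (I1 y Hy) as (ry & Y1 & Y2 & Y3). exists ry. split; [|auto]. unfold update.
          destruct (Nat.eqb_spec y u) as [->|]; [tauto|exact Y1].
        + exists r. split; [|auto]. unfold update. now rewrite Nat.eqb_refl.
      - intros y Hy Hy2. apply in_app_iff in Hy as [Hy|[<-|[]]].
        + specialize (I2 y Hy Hy2). unfold root_done, rule_out in *. change (ar h3) with (ar h2).
          rewrite !F2 by (auto; specialize (Hyn y Hy); lia). exact I2.
        + exact (D2 Hy2).
      - intros y Hy Hy2. apply in_app_iff in Hy as [Hy|[<-|[]]].
        + eapply pair_done_extends; [exact E3| |apply I3; assumption].
          intros a Ha. change (ar h3) with (ar h2). apply F2; auto. specialize (Hyn y Hy). lia.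
        + eapply pair_done_extends; [|reflexivity|exact (D2' Hy2)]. split; [reflexivity|auto].
      - intros j Hj Hju. unfold rule_out. change (ar h3) with (ar h2).
        rewrite !F2 by (auto; try lia; apply Hju, in_app_iff; cbn; auto).
        apply I4; [exact Hj|]. intros y Hy. apply Hju, in_app_iff. auto. }
    w_seq; w_asg; red1; rewrite ?Ei, ?(A1 aOrd) by (cbn; lia); rewrite ?Hou; try lia.
    w_seq; w_ite; red1; rewrite ?(A1 aSd), ?Esd by (cbn; lia); [lia| |]; intros Hd.
    + assert (E2 : sd u = 2) by (destruct (Nat.eqb_spec (sd u) 2); [auto|now destruct Hd]). clear Hd.
      pose proof (Hr u HuO) as Hru. pose proof (Hroot u HuO E2) as Hrt.
      w_seq; w_sto; red1; try lia.
      w_seq; w_sto; red1; rewrite ?(A1 aTag) by (cbn; lia); try lia.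
      w_seq; w_sto; red1; rewrite ?(A1 aFst) by (cbn; lia); try lia.
      w_seq; w_sto; red1; rewrite ?(A1 aSnd) by (cbn; lia); try lia.
      replace (u + 1) with (S u) by lia.
      assert (Hany : forall h2, tk h2 = S (tk h1) -> (forall x, x <> rU -> vr h2 x = vr h1 x) ->
        (forall a, ~ In a [oTag; oFst; oSnd; aRoot] -> ar h2 a = ar h a) ->
        (forall a j, oTag <= a <= oSnd -> j <> S u -> ar h2 a j = ar h1 a j) ->
        ar h2 aRoot = update (ar h1 aRoot) u u -> root_done h2 u ->
        wp (asg cap rI (Pl (Vr rI) (Cn 1))) h2 (assembling h)).
      { intros h2 T2 V2 A2 F2 R2 D2.
        assert (Hx : extends h1 h2).
        { split; [rewrite V2 by lia; reflexivity|]. intros j Hj. rewrite !F2 by lia. auto. }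
        apply (Hend h2 u); auto; try (rewrite V2 by lia; auto).
        - eapply good_extends; [exact Hx|apply V2; lia|split; auto].
        - now constructor.
        - lia. }
      w_ite; red1; rewrite ?(A1 aTag) by (cbn; lia); [lia| |]; intros Hd.
      * assert (E3 : ar h aTag u = 2) by (destruct (Nat.eqb_spec (ar h aTag u) 2); [auto|now destruct Hd]). clear Hd.
        destruct (rl u) as [a|b c|b k] eqn:Er; cbn in Hru; try lia. destruct Hru as (R1 & R2 & R3).
        w_sto; red1; rewrite ?(A1 aFst), ?R2 by (cbn; lia); try lia.
        replace (u + 1) with (S u) by lia. replace (b + 1) with (S b) by lia.
        apply Hany; try reflexivity.
        -- intros x Hx. arr_tac.
        -- intros a Ha. transitivity (ar h1 a); [|now apply A1]. arr_tac; subst; cbn in Ha; tauto.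
        -- intros a j Ha Hj. arr_tac.
        -- unfold root_done, rule_out. rewrite Er. red1. unfold update. rewrite Nat.eqb_refl. auto.
      * assert (E3 : ar h aTag u <> 2) by (destruct (Nat.eqb_spec (ar h aTag u) 2); [discriminate|auto]). clear Hd.
        destruct (rl u) as [a|b c|b k] eqn:Er; cbn in Hru; try lia; try tauto. destruct Hru as (R1 & R2 & R3).
        apply wp_skip. apply Hany; try reflexivity.
        -- intros x Hx. arr_tac.
        -- intros a' Ha. transitivity (ar h1 a'); [|now apply A1]. arr_tac; subst; cbn in Ha; tauto.
        -- intros a' j Ha Hj. arr_tac.
        -- unfold root_done, rule_out. rewrite Er. red1. unfold update. rewrite Nat.eqb_refl. auto.
    + assert (E2 : sd u < 2).
      { destruct (Nat.lt_ge_cases (sd u) 2) as [|E2]; [auto|]. destruct (fo_root Hfo u HuO ltac:(lia)) as [E3 _]. rewrite E3 in Hd. discriminate. }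
      clear Hd. pose proof (fo_ord Hfo dn u rs E E2) as Hvd. pose proof (Hyn _ Hvd) as Hvn.
      destruct (I1 _ Hvd) as (r & Y1 & Y2 & Y3). destruct (HOn r Y3) as [Hrn Hlr].
      destruct (Hfull false u HuO) as (x1 & L1 & U1). destruct (Hfull true u HuO) as (x2 & L2 & U2).
      change (aFull + Nat.b2n false) with 18 in U1. change (aFull + Nat.b2n true) with 19 in U2.
      set (id1 := ar h 18 u) in *. set (id2 := ar h 19 u) in *.
      assert (Hid1 : id1 < vr h rNo).
      { destruct U1 as [[-> _]|(hx & _ & _ & H)]; [|exact H]. destruct Hg as [Hg _]. lia. }
      assert (Hid2 : id2 < vr h rNo).
      { destruct U2 as [[-> _]|(hx & _ & _ & H)]; [|exact H]. destruct Hg as [Hg _]. lia. }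
      assert (Hru : root_of u r) by (now constructor).
      w_seq; w_sto; red1; rewrite ?(A1 aHv), ?Ehv, ?Y1 by (cbn; lia); try lia.
      w_seq; w_asg; red1; unfold update; rewrite ?Nat.eqb_refl; try lia.
      replace (r + 1) with (S r) by lia.
      w_seq; w_asg; red1; rewrite ?(A1 18) by (cbn; lia); try lia. fold id1.
      w_seq; w_asg; red1; rewrite ?(A1 19) by (cbn; lia); try lia. fold id2.
      match goal with |- wp _ ?h0 _ => set (h2 := h0) end.
      assert (V2 : vr h2 rU = u /\ vr h2 rA = id1 /\ vr h2 rB = id2 /\ vr h2 rC = S r /\ vr h2 rI = length dn /\
        vr h2 rM = length O /\ vr h2 rNo = vr h1 rNo) by (unfold h2; red1; auto 10).
      destruct V2 as (VU & VA & VB & VC & VI & VM & VN).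
      assert (A2 : forall a, a <> aRoot -> ar h2 a = ar h1 a) by (intros; unfold h2; arr_tac).
      assert (R2 : ar h2 aRoot = update (ar h1 aRoot) u r) by reflexivity.
      assert (Hany : forall h3, tk h3 = S (tk h1) -> vr h3 rI = length dn -> vr h3 rM = length O ->
        (forall a, ~ In a [oTag; oFst; oSnd] -> ar h3 a = ar h2 a) ->
        good h3 -> extends h1 h3 -> vr h3 rNo <= S (vr h1 rNo) ->
        (forall a j, oTag <= a <= oSnd -> j <= n -> j <> S u -> ar h3 a j = ar h1 a j) ->
        (id1 = 0 /\ rule_out h3 (S u) 1 (S r) id2 \/
         id2 = 0 /\ rule_out h3 (S u) 1 id1 (S r) \/
         id1 <> 0 /\ id2 <> 0 /\ exists q, n < q < vr h3 rNo /\ rule_out h3 (S u) 1 id1 q /\ rule_out h3 q 1 (S r) id2) ->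
        wp (asg cap rI (Pl (Vr rI) (Cn 1))) h3 (assembling h)).
      { intros h3 T3 V3i V3m A3 G3 E3 N3 F3 D3.
        apply (Hend h3 r); auto.
        - intros a Ha. rewrite A3 by (cbn in *; tauto). rewrite A2 by (intros ->; cbn in Ha; tauto). now apply A1.
        - rewrite A3 by (cbn; lia). exact R2.
        - lia.
        - intros _. assert (Hex : extends h h3) by (eapply extends_trans; eauto).
          exists r, id1, x1, id2, x2. split; [exact Hru|]. split; [exact Y3|].
          split; [split; [exact L1|eapply unit_le_extends; eauto]|].
          split; [split; [exact L2|eapply unit_le_extends; eauto]|]. exact D3. }
      assert (Hlow : forall t f s, extends h1 (seta (seta (seta h2 oTag (S u) t) oFst (S u) f) oSnd (S u) s)).
      { intros t f s. split; [red1; lia|]. intros j Hj. red1. rewrite !A2 by lia. unfold update.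
        destruct (Nat.eqb_spec j (S u)); [lia|auto]. }
      w_ite; red1; rewrite ?VA; [lia| |]; intros Hd;
        [assert (E0 : id1 = 0) by (destruct (Nat.eqb_spec id1 0); [auto|now destruct Hd])
        |assert (E0 : id1 <> 0) by (destruct (Nat.eqb_spec id1 0); [discriminate|auto])]; clear Hd.
      * apply wp_pair_rule; cbn [val ok]; rewrite ?VU; red1; rewrite ?VU; try lia.
        replace (u + 1) with (S u) by lia. rewrite VB, VC.
        apply Hany; try reflexivity; auto.
        -- intros a Ha. arr_tac; subst; cbn in Ha; tauto.
        -- eapply good_extends; [apply Hlow| |split; [exact Hng|exact Hg1]]. reflexivity.
        -- intros a j Ha Hj Hju. rewrite <- (A2 a) by lia. arr_tac.
        -- left. split; [exact E0|]. unfold rule_out. red1. unfold update. rewrite Nat.eqb_refl. auto.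
      * w_ite; red1; rewrite ?VB; [lia| |]; intros Hd;
          [assert (E1 : id2 = 0) by (destruct (Nat.eqb_spec id2 0); [auto|now destruct Hd])
          |assert (E1 : id2 <> 0) by (destruct (Nat.eqb_spec id2 0); [discriminate|auto])]; clear Hd.
        -- apply wp_pair_rule; cbn [val ok]; rewrite ?VU; red1; rewrite ?VU; try lia.
           replace (u + 1) with (S u) by lia. rewrite VA, VC.
           apply Hany; try reflexivity; auto.
           ++ intros a Ha. arr_tac; subst; cbn in Ha; tauto.
           ++ eapply good_extends; [apply Hlow| |split; [exact Hng|exact Hg1]]. reflexivity.
           ++ intros a j Ha Hj Hju. rewrite <- (A2 a) by lia. arr_tac.
           ++ right. left. split; [exact E1|]. unfold rule_out. red1. unfold update. rewrite Nat.eqb_refl. auto.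
        -- w_seq. apply wp_pair_rule; cbn [val ok]; rewrite ?VN; auto; try lia.
           w_seq. apply wp_pair_rule; cbn [val ok]; red1; rewrite ?VU; try lia.
           rewrite VA, VB, VC, VN. replace (u + 1) with (S u) by lia.
           w_asg; red1; rewrite ?VN; try lia. replace (vr h1 5 + 1) with (S (vr h1 5)) by lia.
           set (q := vr h1 5) in *.
           match goal with |- wp _ ?h0 _ => set (h3 := h0) end.
           assert (B3 : forall j, ar h3 oTag j = (if j =? S u then 1 else if j =? q then 1 else ar h1 oTag j) /\
              ar h3 oFst j = (if j =? S u then id1 else if j =? q then S r else ar h1 oFst j) /\
              ar h3 oSnd j = (if j =? S u then q else if j =? q then id2 else ar h1 oSnd j)).
           { intros j. unfold h3. red1. rewrite !A2 by lia. unfold update.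
             destruct (j =? S u), (j =? q); auto. }
           assert (Hq : (q =? S u) = false) by (apply Nat.eqb_neq; lia).
           assert (Ex3 : extends h1 h3).
           { split; [unfold h3; red1; lia|]. intros j Hj. destruct (B3 j) as (-> & -> & ->).
             replace (j =? S u) with false by (symmetry; apply Nat.eqb_neq; lia).
             replace (j =? q) with false by (symmetry; apply Nat.eqb_neq; lia). auto. }
           assert (Hout : rule_out h3 q 1 (S r) id2).
           { unfold rule_out. destruct (B3 q) as (-> & -> & ->). rewrite Hq, Nat.eqb_refl. auto. }
           apply Hany; try reflexivity; auto.
           ++ intros a Ha. unfold h3. arr_tac; subst; cbn in Ha; tauto.
           ++ split; [unfold h3; red1; lia|]. intros id Hid. change (vr h3 5) with (S q) in Hid.
              assert (Hjs : forall j, n < j < q -> ar h3 oTag j = ar h1 oTag j /\ ar h3 oFst j = ar h1 oFst j /\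
                 ar h3 oSnd j = ar h1 oSnd j) by (apply Ex3).
              destruct (Nat.eq_dec id q) as [->|Hidq].
              ** destruct U2 as [[? _]|(hx & Hhx & Hux & Hix)]; [lia|].
                 (* The rule joining root and right context is an auxiliary nonterminal as well. Its
                    balance needs the bound of [x2] by its own length, since [u] may be far
                    longer. *)
                 exists true, (r :: x2), (S (Nat.max (bd r) hx)).
                 destruct Hout as (O1 & O2 & O3).
                 assert (Hq1 : vr h 5 <= q) by apply He1.
                 assert (Hux3 : un true (ar h3 oTag) (ar h3 oFst) (ar h3 oSnd) id2 x2 hx).
                 { eapply un_ext; [|exact Hux|exact Hix]. intros j Hj.
                   destruct Ex3 as [_ Ex3]. destruct He1 as [Hn1 He1].
                   destruct (Ex3 j ltac:(lia)) as (-> & -> & ->). now apply He1. }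
                 split.
                 --- change (r :: x2) with ([r] ++ x2). apply un_pair; rewrite ?O2, ?O3; auto; try lia.
                     now constructor.
                 --- unfold gd, bd.
                     assert (lam (ln r) <= lam (sz (r :: x2)) /\ lam (sz x2) <= lam (sz (r :: x2))).
                     { split; apply lam_le; unfold sz, list_sum; cbn [map fold_right]; lia. }
                     lia.
              ** destruct (Hg1 id ltac:(lia)) as (d & y & hy & Hy1 & Hy2). exists d, y, hy. split; [|exact Hy2].
                 eapply un_ext; [exact Hjs|exact Hy1|lia].
           ++ intros a j Ha Hj Hju. destruct (B3 j) as (B31 & B32 & B33).
              rewrite (proj2 (Nat.eqb_neq j (S u)) Hju) in *.
              rewrite (proj2 (Nat.eqb_neq j q)) in * by lia.
              assert (a = 3 \/ a = 4 \/ a = 5) as [->|[->| ->]] by lia; assumption.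
           ++ right. right. split; [exact E0|]. split; [exact E1|]. exists q. split; [change (vr h3 5) with (S q); lia|]. split; [|exact Hout].
              unfold rule_out. destruct (B3 (S u)) as (-> & -> & ->). rewrite Nat.eqb_refl. auto.
  - intros h1 (dn & rs & E & Ei & Em & Et & A1 & Hg1 & He1 & Hno1 & I1 & I2 & I3 & I4).
    red1. rewrite Ei, Em. intros Hge.
    destruct (Nat.ltb_spec (length dn) (length O)) as [|Hlen]; [discriminate|clear Hge].
    assert (rs = []) as -> by (rewrite E, length_app in Hlen; destruct rs; cbn in Hlen; [auto|lia]).
    rewrite app_nil_r in E. subst dn. apply HQ; auto; lia.
Qed.
End Assemble.
End Routines.
Arguments fo_n {n st ln zmax O hv lt sd eta lng hd nxt}.
Arguments fo_ln {n st ln zmax O hv lt sd eta lng hd nxt}.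
Arguments fo_st {n st ln zmax O hv lt sd eta lng hd nxt}.
Arguments fo_root {n st ln zmax O hv lt sd eta lng hd nxt}.
Arguments fo_pair {n st ln zmax O hv lt sd eta lng hd nxt}.
Arguments st_m {ln O hv lt sd eta lng hd nxt h}.
Arguments st_ord {ln O hv lt sd eta lng hd nxt h}.
Arguments st_hv {ln O hv lt sd eta lng hd nxt h}.
Arguments st_sd {ln O hv lt sd eta lng hd nxt h}.

(** * Search for the reachable nonterminals *)

Definition child (r : rule) (x : nat) : Prop :=
  match r with
  | Term _ => False
  | Pair b c => x = b \/ x = c
  | Run b _ => x = b
  end.

Fixpoint stacked (f : nat -> nat) (s : list nat) : Prop :=
  match s with
  | [] => True
  | x :: s => f (length s) = x /\ stacked f s
  end.

Lemma stacked_ext f g s : (forall i, i < length s -> g i = f i) -> stacked f s -> stacked g s.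
Proof.
  induction s as [|x s IH]; [easy|]. cbn. intros H [H1 H2]. split.
  - rewrite H by lia. exact H1.
  - apply IH; auto.
Qed.

Section Search.
Variables w cap n st : nat.
Variable ln : nat -> nat.
Variable rl : nat -> rule.
Notation lim := (lim cap n).
Hypothesis Hfits : fits w cap n.
Hypothesis Hn : 200 * n + 200 <= lim.
Hypothesis Hst : st < n.
Hypothesis Hzmax : ln st < 2 ^ w.
Hypothesis Hrl : forall u, u < n ->
  (forall x, child (rl u) x -> x < n) /\
  match rl u with
  | Term _ => ln u = 1
  | Pair b c => ln u = ln b + ln c
  | Run b k => 2 < k /\ ln u = ln b * k
  end.
Hypothesis Hpos : forall u, u < n -> 0 < ln u.
Notation wp := (wp w cap n st).

Lemma wp_clear h (Q : astate -> Prop) :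
  (forall h', tk h' = tk h + n ->
     (forall u, u < n -> ar h' aLen u = 0 /\ ar h' aEta u = 0 /\ ar h' aLng u = 0 /\ ar h' aHd u = 0) ->
     (forall j, j <= n -> ar h' oTag j = 0 /\ ar h' oFst j = 0 /\ ar h' oSnd j = 0) ->
     (forall a, a < 3 -> ar h' a = ar h a) -> Q h') ->
  wp (clear cap) h Q.
Proof.
  clear Hst Hzmax Hrl Hpos ln. intros HQ. pose proof Hfits as [Hbig Hw].
  unfold clear. do 3 (w_seq; w_sto; red1; try lia). w_seq; w_asg; red1; [lia|].
  eapply wp_whl with (B := tk h + n) (I := fun h1 => exists i, i <= n /\ vr h1 rI = i /\ tk h1 = tk h + i /\
     (forall u, u < i -> ar h1 aLen u = 0 /\ ar h1 aEta u = 0 /\ ar h1 aLng u = 0 /\ ar h1 aHd u = 0) /\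
     (forall j, j <= i -> ar h1 oTag j = 0 /\ ar h1 oFst j = 0 /\ ar h1 oSnd j = 0) /\
     (forall a, a < 3 -> ar h1 a = ar h a)).
  1: exact Hfits.
  - exists 0. red1. split; [lia|]. split; [reflexivity|]. split; [lia|]. split; [lia|]. split.
    + intros j Hj. assert (j = 0) as -> by lia. auto.
    + intros a Ha. arr_tac.
  - intros h1 (i & H1 & H2 & H3 & _). red1. split; auto; lia.
  - intros h1 (i & H1 & H2 & H3 & H4 & H5 & H6). red1. rewrite H2. intros Hlt.
    destruct (Nat.ltb_spec i n) as [Hi|]; [clear Hlt|now destruct Hlt].
    do 7 (w_seq; w_sto; red1; rewrite ?H2; try lia).
    w_asg; red1; rewrite ?H2; try lia.
    exists (i + 1). red1. split; [lia|]. split; [reflexivity|]. split; [lia|]. split; [|split].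
    + intros u Hu. unfold update. destruct (Nat.eqb_spec u i); [auto|]. apply H4. lia.
    + intros j Hj. unfold update. destruct (Nat.eqb_spec j (i + 1)); [auto|]. apply H5. lia.
    + intros a Ha. rewrite <- H6 by exact Ha. arr_tac.
  - intros h1 (i & H1 & H2 & H3 & H4 & H5 & H6). red1. rewrite H2. intros Hlt.
    destruct (Nat.ltb_spec i n) as [|Hi]; [discriminate|]. assert (i = n) as -> by lia.
    apply HQ; auto.
Qed.

Definition closed (l : list nat) : Prop :=
  forall d1 u d2, l = d1 ++ u :: d2 -> forall x, child (rl u) x -> In x d1.

Record searched (h : astate) (l : list nat) : Prop := Searched {
  se_m : vr h rM = length l;
  se_ord : forall i, i < length l -> ar h aOrd i = nth i l 0;
  se_nodup : NoDup l;
  se_n : forall u, In u l -> u < n /\ ln u <= ln st;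
  se_in : forall u, In u l -> ar h aLen u = ln u;
  se_out : forall u, u < n -> ~ In u l -> ar h aLen u = 0;
  se_closed : closed l }.

Lemma closed_snoc l u : closed l -> (forall x, child (rl u) x -> In x l) -> closed (l ++ [u]).
Proof.
  intros Hl Hu d1 v d2 E x Hx. destruct d2 as [|y d2] using rev_ind.
  - apply app_inj_tail in E as [-> ->]. auto.
  - clear IHd2. rewrite app_comm_cons, app_assoc in E. apply app_inj_tail in E as [-> _].
    eapply Hl; eauto.
Qed.

(** Children are strictly shorter than their parents, so lengths increase down the stack. This
    excludes repetitions, which bounds stack and list together by [n]. In the tick equation each
    nonterminal counts once when pushed and once more when finished; the start is pushed before the
    loop, hence the [+ 1]. *)
Definition searching (h h1 : astate) : Prop := exists l s, searched h1 l /\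
  vr h1 rSp = length s /\ stacked (ar h1 aStk) s /\ StronglySorted (fun x y => ln x < ln y) s /\
  (forall x, In x s -> x < n /\ ln x <= ln st /\ ~ In x l) /\
  In st (l ++ s) /\ length l + length s <= n /\ tk h1 + 1 = tk h + 2 * length l + length s /\
  (forall a, ~ In a [aLen; aOrd; aStk] -> ar h1 a = ar h a).

Lemma wp_search h (Q : astate -> Prop) :
  (forall u, u < n -> rule_in h u (rl u)) ->
  (forall u, u < n -> ar h aLen u = 0) ->
  (forall h' l, searched h' l -> In st l -> tk h' <= tk h + 3 * n ->
     (forall a, ~ In a [aLen; aOrd; aStk] -> ar h' a = ar h a) -> Q h') ->
  wp (search cap) h Q.
Proof.
  intros Hin H0 HQ. pose proof Hfits as [Hbig Hw].
  unfold search. w_seq; w_sto; red1; try lia.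
  do 2 (w_seq; w_asg; red1; [lia|]).
  eapply wp_whl with (B := tk h + 3 * n) (I := searching h).
  1: exact Hfits.
  - exists [], [st]. red1. split.
    { constructor; cbn; auto; try easy; try lia; [constructor|]. intros d1 u d2 E. now destruct d1. }
    split; [reflexivity|]. split; [cbn; auto|]. split; [repeat constructor|].
    split; [intros x [<-|[]]; cbn; auto|]. split; [now left|]. split; [cbn; lia|]. split; [cbn; lia|].
    intros a Ha. arr_tac. subst. cbn in Ha. tauto.
  - intros h1 (l & s & H1 & H2 & H3 & H4 & H5 & H6 & H7 & H8 & H9). red1. split; [exact I|lia].
  - intros h1 (l & s & H1 & H2 & H3 & H4 & H5 & H6 & H7 & H8 & H9). red1. rewrite H2. intros Hs.
    destruct s as [|u s]; [cbn in Hs; lia|]. clear Hs. cbn [length stacked] in *. destruct H3 as [H3 H3'].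
    destruct (H5 u (or_introl eq_refl)) as (Hu1 & Hu2 & Hu3).
    inversion_clear H4 as [|? ? H4' H4f]. destruct (Hrl u Hu1) as [Hch Hlu].
    pose proof (Hin u Hu1) as Hru.
    assert (Hl0 : forall x, x < n -> ar h1 aLen x = 0 <-> ~ In x l).
    { intros x Hx. split; [|apply (se_out _ _ H1); exact Hx]. intros E Hxl.
      rewrite (se_in _ _ H1 x Hxl) in E. specialize (Hpos x Hx). lia. }
    assert (Ha9 : forall a, a < 3 -> ar h1 a = ar h a) by (intros; apply H9; cbn; lia).
    assert (Hsp : vr h1 rSp - 1 = length s) by lia.
    assert (Hfin : forall e h2, tk h2 = S (tk h1) -> ar h2 = ar h1 -> vr h2 rSp = vr h1 rSp -> vr h2 rM = vr h1 rM ->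
       vr h2 rU = u -> ok w cap n st h2 e -> val n st h2 e = ln u -> (forall x, child (rl u) x -> In x l) ->
       wp (finish cap e) h2 (searching h)).
    { intros e h2 E1 E2 E3 E4 E5 E6 E7 E8. pose proof (se_m _ _ H1) as Em. unfold finish.
      w_seq; w_sto; red1; rewrite ?E5, ?E7; auto; try lia.
      w_seq; w_sto; red1; rewrite ?E4, ?E5, ?Em; try lia.
      w_seq; w_asg; red1; rewrite ?E4, ?Em; try lia.
      w_asg; red1; rewrite ?E3, ?Hsp; try lia.
      exists (l ++ [u]), s. red1. rewrite ?E2. split; [|split; [reflexivity|]].
      - constructor; red1; rewrite ?E2, ?length_app; cbn [length].
        + lia.
        + intros i Hi. unfold update. destruct (Nat.eqb_spec i (length l)) as [->|].
          * now rewrite app_nth2, Nat.sub_diag by lia.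
          * rewrite app_nth1 by lia. apply (se_ord _ _ H1). lia.
        + apply NoDup_app; [apply (se_nodup _ _ H1)|repeat constructor; easy|].
          intros x Hx [<-|[]]. tauto.
        + intros x Hx. apply in_app_iff in Hx as [Hx|[<-|[]]]; [now apply (se_n _ _ H1)|auto].
        + intros x Hx. unfold update. destruct (Nat.eqb_spec x u) as [->|]; [reflexivity|].
          apply in_app_iff in Hx as [Hx|[<-|[]]]; [now apply (se_in _ _ H1)|tauto].
        + intros x Hx Hxl. rewrite in_app_iff in Hxl. cbn in Hxl. unfold update.
          destruct (Nat.eqb_spec x u) as [->|]; [tauto|]. apply (se_out _ _ H1); tauto.
        + apply closed_snoc; [apply (se_closed _ _ H1)|exact E8].
      - split; [exact H3'|]. split; [exact H4'|]. split; [|split; [|split; [|split]]].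
        + intros x Hx. destruct (H5 x (or_intror Hx)) as (X1 & X2 & X3). split; [exact X1|]. split; [exact X2|].
          rewrite in_app_iff. intros [?|[->|[]]]; [tauto|].
          rewrite Forall_forall in H4f. specialize (H4f x Hx). lia.
        + rewrite <- app_assoc. exact H6.
        + rewrite length_app. cbn. lia.
        + rewrite length_app. cbn. lia.
        + intros a Ha. rewrite <- H9 by exact Ha. rewrite <- E2. arr_tac; subst; cbn in Ha; tauto. }
    assert (Hpush : forall r x h2, tk h2 = S (tk h1) -> ar h2 = ar h1 -> vr h2 rSp = vr h1 rSp -> vr h2 rM = vr h1 rM ->
       vr h2 r = x -> child (rl u) x -> ~ In x l -> ln x < ln u ->
       wp (push_node cap (Vr r)) h2 (searching h)).
    { intros r x h2 E1 E2 E3 E4 E5 E6 E7 E8. pose proof (Hch x E6) as Hxn. unfold push_node.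
      w_seq; w_sto; red1; rewrite ?E3, ?E5, ?H2; try lia.
      w_asg; red1; rewrite ?E3, ?H2; try lia.
      assert (Hss : StronglySorted (fun x y => ln x < ln y) (x :: u :: s)).
      { constructor; [constructor; assumption|]. constructor; [exact E8|].
        eapply Forall_impl; [|exact H4f]. cbn. lia. }
      assert (Hxs : forall y, In y (x :: u :: s) -> y < n /\ ln y <= ln st /\ ~ In y l).
      { intros y [<-|Hy]; [|now apply H5]. split; [exact Hxn|]. split; [lia|exact E7]. }
      exists l, (x :: u :: s). red1. rewrite ?E2. split; [|split; [cbn; lia|]].
      - destruct H1 as [X1 X2 X3 X4 X5 X6 X7]. constructor; red1; rewrite ?E2; auto. now rewrite E4.
      - split.
        { cbn [stacked length]. unfold update at 1. rewrite Nat.eqb_refl. split; [reflexivity|].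
          change (stacked (update (ar h1 8) (S (length s)) x) (u :: s)).
          eapply stacked_ext; [|cbn; split; [|exact H3']].
          - intros i Hi. unfold update. cbn in Hi. destruct (Nat.eqb_spec i (S (length s))); [lia|reflexivity].
          - exact H3. }
        split; [exact Hss|]. split; [exact Hxs|]. split; [|split; [|split]].
        + rewrite in_app_iff in *. cbn in *. tauto.
        + rewrite <- length_app. apply NoDup_length_le.
          * apply NoDup_app; [apply (se_nodup _ _ H1)| |].
            -- clear - Hss. induction Hss as [|y t Ht IH Hf]; constructor; [|exact IH].
               intros Hy. rewrite Forall_forall in Hf. specialize (Hf y Hy). lia.
            -- intros y Hy Hy'. apply Hxs in Hy'. tauto.
          * intros y Hy. apply in_app_iff in Hy as [Hy|Hy]; [now apply (se_n _ _ H1)|now apply Hxs].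
        + cbn [length]. lia.
        + intros a Ha. rewrite <- H9 by exact Ha. rewrite <- E2. arr_tac; subst; cbn in Ha; tauto. }
    replace (S (length s) - 1) with (length s) in * by lia.
    w_seq; w_asg; red1; rewrite ?Hsp, ?H3; try lia.
    w_ite; red1; rewrite ?Ha9 by lia; [lia| |]; intros Ht.
    + assert (Et : ar h aTag u = 0) by (destruct (Nat.eqb_spec (ar h aTag u) 0); [auto|now destruct Ht]).
      destruct (rl u) as [a|b c|b k] eqn:Er; cbn in Hru; try lia.
      apply Hfin; auto; [red1; lia|easy].
    + assert (Et : ar h aTag u <> 0) by (destruct (Nat.eqb_spec (ar h aTag u) 0); [discriminate|auto]).
      assert (Ev : child (rl u) (ar h aFst u)).
      { destruct (rl u) as [a|b c|b k]; cbn in Hru |- *; lia. }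
      pose proof (Hch _ Ev) as Hvn. pose proof (Hpos _ Hvn) as Hvp. pose proof (Hpos _ Hu1) as Hup.
      assert (Hvu : ln (ar h aFst u) < ln u).
      { destruct (rl u) as [a|b c|b k]; cbn in Hru; destruct Hru as (R1 & R2 & R3); [lia| |].
        - rewrite R2. specialize (Hpos c (Hch c (or_intror eq_refl))). lia.
        - rewrite R2 in *. nia. }
      w_seq; w_asg; red1; rewrite ?Ha9 by lia; try lia.
      w_ite; red1; [lia| |]; intros Hv.
      * apply Hpush with (x := ar h aFst u); auto. apply Hl0; [exact Hvn|].
        destruct (Nat.eqb_spec (ar h1 aLen (ar h aFst u)) 0); [auto|now destruct Hv].
      * assert (Hvl : In (ar h aFst u) l).
        { destruct (in_dec Nat.eq_dec (ar h aFst u) l) as [|Hno]; [auto|]. apply Hl0 in Hno; [|exact Hvn].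
          rewrite Hno in Hv. discriminate. }
        clear Hv. pose proof (se_in _ _ H1 _ Hvl) as Elv.
        w_ite; red1; rewrite ?Ha9 by lia; [lia| |]; intros Ht2.
        -- assert (Et2 : ar h aTag u = 2) by (destruct (Nat.eqb_spec (ar h aTag u) 2); [auto|now destruct Ht2]).
           destruct (rl u) as [a|b c|b k] eqn:Er; cbn in Hru; try lia.
           destruct Hru as (R1 & R2 & R3).
           apply Hfin; auto.
           ++ red1. rewrite ?(Ha9 1), ?(Ha9 2) by lia. rewrite R2, R3 in *. rewrite Elv. lia.
           ++ red1. rewrite ?(Ha9 1), ?(Ha9 2) by lia. rewrite R2, R3 in *. rewrite Elv. lia.
           ++ cbn. intros x ->. now rewrite <- R2.
        -- assert (Et2 : ar h aTag u <> 2) by (destruct (Nat.eqb_spec (ar h aTag u) 2); [discriminate|auto]).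
           destruct (rl u) as [a|b c|b k] eqn:Er; cbn in Hru; try lia.
           destruct Hru as (R1 & R2 & R3). rewrite R2 in *.
           pose proof (Hch c (or_intror eq_refl)) as Hcn. pose proof (Hpos c Hcn) as Hcp.
           w_seq; w_asg; red1; rewrite ?Ha9, ?R3 by lia; try lia.
           w_ite; red1; [lia| |]; intros Hc.
           ++ apply Hpush with (x := c); auto; [now right| |lia]. apply Hl0; [exact Hcn|].
              destruct (Nat.eqb_spec (ar h1 aLen c) 0); [auto|now destruct Hc].
           ++ assert (Hcl : In c l).
              { destruct (in_dec Nat.eq_dec c l) as [|Hno]; [auto|]. apply Hl0 in Hno; [|exact Hcn].
                rewrite Hno in Hc. discriminate. }
              pose proof (se_in _ _ H1 _ Hcl) as Elc.
              apply Hfin; auto.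
              ** red1. rewrite Elv, Elc. lia.
              ** red1. rewrite Elv, Elc. lia.
              ** cbn. intros x [->| ->]; auto.
  - intros h1 (l & s & H1 & H2 & H3 & H4 & H5 & H6 & H7 & H8 & H9). red1. rewrite H2. intros Hs.
    destruct s; [|cbn in Hs; lia]. rewrite app_nil_r in H6.
    apply HQ with (l := l); auto. cbn in *. lia.
Qed.
End Search.
Arguments se_m {n st ln rl h l}.
Arguments se_ord {n st ln rl h l}.
Arguments se_nodup {n st ln rl h l}.
Arguments se_n {n st ln rl h l}.
Arguments se_in {n st ln rl h l}.
Arguments se_out {n st ln rl h l}.
Arguments se_closed {n st ln rl h l}.

Lemma linked_ext f g p l : (forall x, In x l -> g x = f x) -> linked f p l -> linked g p l.
Proof.
  revert p. induction l as [|x l IH]; intros p; cbn; [auto|]. intros H [H1 H2]. split; [exact H1|].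
  rewrite H by auto. apply IH; auto.
Qed.

(** * Construction of the forest *)

Section ForestPhase.
Variables w cap n st : nat.
Variable ln : nat -> nat.
Variable rl : nat -> rule.
Variable O : list nat.
Notation lim := (lim cap n).
Hypothesis Hfits : fits w cap n.
Hypothesis Hn : 200 * n + 200 <= lim.
Hypothesis HOn : forall u, In u O -> u < n.
Hypothesis HOnd : NoDup O.
Hypothesis Hclosed : closed rl O.
Hypothesis Hst : In st O.
Hypothesis Hln : forall u, In u O -> 0 < ln u <= ln st.
Hypothesis Hpair : forall u b c, In u O -> rl u = Pair b c -> ln u = ln b + ln c.
Notation wp := (wp w cap n st).

Definition hvf u := match rl u with Pair b c => if ln b <? ln c then c else b | _ => u end.
Definition ltf u := match rl u with Pair b c => if ln b <? ln c then b else c | _ => u end.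
Definition sdf u := match rl u with Pair b c => if ln b <? ln c then 0 else 1 | _ => 2 end.

Lemma sdf_pair u : sdf u < 2 -> exists b c, rl u = Pair b c.
Proof. clear. unfold sdf. destruct (rl u); eauto; lia. Qed.

Lemma forest_ord dn u rs : O = dn ++ u :: rs -> sdf u < 2 -> In (hvf u) dn /\ In (ltf u) dn.
Proof.
  intros E Hsd. destruct (sdf_pair u Hsd) as (b & c & Er).
  assert (Hb : In b dn) by (eapply Hclosed; [exact E|rewrite Er; cbn; auto]).
  assert (Hc : In c dn) by (eapply Hclosed; [exact E|rewrite Er; cbn; auto]).
  unfold hvf, ltf. rewrite Er. destruct (_ <? _); auto.
Qed.

(** The invariant describes the forest on the processed tail [rs] of the order. [lng v] changes only
    together with a strict increase of the height of [v], so it always names a child attaining the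
    maximum, whose own height is already final. *)
Lemma wp_forest h (Q : astate -> Prop) :
  vr h rM = length O ->
  (forall i, i < length O -> ar h aOrd i = nth i O 0) ->
  (forall u, In u O -> rule_in h u (rl u)) ->
  (forall u, In u O -> ar h aLen u = ln u) ->
  (forall u, u < n -> ar h aEta u = 0 /\ ar h aLng u = 0 /\ ar h aHd u = 0) ->
  (forall h' eta lng hd nxt,
     forest n st ln (ln st) O hvf ltf sdf eta lng hd nxt ->
     (forall v, In v O -> 0 < eta v -> lng v <> 0) ->
     static ln O hvf ltf sdf eta lng hd nxt h' ->
     tk h' = tk h + length O ->
     (forall a, ~ In a [aHv; aLt; aSd; aEta; aLng; aHd; aNxt] -> ar h' a = ar h a) -> Q h') ->
  wp (link_forest cap) h Q.
Proof.
  intros Hm Hord Hrule Hlen Hzero HQ. pose proof Hfits as [Hbig Hw].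
  pose proof (NoDup_length_le n O HOnd HOn) as HOl.
  unfold link_forest. w_seq; w_asg; red1; [exact I|].
  eapply wp_whl with (B := tk h + length O) (I := fun h1 => exists dn rs, O = dn ++ rs /\ vr h1 rI = length dn /\
     vr h1 rM = length O /\ tk h1 = tk h + length rs /\
     (forall a, ~ In a [aHv; aLt; aSd; aEta; aLng; aHd; aNxt] -> ar h1 a = ar h a) /\
     (forall u, In u rs -> ar h1 aHv u = hvf u /\ ar h1 aSd u = sdf u /\ (sdf u < 2 -> ar h1 aLt u = ltf u)) /\
     (forall u, In u rs -> sdf u < 2 -> ar h1 aEta u < ar h1 aEta (hvf u)) /\
     (forall u v, In v O -> ar h1 aLng v = S u -> In u rs /\ sdf u < 2 /\ hvf u = v /\ ar h1 aEta v = S (ar h1 aEta u)) /\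
     (forall v, In v O -> 0 < ar h1 aEta v -> ar h1 aLng v <> 0) /\
     (forall v, In v O -> ar h1 aEta v <= length rs) /\
     (forall v, In v O -> exists ch, linked (ar h1 aNxt) (ar h1 aHd v) ch /\ NoDup ch /\
        forall x, In x ch <-> In x rs /\ sdf x < 2 /\ hvf x = v)).
  1: exact Hfits.
  - exists O, []. red1. rewrite app_nil_r. split; [reflexivity|]. split; [exact Hm|]. split; [exact Hm|].
    split; [cbn; lia|]. split; [reflexivity|]. split; [easy|]. split; [easy|].
    split; [|split; [|split]].
    + intros u v Hv E. destruct (Hzero v (HOn v Hv)) as (_ & E' & _). lia.
    + intros v Hv Hp. destruct (Hzero v (HOn v Hv)). lia.
    + intros v Hv. destruct (Hzero v (HOn v Hv)). lia.
    + intros v Hv. exists []. destruct (Hzero v (HOn v Hv)) as (_ & _ & E'). split; [exact E'|].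
      split; [constructor|]. cbn. tauto.
  - intros h1 (dn & rs & E & Ei & Em & Et & _). red1. split; [exact I|]. rewrite Et, E, length_app. lia.
  - intros h1 (dn & rs & E & Ei & Em & Et & A1 & I1 & I2 & I3 & I4 & I5 & I6). red1. rewrite Ei. intros Hne.
    destruct dn as [|u dn _] using rev_ind; [cbn in Hne; lia|]. clear Hne.
    rewrite <- app_assoc in E. cbn [app] in E. rewrite length_app in Ei. cbn [length] in Ei.
    assert (HuO : In u O) by (rewrite E; apply in_elt). pose proof (HOn u HuO) as Hun.
    assert (Hnd : ~ In u dn /\ ~ In u rs /\ forall x, In x dn -> ~ In x rs).
    { rewrite E in HOnd. pose proof (NoDup_remove_2 _ _ _ HOnd) as H2. rewrite in_app_iff in H2.
      split; [tauto|]. split; [tauto|]. intros x Hx Hx'.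
      apply NoDup_remove_1 in HOnd. apply in_split in Hx as (d1 & d2 & ->).
      rewrite <- app_assoc in HOnd. cbn in HOnd. apply NoDup_remove_2 in HOnd. apply HOnd.
      rewrite !in_app_iff. auto. }
    assert (Hlen' : length dn + S (length rs) = length O) by (rewrite E, length_app; reflexivity).
    assert (Hou : ar h aOrd (length dn) = u).
    { rewrite Hord by lia. rewrite E, app_nth2, Nat.sub_diag by lia. reflexivity. }
    pose proof (Hrule u HuO) as Hru.
    w_seq; w_asg; red1; rewrite ?Ei; try lia. replace (length dn + 1 - 1) with (length dn) by lia.
    w_seq; w_asg; red1; rewrite ?(A1 aOrd) by (cbn; lia); rewrite ?Hou; try lia.
    w_ite; red1; rewrite ?(A1 aTag) by (cbn; lia); [lia| |]; intros Ht.
    + assert (Et1 : ar h aTag u = 1) by (destruct (Nat.eqb_spec (ar h aTag u) 1); [auto|now destruct Ht]).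
      destruct (rl u) as [a|b c|b k] eqn:Er; cbn in Hru; try lia. destruct Hru as (_ & R2 & R3). clear Ht.
      pose proof (Hclosed dn u rs E) as Hcl. rewrite Er in Hcl. cbn in Hcl.
      pose proof (Hcl b (or_introl eq_refl)) as Hb. pose proof (Hcl c (or_intror eq_refl)) as Hc. clear Hcl.
      assert (HbO : In b O) by (rewrite E; apply in_app_iff; auto).
      assert (HcO : In c O) by (rewrite E; apply in_app_iff; auto).
      pose proof (HOn b HbO). pose proof (HOn c HcO).
      set (v := hvf u). set (x := ltf u).
      assert (Hsd : sdf u < 2) by (unfold sdf; rewrite Er; destruct (_ <? _); lia).
      destruct (forest_ord dn u rs E Hsd) as [Hv _]. fold v in Hv.
      assert (HvO : In v O) by (rewrite E; apply in_app_iff; auto). pose proof (HOn v HvO) as Hvn.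
      assert (Hvu : v <> u) by (intros Ev; rewrite Ev in Hv; tauto).
      assert (Hvrs : ~ In v rs) by (now apply Hnd).
      assert (Hchoose : forall h2, ar h2 = ar h1 -> vr h2 rU = u -> forall Q2,
        (forall h3, tk h3 = tk h2 -> (forall y, y <> rV -> vr h3 y = vr h2 y) -> vr h3 rV = v ->
           ar h3 aLt u = x -> ar h3 aSd u = sdf u ->
           (forall y, y <> u -> ar h3 aLt y = ar h2 aLt y /\ ar h3 aSd y = ar h2 aSd y) ->
           (forall a, a <> aLt -> a <> aSd -> ar h3 a = ar h2 a) -> Q2 h3) ->
        wp (ite cap (Ltb (Ar aLen (Ar aFst (Vr rU))) (Ar aLen (Ar aSnd (Vr rU))))
              (asg cap rV (Ar aSnd (Vr rU));; sto cap aLt (Vr rU) (Ar aFst (Vr rU));; sto cap aSd (Vr rU) (Cn 0))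
              (asg cap rV (Ar aFst (Vr rU));; sto cap aLt (Vr rU) (Ar aSnd (Vr rU));; sto cap aSd (Vr rU) (Cn 1))) h2 Q2).
      { intros h2 E2 EU Q2 HQ2.
        assert (L2 : forall y, In y O -> ar h1 aLen y = ln y) by (intros; rewrite A1 by (cbn; lia); auto).
        assert (F1 : ar h1 aFst u = b) by (rewrite A1 by (cbn; lia); auto).
        assert (F2 : ar h1 aSnd u = c) by (rewrite A1 by (cbn; lia); auto).
        assert (Ev : v = if ln b <? ln c then c else b) by (unfold v, hvf; now rewrite Er).
        assert (Ex : x = if ln b <? ln c then b else c) by (unfold x, ltf; now rewrite Er).
        assert (Es : sdf u = if ln b <? ln c then 0 else 1) by (unfold sdf; now rewrite Er).
        w_ite; red1; rewrite ?E2, ?EU, ?F1, ?F2, ?L2 by auto; [lia| |]; intros Hlt;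
          [assert (Ec : (ln b <? ln c) = true) by (destruct (ln b <? ln c); [auto|now destruct Hlt])
          |assert (Ec : (ln b <? ln c) = false) by (destruct (ln b <? ln c); [discriminate|auto])];
          rewrite Ec in *;
          (w_seq; w_asg; red1; rewrite ?E2, ?EU, ?F1, ?F2; try lia);
          (w_seq; w_sto; red1; rewrite ?E2, ?EU, ?F1, ?F2; try lia);
          (w_sto; red1; rewrite ?E2, ?EU, ?F1, ?F2; try lia);
          (apply HQ2; [reflexivity|intros; arr_tac|arr_tac|arr_tac|arr_tac|intros; split; arr_tac|intros; arr_tac]). }
      w_seq. apply Hchoose; [reflexivity|reflexivity|].
      intros h3 T3 V3 V3v L3 S3 F3 A3. red1in T3.
      assert (W1 : vr h3 rU = u) by (rewrite V3 by lia; reflexivity).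
      assert (A31 : forall a, a <> aLt -> a <> aSd -> ar h3 a = ar h1 a).
      { intros a Ha Ha'. rewrite A3 by auto. reflexivity. }
      w_seq; w_sto; red1; rewrite ?W1, ?V3v; try lia.
      pose proof (I5 u HuO) as Heu.
      set (m := S (ar h1 aEta u)). set (ev := Nat.max (ar h1 aEta v) m).
      set (lv := if ar h1 aEta v <? m then S u else ar h1 aLng v).
      w_seq.
      (* Both outcomes of the test leave the maximum in the height, so one pointwise description of
         the arrays covers them. *)
      apply wp_conseq with (Q := fun h4 => tk h4 = tk h3 /\ (forall y, vr h4 y = vr h3 y) /\
         (forall a, ~ In a [aEta; aLng; aHv] -> ar h4 a = ar h3 a) /\
         (forall a y, ar h4 a y = if ((a =? aHv) && (y =? u))%bool then v else if ((a =? aEta) && (y =? v))%bool then ev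
            else if ((a =? aLng) && (y =? v))%bool then lv else ar h3 a y)).
      { w_ite; red1; rewrite ?W1, ?V3v, ?A31 by lia; [lia| |]; intros Hlt.
        - destruct (Nat.ltb_spec (ar h1 aEta v) (ar h1 aEta u + 1)) as [Hm1|]; [clear Hlt|now destruct Hlt].
          w_seq; w_sto; red1; rewrite ?W1, ?V3v, ?A31 by lia; try lia.
          w_sto; red1; rewrite ?W1, ?V3v; try lia.
          split; [reflexivity|]. split; [reflexivity|]. split; [keep_tac|]. intros a y.
          assert (Elv : lv = u + 1) by (unfold lv, m; destruct (Nat.ltb_spec (ar h1 aEta v) (S (ar h1 aEta u))); lia).
          assert (Eev : ev = ar h1 aEta u + 1) by (unfold ev, m; lia). rewrite Elv, Eev.
          red1. unfold update.
          destruct (Nat.eqb_spec a 13) as [->|]; [red1; cbn [andb]; destruct (Nat.eqb_spec y v); reflexivity|].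
          destruct (Nat.eqb_spec a 12) as [->|]; [red1; cbn [andb]; destruct (Nat.eqb_spec y v); reflexivity|].
          destruct (Nat.eqb_spec a 9) as [->|]; [cbn [andb]; destruct (Nat.eqb_spec y u); reflexivity|reflexivity].
        - destruct (Nat.ltb_spec (ar h1 aEta v) (ar h1 aEta u + 1)) as [|Hm1]; [discriminate|clear Hlt].
          apply wp_skip. split; [reflexivity|]. split; [reflexivity|]. split; [keep_tac|]. intros a y.
          assert (Elv : lv = ar h1 aLng v) by (unfold lv, m; destruct (Nat.ltb_spec (ar h1 aEta v) (S (ar h1 aEta u))); lia).
          assert (Eev : ev = ar h1 aEta v) by (unfold ev, m; lia). rewrite Elv, Eev.
          red1. unfold update.
          destruct (Nat.eqb_spec a 9) as [->|]; [red1; cbn [andb]; destruct (Nat.eqb_spec y u); reflexivity|].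
          cbn [andb].
          destruct (Nat.eqb_spec a 12) as [->|]; [cbn [andb]; destruct (Nat.eqb_spec y v) as [->|]; [now rewrite A31 by lia|reflexivity]|].
          destruct (Nat.eqb_spec a 13) as [->|]; [cbn [andb]; destruct (Nat.eqb_spec y v) as [->|]; [now rewrite A31 by lia|reflexivity]|].
          reflexivity. }
      intros h4 (T4 & V4 & AA4 & A4).
      assert (X1 : vr h4 rU = u) by (rewrite V4; exact W1).
      assert (X2 : vr h4 rV = v) by (rewrite V4; exact V3v).
      assert (X3 : ar h4 aHd v = ar h1 aHd v) by (rewrite A4; cbn [Nat.eqb andb]; now rewrite A31 by lia).
      w_seq; w_sto; red1; rewrite ?X1, ?X2, ?X3; try lia.
      w_sto; [red1; lia|red1; rewrite ?X1; lia|lia|red1; lia|].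
      match goal with |- context [seta ?h0 14 ?i ?e] => set (h5 := seta h0 14 i e) end.
      assert (A5 : forall a y, ar h5 a y = if ((a =? aHd) && (y =? v))%bool then S u else
         if ((a =? aNxt) && (y =? u))%bool then ar h1 aHd v else ar h4 a y).
      { intros a y. unfold h5. red1. rewrite X1, X2. unfold update.
        destruct (Nat.eqb_spec a 14) as [->|]; cbn [andb].
        - destruct (Nat.eqb_spec y v); [lia|reflexivity].
        - destruct (Nat.eqb_spec a 15) as [->|]; [cbn [andb]; destruct (Nat.eqb_spec y u); reflexivity|reflexivity]. }
      assert (Beta : forall y, ar h5 aEta y = if y =? v then ev else ar h1 aEta y).
      { intros y. rewrite A5, A4. cbn [Nat.eqb andb]. destruct (y =? v); [reflexivity|]. now rewrite A31 by lia. }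
      assert (Blng : forall y, ar h5 aLng y = if y =? v then lv else ar h1 aLng y).
      { intros y. rewrite A5, A4. cbn [Nat.eqb andb]. destruct (y =? v); [reflexivity|]. now rewrite A31 by lia. }
      assert (Bhv : forall y, ar h5 aHv y = if y =? u then v else ar h1 aHv y).
      { intros y. rewrite A5, A4. cbn [Nat.eqb andb]. destruct (y =? u); [reflexivity|]. now rewrite A31 by lia. }
      assert (Bhd : forall y, ar h5 aHd y = if y =? v then S u else ar h1 aHd y).
      { intros y. rewrite A5, A4. cbn [Nat.eqb andb]. destruct (y =? v); [reflexivity|]. now rewrite A31 by lia. }
      assert (Bnxt : forall y, ar h5 aNxt y = if y =? u then ar h1 aHd v else ar h1 aNxt y).
      { intros y. rewrite A5, A4. cbn [Nat.eqb andb]. destruct (y =? u); [reflexivity|]. now rewrite A31 by lia. }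
      assert (Bsl : forall y, y <> u -> ar h5 aSd y = ar h1 aSd y /\ ar h5 aLt y = ar h1 aLt y).
      { intros y Hy. rewrite !A5, !A4. cbn [Nat.eqb andb]. destruct (F3 y Hy) as [-> ->]. auto. }
      assert (Hne : forall y, In y rs -> y <> u /\ y <> v) by (intros y Hy; split; intros ->; tauto).
      assert (Eetau : ar h5 aEta u = ar h1 aEta u).
      { rewrite Beta. destruct (Nat.eqb_spec u v); [congruence|reflexivity]. }
      exists dn, (u :: rs). split; [exact E|].
      split; [change (vr h5 0) with (vr h4 0); rewrite V4, V3 by lia; reflexivity|].
      split; [change (vr h5 4) with (vr h4 4); rewrite V4, V3 by lia; exact Em|].
      split; [change (tk h5) with (tk h4); cbn [length]; lia|].
      split.
      { intros a Ha. transitivity (ar h4 a).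
        - unfold h5, seta; cbn [ar]. destruct (Nat.eqb_spec a 14); [subst; cbn in Ha; tauto|].
          destruct (Nat.eqb_spec a 15); [subst; cbn in Ha; tauto|reflexivity].
        - rewrite AA4 by (cbn in *; tauto). rewrite A31 by (intros ->; cbn in Ha; tauto). now apply A1. }
      split; [|split; [|split; [|split; [|split]]]].
      * intros y [<-|Hy].
        -- rewrite Bhv, Nat.eqb_refl. rewrite !A5, !A4. cbn [Nat.eqb andb]. auto.
        -- destruct (Hne y Hy) as [N1 _]. rewrite Bhv. destruct (Nat.eqb_spec y u); [tauto|].
           destruct (Bsl y N1) as [-> ->]. now apply I1.
      * intros y [<-|Hy] Hy2.
        -- rewrite Eetau. fold v. rewrite Beta, Nat.eqb_refl. unfold ev, m. lia.
        -- destruct (Hne y Hy) as [N1 N2]. rewrite !Beta. destruct (Nat.eqb_spec y v); [tauto|].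
           specialize (I2 y Hy Hy2). destruct (Nat.eqb_spec (hvf y) v) as [Ey|]; [|exact I2].
           rewrite Ey in I2. unfold ev. lia.
      * intros y z Hz. rewrite Blng, Beta. destruct (Nat.eqb_spec z v) as [->|Hzv].
        -- unfold lv, ev, m. destruct (Nat.ltb_spec (ar h1 aEta v) (S (ar h1 aEta u))) as [Hlt|Hge]; intros Ey.
           ++ injection Ey as <-. rewrite Eetau. split; [now left|]. split; [exact Hsd|]. split; [reflexivity|lia].
           ++ destruct (I3 y v Hz Ey) as (J1 & J2 & J3 & J4). destruct (Hne y J1) as [N1 N2].
              rewrite Beta. destruct (Nat.eqb_spec y v); [tauto|].
              split; [now right|]. split; [exact J2|]. split; [exact J3|]. lia.
        -- intros Ey. destruct (I3 y z Hz Ey) as (J1 & J2 & J3 & J4). destruct (Hne y J1) as [N1 N2].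
           rewrite Beta. destruct (Nat.eqb_spec y v); [tauto|]. split; [now right|auto].
      * intros y Hy. rewrite Blng, Beta. destruct (Nat.eqb_spec y v) as [->|]; [|now apply I4].
        unfold lv, ev, m. destruct (Nat.ltb_spec (ar h1 aEta v) (S (ar h1 aEta u))); [lia|].
        intros Hp. apply I4; [exact Hy|lia].
      * intros y Hy. rewrite Beta. cbn [length]. pose proof (I5 y Hy).
        destruct (Nat.eqb_spec y v) as [->|]; [unfold ev, m|]; lia.
      * intros y Hy. destruct (I6 y Hy) as (ch & C1 & C2 & C3). rewrite Bhd.
        assert (Hnx : forall z, In z ch -> ar h5 aNxt z = ar h1 aNxt z).
        { intros z Hz. apply C3 in Hz as (Z1 & _). rewrite Bnxt.
          destruct (Nat.eqb_spec z u) as [->|]; [tauto|reflexivity]. }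
        destruct (Nat.eqb_spec y v) as [->|Hyv].
        -- exists (u :: ch). split; [|split].
           ++ change (S u = S u /\ linked (ar h5 aNxt) (ar h5 aNxt u) ch). split; [reflexivity|]. rewrite Bnxt, Nat.eqb_refl.
              eapply linked_ext; [exact Hnx|exact C1].
           ++ constructor; [|exact C2]. rewrite C3. tauto.
           ++ intros z. cbn. rewrite C3. split.
              ** intros [<-|(Z1 & Z2 & Z3)]; auto.
              ** intros ([->|Z1] & Z2 & Z3); auto.
        -- exists ch. split; [eapply linked_ext; [exact Hnx|exact C1]|]. split; [exact C2|].
           intros z. rewrite C3. cbn. split; [tauto|]. intros ([->|Z1] & Z2 & Z3); [|auto].
           exfalso. apply Hyv. symmetry. exact Z3.
    + assert (Et1 : ar h aTag u <> 1) by (destruct (Nat.eqb_spec (ar h aTag u) 1); [discriminate|auto]).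
      assert (Hroot : hvf u = u /\ sdf u = 2).
      { unfold hvf, sdf. destruct (rl u); cbn in Hru; auto. lia. }
      destruct Hroot as [Hr1 Hr2].
      w_seq; w_sto; red1; try lia.
      w_sto; [red1; lia|red1; lia|lia|red1; lia|].
      match goal with |- context [seta ?h0 11 ?i ?e] => set (h5 := seta h0 11 i e) end.
      assert (A5 : forall a, a <> aHv -> a <> aSd -> ar h5 a = ar h1 a).
      { intros a H9 H11. unfold h5. red1. destruct (Nat.eqb_spec a 11); [tauto|]. destruct (Nat.eqb_spec a 9); [tauto|reflexivity]. }
      assert (Hne : forall y, In y rs -> y <> u) by (intros y Hy ->; tauto).
      exists dn, (u :: rs). split; [exact E|]. split; [reflexivity|]. split; [exact Em|].
      split; [change (tk h5) with (S (tk h1)); cbn [length]; lia|].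
      rewrite !(A5 aLt), !(A5 aEta), !(A5 aLng), !(A5 aHd), !(A5 aNxt) by lia.
      split; [|split; [|split; [|split; [|split; [|split]]]]].
      * intros a Ha. rewrite A5 by (intros ->; cbn in Ha; tauto). now apply A1.
      * intros y [<-|Hy].
        -- unfold h5. red1. unfold update. rewrite Nat.eqb_refl. repeat split; auto. lia.
        -- pose proof (Hne y Hy). unfold h5. red1. unfold update. destruct (Nat.eqb_spec y u); [tauto|].
           now apply I1.
      * intros y [<-|Hy] Hy2; [lia|now apply I2].
      * intros y z Hz Ey. destruct (I3 y z Hz Ey) as (J1 & J2 & J3 & J4). split; [now right|auto].
      * exact I4.
      * intros y Hy. cbn [length]. specialize (I5 y Hy). lia.
      * intros y Hy. destruct (I6 y Hy) as (ch & C1 & C2 & C3). exists ch. split; [exact C1|]. split; [exact C2|].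
        intros z. rewrite C3. cbn. split; [tauto|]. intros ([<-|Z1] & Z2 & Z3); [lia|auto].
  - intros h1 (dn & rs & E & Ei & Em & Et & A1 & I1 & I2 & I3 & I4 & I5 & I6). red1. rewrite Ei. intros H0.
    destruct dn; [|cbn in H0; lia]. cbn [app] in E. subst rs.
    apply HQ with (eta := ar h1 aEta) (lng := ar h1 aLng) (hd := ar h1 aHd) (nxt := ar h1 aNxt); auto.
    + constructor; auto.
      * intros u Hu Hsd. unfold sdf, hvf in *. destruct (rl u); auto. destruct (_ <? _); lia.
      * intros u Hu Hsd. destruct (in_split _ _ Hu) as (d1 & d2 & E).
        destruct (forest_ord d1 u d2 E Hsd) as [Hv Hl].
        assert (Hsub : forall y, In y d1 -> In y O) by (intros y Hy; rewrite E; apply in_app_iff; auto).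
        split; [auto|]. split; [auto|]. specialize (I2 u Hu Hsd).
        destruct (sdf_pair u Hsd) as (b & c & Er). pose proof (Hpair u b c Hu Er) as Hp.
        unfold hvf, ltf in *. rewrite Er in *. destruct (Nat.ltb_spec (ln b) (ln c)); lia.
      * intros d1 u d2 E Hsd. now apply (forest_ord d1 u d2).
    + constructor; auto.
      * intros i Hi. rewrite A1 by (cbn; lia). auto.
      * intros u Hu. rewrite A1 by (cbn; lia). auto.
      * intros u Hu. now apply I1.
      * intros u Hu. now apply I1.
      * intros u Hu. now apply I1.
Qed.
End ForestPhase.

(** * Expansions of the input grammar *)

Lemma flat_map_repeat {X Y} (f : X -> list Y) x k : flat_map f (repeat x k) = concat (repeat (f x) k).
Proof. induction k as [|k IH]; [reflexivity|]. cbn. now rewrite IH. Qed.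

Lemma length_concat_repeat {X} (l : list X) k : length (concat (repeat l k)) = length l * k.
Proof. induction k as [|k IH]; cbn; [lia|]. rewrite length_app, IH. lia. Qed.

Lemma parse_det Gr i t t' : parse Gr i t -> parse Gr i t' -> t = t'.
Proof.
  intros H. revert t'. induction H as [i a Hi|i b c t u Hi Hb IHb Hc IHc|i b k t Hi Hb IHb]; intros t' H';
    inversion H' as [i' a' Hi'|i' b' c' t1 u1 Hi' Hb' Hc'|i' b' k' t1 Hi' Hb']; subst; rewrite Hi in Hi'; try discriminate.
  - now injection Hi' as ->.
  - injection Hi' as -> ->. f_equal. f_equal; [now apply IHb|]. f_equal. now apply IHc.
  - injection Hi' as -> ->. f_equal. f_equal. now apply IHb.
Qed.

Lemma expands_det Gr i x y : expands Gr i x -> expands Gr i y -> x = y.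
Proof. intros (t & Ht & <-) (u & Hu & <-). now rewrite (parse_det Gr i t u). Qed.

Lemma expands_lt Gr i x : expands Gr i x -> i < size Gr.
Proof.
  intros (t & Ht & _). unfold size. apply nth_error_Some. destruct Ht; congruence.
Qed.

(** Turns the expansions promised by [rlslp] into a function of the nonterminal, by induction on
    their number. *)
Lemma finite_choice {X} (P : nat -> X -> Prop) (d : X) n :
  (forall i, i < n -> exists x, P i x) -> exists f, forall i, i < n -> P i (f i).
Proof.
  induction n as [|n IH]; intros H; [exists (fun _ => d); lia|].
  destruct IH as [f Hf]; [intros; apply H; lia|]. destruct (H n ltac:(lia)) as [x Hx].
  exists (fun i => if i =? n then x else f i). intros i Hi.
  destruct (Nat.eqb_spec i n) as [->|]; [exact Hx|apply Hf; lia].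
Qed.

Section Input.
Variable Gr : grammar.
Variable E : nat -> list nat.
Hypothesis Hgr : rlslp Gr.
Hypothesis HE : forall i, i < size Gr -> expands Gr i (E i).

Definition rule_of (i : nat) : rule := nth i (rules Gr) (Term 0).

Lemma rule_of_nth i : i < size Gr -> nth_error (rules Gr) i = Some (rule_of i).
Proof. apply nth_error_nth'. Qed.

Lemma E_expand u : u < size Gr ->
  (forall x, child (rule_of u) x -> x < size Gr) /\
  match rule_of u with
  | Term a => E u = [a]
  | Pair b c => E u = E b ++ E c
  | Run b k => 2 < k /\ E u = concat (repeat (E b) k)
  end.
Proof.
  intros Hu. pose proof (rule_of_nth u Hu) as Hn. destruct (HE u Hu) as (t & Ht & Hy).
  destruct Ht as [u a Hi|u b c t t' Hi Hb Hc|u b k t Hi Hb]; rewrite Hi in Hn; injection Hn as <-; cbn.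
  - split; [easy|]. now rewrite <- Hy.
  - assert (Eb : expands Gr b (yield t)) by (exists t; auto).
    assert (Ec : expands Gr c (yield t')) by (exists t'; auto).
    pose proof (expands_lt _ _ _ Eb). pose proof (expands_lt _ _ _ Ec). split; [intros x [->| ->]; auto|].
    rewrite (expands_det Gr b (E b) (yield t)), (expands_det Gr c (E c) (yield t')); auto.
    rewrite <- Hy. cbn. now rewrite app_nil_r.
  - assert (Eb : expands Gr b (yield t)) by (exists t; auto).
    pose proof (expands_lt _ _ _ Eb). split; [intros x ->; auto|]. split.
    + destruct Hgr as (_ & Hk & _). eapply Hk; eauto.
    + rewrite (expands_det Gr b (E b) (yield t)); auto. rewrite <- Hy. cbn. apply flat_map_repeat.
Qed.

Lemma E_pos u : u < size Gr -> 0 < length (E u).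
Proof.
  intros Hu. destruct (HE u Hu) as (t & Ht & <-). clear Hu.
  induction Ht as [u a Hi|u b c t t' Hi Hb IHb Hc IHc|u b k t Hi Hb IHb]; cbn.
  - lia.
  - rewrite length_app. lia.
  - rewrite flat_map_repeat, length_concat_repeat.
    destruct Hgr as (_ & Hk & _). specialize (Hk _ _ _ Hi). nia.
Qed.

Lemma length_expand u : u < size Gr ->
  (forall x, child (rule_of u) x -> x < size Gr) /\
  match rule_of u with
  | Term _ => length (E u) = 1
  | Pair b c => length (E u) = length (E b) + length (E c)
  | Run b k => 2 < k /\ length (E u) = length (E b) * k
  end.
Proof.
  intros Hu. destruct (E_expand u Hu) as [H1 H2]. split; [exact H1|].
  destruct (rule_of u) as [a|b c|b k].
  - now rewrite H2.
  - now rewrite H2, length_app.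
  - destruct H2 as [H2 ->]. split; [exact H2|apply length_concat_repeat].
Qed.
End Input.

(** * Correctness and balance of the output grammar *)

Section Output.
Variable Gr : grammar.
Variable E : nat -> list nat.
Hypothesis Hgr : rlslp Gr.
Hypothesis HE : forall i, i < size Gr -> expands Gr i (E i).
Notation n := (size Gr).
Notation st := (start Gr).
Notation rl := (rule_of Gr).
Variable ln : nat -> nat.
Variable O : list nat.
Hypothesis Hln : forall u, In u O -> ln u = length (E u).
Hypothesis Hln0 : forall u, u < n -> 0 < ln u -> In u O.
Notation hv := (hvf ln rl).
Notation lt := (ltf ln rl).
Notation sd := (sdf ln rl).
Variables eta lng hd nxt : nat -> nat.
Hypothesis Hfo : forest n st ln (ln st) O hv lt sd eta lng hd nxt.
Hypothesis Hclosed : closed rl O.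
Variable h : astate.
Hypothesis Hgood : good n ln h.
Hypothesis Hroot : forall u, In u O -> sd u = 2 -> root_done rl h u.
Hypothesis Hpair : forall u, In u O -> sd u < 2 -> pair_done n ln O hv lt sd h u.
Hypothesis Hzero : forall j, j <= n -> (forall u, In u O -> j <> S u) -> rule_out h j 0 0 0.
Notation no := (vr h rNo).

Definition out_rule (i : nat) : rule :=
  match ar h oTag i with
  | 0 => Term (ar h oFst i)
  | 1 => Pair (ar h oFst i) (ar h oSnd i)
  | _ => Run (ar h oFst i) (ar h oSnd i)
  end.

Definition out : grammar := Grammar (map out_rule (seq 0 no)) (S st).

Lemma out_size : size out = no.
Proof. unfold size, out. cbn. now rewrite length_map, length_seq. Qed.

Lemma out_nth i : i < no -> nth_error (rules out) i = Some (out_rule i).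
Proof.
  intros Hi. unfold out; cbn [rules]. rewrite nth_error_map.
  rewrite (nth_error_nth' (seq 0 no) 0) by (rewrite length_seq; lia). rewrite seq_nth by lia. reflexivity.
Qed.

Definition parsed (b u : nat) : Prop :=
  exists t, parse out (S u) t /\ yield t = E u /\ height t <= b.

Lemma un_parsed d id x hx :
  un n ln d (ar h oTag) (ar h oFst) (ar h oSnd) id x hx -> id < no ->
  (forall u, In u x -> parsed (bd ln u) u) ->
  exists t, parse out id t /\ yield t = concat (map E (if d then x else rev x)) /\ height t <= hx.
Proof.
  intros Hu. induction Hu as [A HA HA'|id x y hx hy H1 H2 H3 H4 H5 IH5 H6 IH6]; intros Hid Hx.
  - destruct (Hx A (or_introl eq_refl)) as (t & T1 & T2 & T3). exists t. split; [exact T1|]. split; [|exact T3].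
    rewrite T2. destruct d; cbn; now rewrite app_nil_r.
  - destruct IH5 as (t & T1 & T2 & T3); [lia|intros; apply Hx, in_app_iff; auto|].
    destruct IH6 as (t' & T1' & T2' & T3'); [lia|intros; apply Hx, in_app_iff; auto|].
    pose proof (out_nth id Hid) as Hr. unfold out_rule in Hr. rewrite H2 in Hr.
    destruct d.
    + exists (Node id [t; t']). split; [eapply parse_pair; eauto|]. split.
      * cbn. rewrite app_nil_r, map_app, concat_app. congruence.
      * cbn. lia.
    + exists (Node id [t'; t]). split; [eapply parse_pair; eauto|]. split.
      * cbn. rewrite app_nil_r, rev_app_distr, map_app, concat_app. congruence.
      * cbn. lia.
Qed.

Lemma lets_letters d u ls x : lets hv lt sd d u ls -> In u O -> In x ls -> In x O /\ ln x < ln u.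
Proof.
  induction 1 as [u Hu|u ls Hu Hl IH]; intros HO Hx; [easy|].
  destruct (fo_pair Hfo u HO Hu) as (H1 & H2 & H3 & H4 & _).
  pose proof (fo_ln Hfo _ H1). pose proof (fo_ln Hfo _ H2).
  apply in_app_iff in Hx as [Hx|Hx].
  - destruct (IH H2 Hx). split; [assumption|lia].
  - destruct (_ =? _); [|easy]. destruct Hx as [<-|[]]. split; [exact H1|lia].
Qed.

(** Induction along the path to the root, where each step adds the letter [lt u] on the outside. The
    strict inequality lets an induction on lengths reach [r]; the nonempty context ensures that the
    rule of a proper node has two genuine children. *)
Lemma E_split u r x1 x2 : root_of hv sd u r -> In u O ->
  lets hv lt sd false u x1 -> lets hv lt sd true u x2 ->
  sd r = 2 /\ ln r <= ln u /\ (sd u < 2 -> ln r < ln u) /\ (sd u < 2 -> x1 <> [] \/ x2 <> []) /\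
  E u = concat (map E (rev x1)) ++ E r ++ concat (map E x2).
Proof.
  intros Hr. revert x1 x2. induction Hr as [u Hu|u r Hu Hr IH]; intros x1 x2 HO H1 H2.
  - inversion H1; subst; [|lia]. inversion H2; subst; [|lia]. cbn. rewrite app_nil_r.
    repeat split; auto; lia.
  - inversion H1 as [|? ls1 _ L1]; subst; [lia|]. inversion H2 as [|? ls2 _ L2]; subst; [lia|].
    destruct (fo_pair Hfo u HO Hu) as (P1 & P2 & P3 & P4 & _).
    pose proof (fo_ln Hfo _ P1).
    destruct (IH ls1 ls2 P2 L1 L2) as (Q1 & Q2 & _ & _ & Q5).
    split; [exact Q1|]. split; [lia|]. split; [lia|].
    destruct (sdf_pair ln rl u Hu) as (b & c & Er).
    destruct (E_expand Gr E Hgr HE u (fo_n Hfo u HO)) as [_ HEu]. rewrite Er in HEu.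
    assert (Hcase : sd u = 0 /\ E u = E (lt u) ++ E (hv u) \/ sd u = 1 /\ E u = E (hv u) ++ E (lt u)).
    { unfold hvf, ltf, sdf. rewrite Er. destruct (_ <? _); auto. }
    destruct Hcase as [[Es Eu]|[Es Eu]]; rewrite Es; cbn [Nat.eqb Nat.b2n].
    + split; [intros _; left; now destruct ls1|]. rewrite Eu, Q5, rev_app_distr, !app_nil_r. cbn. now rewrite !app_assoc.
    + split; [intros _; right; now destruct ls2|]. rewrite Eu, Q5, !app_nil_r, map_app, concat_app. cbn.
      now rewrite app_nil_r, !app_assoc.
Qed.

Lemma full_parsed d u id x : full_le n ln hv lt sd d h u id x -> In u O ->
  (forall y, In y O -> ln y < ln u -> parsed (bd ln y) y) -> id <> 0 ->
  exists t, parse out id t /\ yield t = concat (map E (if d then x else rev x)) /\ height t <= 10 * lam (ln u) + 5.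
Proof.
  intros [Hl [[? _]|(hx & Hx & Hu & Hi)]] HO IH Hid; [lia|].
  destruct (un_parsed d id x hx Hu Hi) as (t & T1 & T2 & T3).
  - intros y Hy. destruct (lets_letters d u x y Hl HO Hy). now apply IH.
  - exists t. split; [exact T1|]. split; [exact T2|]. lia.
Qed.

Lemma out_tag i a b c : i < no -> rule_out h i a b c ->
  nth_error (rules out) i = Some (match a with 0 => Term b | 1 => Pair b c | _ => Run b c end).
Proof. intros Hi (H1 & H2 & H3). rewrite out_nth by exact Hi. unfold out_rule. now rewrite H1, H2, H3. Qed.

(* A root [r] may end up two levels below nodes [u] with [lam (ln u) = lam (ln r)]; hence the slack of 2. *)
Lemma all_parsed u : In u O -> parsed (bd ln u - if sd u =? 2 then 2 else 0) u.
Proof.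
  remember (ln u) as s eqn:Es. revert u Es. induction s as [s IH] using lt_wf_ind. intros u -> HO.
  assert (IH' : forall y, In y O -> ln y < ln u -> parsed (bd ln y) y).
  { intros y Hy Hyu. destruct (IH (ln y) Hyu y eq_refl Hy) as (t & T1 & T2 & T3). exists t.
    split; [exact T1|]. split; [exact T2|lia]. }
  destruct Hgood as [Hno _]. pose proof (fo_n Hfo u HO) as Hun.
  pose proof (fo_ln Hfo u HO) as Hlu.
  destruct (E_expand Gr E Hgr HE u Hun) as [_ HEu].
  destruct (Nat.lt_ge_cases (sd u) 2) as [Hs|Hs].
  - destruct (Hpair u HO Hs) as (r & id1 & x1 & id2 & x2 & R & HrO & F1 & F2 & D).
    destruct (E_split u r x1 x2 R HO (proj1 F1) (proj1 F2)) as (S1 & _ & S3 & S4 & S5).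
    specialize (S3 Hs). specialize (S4 Hs).
    destruct (IH (ln r) S3 r eq_refl HrO) as (tr & R1 & R2 & R3). rewrite S1, Nat.eqb_refl in R3.
    replace (sd u =? 2) with false by (symmetry; apply Nat.eqb_neq; lia).
    assert (Hrl : lam (ln r) <= lam (ln u)) by (apply lam_le; lia). unfold bd in *.
    assert (N1 : id1 = 0 -> x1 = []).
    { intros ->. destruct F1 as [_ [[_ X]|(hx & _ & X & _)]]; [exact X|]. apply un_pos in X. lia. }
    assert (N2 : id2 = 0 -> x2 = []).
    { intros ->. destruct F2 as [_ [[_ X]|(hx & _ & X & _)]]; [exact X|]. apply un_pos in X. lia. }
    destruct D as [(D1 & D2)|[(D1 & D2)|(Z1 & Z2 & q & Q1 & Q2 & Q3)]].
    + destruct (full_parsed true u id2 x2 F2 HO IH') as (t & T1 & T2 & T3); [intros X; destruct S4; auto|].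
      exists (Node (S u) [tr; t]). split; [|split].
      * eapply parse_pair; [apply (out_tag _ 1); [lia|exact D2]|exact R1|exact T1].
      * cbn. rewrite app_nil_r, R2, T2, S5, (N1 D1). reflexivity.
      * cbn. lia.
    + destruct (full_parsed false u id1 x1 F1 HO IH') as (t & T1 & T2 & T3); [intros X; destruct S4; auto|].
      exists (Node (S u) [t; tr]). split; [|split].
      * eapply parse_pair; [apply (out_tag _ 1); [lia|exact D2]|exact T1|exact R1].
      * cbn. rewrite app_nil_r, R2, T2, S5, (N2 D1). cbn. now rewrite app_nil_r.
      * cbn. lia.
    + destruct (full_parsed false u id1 x1 F1 HO IH' Z1) as (t1 & T1 & T2 & T3).
      destruct (full_parsed true u id2 x2 F2 HO IH' Z2) as (t2 & U1 & U2 & U3).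
      exists (Node (S u) [t1; Node q [tr; t2]]). split; [|split].
      * eapply parse_pair; [apply (out_tag _ 1); [lia|exact Q2]|exact T1|].
        eapply parse_pair; [apply (out_tag _ 1); [lia|exact Q3]|exact R1|exact U1].
      * cbn. rewrite !app_nil_r, R2, T2, U2, S5. reflexivity.
      * cbn. lia.
  - destruct (fo_root Hfo u HO ltac:(lia)) as [Hs2 _].
    pose proof (Hroot u HO Hs2) as D. unfold root_done in D. rewrite Hs2, Nat.eqb_refl. unfold bd.
    destruct (rl u) as [a|b c|b k] eqn:Er; [| |].
    + exists (Node (S u) [Leaf a]). split; [|split].
      * apply parse_term. apply (out_tag _ 0 a 0); [lia|exact D].
      * cbn. auto.
      * cbn. lia.
    + easy.
    + destruct HEu as [Hk HEu]. apply in_split in HO as HO'. destruct HO' as (d1 & d2 & EO).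
      assert (HbO : In b O).
      { rewrite EO. apply in_app_iff. left. apply (Hclosed d1 u d2 EO). now rewrite Er. }
      assert (Elb : ln u = ln b * k).
      { rewrite (Hln u HO), (Hln b HbO), HEu. apply length_concat_repeat. }
      pose proof (fo_ln Hfo b HbO) as Hlb.
      destruct (IH (ln b) ltac:(nia) b eq_refl HbO) as (t & T1 & T2 & T3).
      assert (Hlam : lam (ln b) + 8 <= lam (ln u)).
      { apply lam_double; [lia|]. rewrite Elb. nia. }
      exists (Node (S u) (repeat t k)). split; [|split].
      * apply parse_run with (B := S b); [|exact T1]. apply (out_tag _ 2); [lia|exact D].
      * cbn. rewrite flat_map_repeat, T2. now rewrite HEu.
      * cbn. unfold bd in T3.
        assert (list_max (map height (repeat t k)) <= 10 * lam (ln b) + 10); [|lia].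
        apply list_max_le, Forall_map, Forall_forall. intros t' Ht. apply repeat_spec in Ht as ->. lia.
Qed.

Lemma sz_yield x : (forall u, In u x -> In u O) -> length (concat (map E x)) = sz ln x.
Proof.
  induction x as [|u x IH]; intros Hx; [reflexivity|]. cbn. rewrite length_app, IH by (intros; apply Hx; now right).
  rewrite <- Hln by (apply Hx; now left). reflexivity.
Qed.

Lemma un_letters d K B C id x hx : un n ln d K B C id x hx -> forall u, In u x -> In u O.
Proof.
  induction 1 as [A HA HA'|id x y hx hy H1 H2 H3 H4 H5 IH5 H6 IH6]; intros u Hu.
  - destruct Hu as [<-|[]]. auto.
  - apply in_app_iff in Hu as [Hu|Hu]; auto.
Qed.

Lemma out_cases id : id <= n -> (exists u, In u O /\ id = S u) \/ forall u, In u O -> id <> S u.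
Proof.
  intros Hid. destruct id as [|u]; [right; easy|].
  destruct (in_dec Nat.eq_dec u O) as [H|H]; [left; eauto|]. right. now intros y Hy [= ->].
Qed.

(** Three kinds of nonterminals: images of reached ones, placeholders, and auxiliary products, whose
    granted leaf heights are now justified by [all_parsed]. *)
Lemma out_parse id : id < no -> exists t, parse out id t /\ height t <= 11 * lam (length (yield t)) + 16.
Proof.
  intros Hid. destruct Hgood as [Hno Hun]. destruct (Nat.le_gt_cases id n) as [Hn|Hn].
  - destruct (out_cases id Hn) as [(u & Hu & ->)|Hc].
    + destruct (all_parsed u Hu) as (t & T1 & T2 & T3). exists t. split; [exact T1|].
      rewrite T2, <- Hln by exact Hu. unfold bd in T3. lia.
    + exists (Node id [Leaf 0]). split; [|cbn; lia]. apply parse_term.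
      apply (out_tag id 0 0 0 Hid). now apply Hzero.
  - destruct (Hun id ltac:(lia)) as (d & x & hx & U & B). pose proof (un_letters _ _ _ _ _ _ _ U) as HxO.
    destruct (un_parsed d id x hx U Hid) as (t & T1 & T2 & T3).
    { intros u Hu. destruct (all_parsed u (HxO u Hu)) as (t & T1 & T2 & T3). exists t.
      split; [exact T1|]. split; [exact T2|lia]. }
    exists t. split; [exact T1|]. rewrite T2, sz_yield by (intros u Hu; apply HxO; destruct d; [auto|now apply in_rev]).
    replace (sz ln (if d then x else rev x)) with (sz ln x); [unfold gd in B; lia|].
    destruct d; [reflexivity|]. unfold sz. rewrite map_rev. apply Permutation_list_sum,  Permutation_rev.
Qed.

(** Needed to decode the table: [stores] demands a zero third word for a terminal rule, and [rlslp]
    an exponent above 2 for a run. *)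
Lemma out_shape id : id < no ->
  ar h oTag id = 0 /\ ar h oSnd id = 0 \/ ar h oTag id = 1 \/ ar h oTag id = 2 /\ 2 < ar h oSnd id.
Proof.
  intros Hid. destruct Hgood as [Hno Hun]. destruct (Nat.le_gt_cases id n) as [Hn|Hn].
  - destruct (out_cases id Hn) as [(u & Hu & ->)|Hc].
    + destruct (Nat.lt_ge_cases (sd u) 2) as [Hs|Hs].
      * destruct (Hpair u Hu Hs) as (r & id1 & x1 & id2 & x2 & _ & _ & _ & _ & D).
        right. left. destruct D as [(_ & D)|[(_ & D)|(_ & _ & q & _ & D & _)]]; apply D.
      * destruct (fo_root Hfo u Hu ltac:(lia)) as [Hs2 _].
        pose proof (Hroot u Hu Hs2) as D. unfold root_done in D.
        destruct (E_expand Gr E Hgr HE u (fo_n Hfo u Hu)) as [_ HEu].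
        destruct (rl u) as [a|b c|b k]; [|easy|]; destruct D as (D1 & D2 & D3); rewrite D1, D3; auto.
        right. right. split; [reflexivity|apply HEu].
    + destruct (Hzero id Hn Hc) as (D & _ & D'). auto.
  - destruct (Hun id ltac:(lia)) as (d & x & hx & U & _).
    destruct U as [A HA _|id x y hx hy _ H2 _ _ _ _]; [lia|]. auto.
Qed.

Lemma out_run id b k : nth_error (rules out) id = Some (Run b k) -> 2 < k.
Proof.
  intros R. assert (Hid : id < no).
  { rewrite <- out_size. apply nth_error_Some. congruence. }
  rewrite out_nth in R by exact Hid. injection R as R. unfold out_rule in R.
  destruct (out_shape id Hid) as [(D & _)|[D|(D & D')]]; rewrite D in R; [easy|easy|]. now injection R as _ <-.
Qed.

Lemma out_rlslp : st < n -> rlslp out.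
Proof.
  intros Hst. split; [|split].
  - rewrite out_size. cbn [start out]. destruct Hgood. lia.
  - exact out_run.
  - intros A HA. rewrite out_size in HA. destruct (out_parse A HA) as (t & Ht & _). exists (yield t). now exists t.
Qed.

Lemma out_generates : generates out (E st).
Proof.
  destruct (fo_st Hfo) as [HO _].
  destruct (all_parsed st HO) as (t & T1 & T2 & _). now exists t.
Qed.

Lemma out_height A t : parse out A t -> height t <= 11 * lam (length (yield t)) + 16.
Proof.
  intros Ht. assert (HA : A < no).
  { rewrite <- out_size. apply (expands_lt _ _ (yield t)). now exists t. }
  destruct (out_parse A HA) as (t' & T1 & T2). now rewrite (parse_det _ _ _ _ Ht T1).
Qed.
End Output.

(** * Real logarithms and the whole program *)

Lemma lam_log s : (INR (lam s) <= 8 * log (INR s))%R.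
Proof.
  unfold log. destruct (Nat.eq_dec s 0) as [->|Hs].
  { cbn [lam Nat.pow Nat.mul Nat.log2 Nat.log2_iter INR]. pose proof (Rmax_l 1 (ln (INR 0) / ln 2)). cbn in *. lra. }
  eapply Rle_trans; [|apply Rmult_le_compat_l; [lra|apply Rmax_r]].
  unfold lam. assert (H : 2 ^ Nat.log2 (s ^ 8) <= s ^ 8).
  { apply Nat.log2_spec. assert (s ^ 8 <> 0) by (apply Nat.pow_nonzero; lia). lia. }
  apply le_INR in H. rewrite !pow_INR in H. change (INR 2) with 2%R in H.
  assert (Hs' : (0 < INR s)%R) by (apply lt_0_INR; lia).
  assert (H2 : (0 < ln 2)%R) by (rewrite <- ln_1; apply ln_increasing; lra).
  assert (Hl : (ln (2 ^ Nat.log2 (s ^ 8)) <= ln (INR s ^ 8))%R).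
  { destruct H as [H| ->]; [|apply Rle_refl]. left. apply ln_increasing; [apply pow_lt; lra|exact H]. }
  rewrite !ln_pow in Hl by lra. replace (INR 8) with 8%R in Hl by (cbn; lra).
  apply Rmult_le_reg_r with (ln 2); [exact H2|].
  replace (8 * (ln (INR s) / ln 2) * ln 2)%R with (8 * ln (INR s))%R by (field; lra). exact Hl.
Qed.

Section Main.
Variables w cap : nat.
Variable Gr : grammar.
Variable E : nat -> list nat.
Hypothesis Hgr : rlslp Gr.
Hypothesis HE : forall i, i < size Gr -> expands Gr i (E i).
Notation n := (size Gr).
Notation st := (start Gr).
Notation lim := (lim cap n).
Hypothesis Hcap : 1000 <= cap.
Hypothesis Hw : 30 * lim <= 2 ^ w.
Hypothesis Hlen : 4 * length (E st) + 1 < 2 ^ w.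

(** Per input rule, the iterations are 1 for clearing, at most 3 for the search, 1 for the forest,
    60 for each pass and 1 for assembling. Numbering starts at [n + 1]; each pass adds at most
    [60 * n] rules and assembling at most [n]. *)
Lemma wp_core h :
  (forall u, u < n -> rule_in h u (rule_of Gr u)) ->
  wp w cap n st (core cap) h (fun h' => tk h' <= tk h + 126 * n /\
    vr h' rNo <= 122 * n + 1 /\
    rlslp (out Gr h') /\ generates (out Gr h') (E st) /\
    (forall i, i < vr h' rNo -> ar h' oTag i = 0 /\ ar h' oSnd i = 0 \/ ar h' oTag i = 1 \/ ar h' oTag i = 2) /\
    (forall i t, parse (out Gr h') i t -> height t <= 11 * lam (length (yield t)) + 16)).
Proof.
  intros Hin. destruct Hgr as (Hst & _).
  assert (Hbig : 1000 * n <= lim) by (apply Nat.mul_le_mono_r; exact Hcap).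
  assert (Hfits : fits w cap n) by (split; lia).
  assert (Hn : 200 * n + 200 <= lim) by lia.
  pose (L u := length (E u)).
  assert (HL : forall u, u < n -> (forall x, child (rule_of Gr u) x -> x < n) /\
    match rule_of Gr u with
    | Term _ => L u = 1
    | Pair b c => L u = L b + L c
    | Run b k => 2 < k /\ L u = L b * k
    end) by (intros; now apply length_expand).
  assert (HL0 : forall u, u < n -> 0 < L u) by (intros; now apply (E_pos Gr E)).
  unfold core. apply wp_seq, (wp_clear w cap n st); auto.
  intros h1 T1 Z1 O1 A1. apply wp_seq, (wp_search w cap n st L (rule_of Gr)); auto.
  - unfold L. lia.
  - intros u Hu. specialize (Hin u Hu). unfold rule_in in *. now rewrite !A1 by lia.
  - intros u Hu. now apply Z1.
  - intros h2 l S2 Hst2 T2 A2.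
    assert (R2 : forall u, u < n -> rule_in h2 u (rule_of Gr u)).
    { intros u Hu. specialize (Hin u Hu). unfold rule_in in *. now rewrite !A2, !A1 by (cbn; lia). }
    (* nonterminals that the start symbol does not reach get length 0 *)
    pose (ln := ar h2 aLen).
    assert (HlL : forall u, In u l -> ln u = L u) by (apply (se_in S2)).
    assert (Hln : forall u, In u l -> u < n) by (intros; now apply (se_n S2)).
    assert (Hl0 : forall u, u < n -> 0 < ln u -> In u l).
    { intros u Hu Hp. destruct (in_dec Nat.eq_dec u l) as [|Hul]; [assumption|].
      unfold ln in Hp. rewrite (se_out S2 u Hu Hul) in Hp. lia. }
    assert (Hcl : closed (rule_of Gr) l) by (apply (se_closed S2)).
    assert (Hch : forall u x, In u l -> child (rule_of Gr u) x -> In x l).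
    { intros u x Hu Hx. apply in_split in Hu as (d1 & d2 & Eu). rewrite Eu. apply in_app_iff. left.
      now apply (Hcl d1 u d2). }
    apply wp_seq, (wp_forest w cap n st ln (rule_of Gr) l); auto.
    + apply (se_nodup S2).
    + intros u Hu. rewrite !HlL by auto. split; [auto|]. now apply (se_n S2).
    + intros u b c Hu Er. destruct (HL u (Hln u Hu)) as [_ Hu']. rewrite Er in Hu'.
      rewrite !HlL; auto; apply (Hch u); auto; rewrite Er; cbn; auto.
    + apply (se_m S2).
    + apply (se_ord S2).
    + intros u Hu. rewrite !A2 by (cbn; lia). now apply Z1.
    + intros h3 eta lng hd nxt Hfo Hlng0 Hs3 T3 A3.
      pose proof Hfits as [Hb Hw'].
      w_seq; w_asg; red1; [lia|].
      match goal with |- wp _ _ _ _ _ ?h0 _ => set (h4 := h0) end.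
      assert (G4 : good n ln h4).
      { split; [cbn; lia|]. intros id Hid. cbn in Hid. lia. }
      assert (Hz : 4 * ln st + 1 < 2 ^ w) by (rewrite HlL by exact Hst2; exact Hlen).
      w_seq. apply (wp_pass w cap n st ln (ln st)) with (O := l) (hv := hvf ln (rule_of Gr)) (lt := ltf ln (rule_of Gr))
        (sd := sdf ln (rule_of Gr)) (eta := eta) (lng := lng) (hd := hd) (nxt := nxt); auto.
      { destruct Hs3. now constructor. }
      { cbn. lia. }
      intros h5 S5 G5 Gr5 F5 T5 N5 A5. change (vr h4 rNo) with (n + 1) in N5. change (tk h4) with (tk h3) in T5.
      w_seq. apply (wp_pass w cap n st ln (ln st)) with (O := l) (hv := hvf ln (rule_of Gr)) (lt := ltf ln (rule_of Gr))
        (sd := sdf ln (rule_of Gr)) (eta := eta) (lng := lng) (hd := hd) (nxt := nxt); auto.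
      { lia. }
      intros h6 S6 G6 Gr6 F6 T6 N6 A6.
      assert (A46 : forall a, a < 3 \/ 6 <= a < 16 -> ar h6 a = ar h3 a).
      { intros a Ha. rewrite A6, A5 by (cbn; lia). reflexivity. }
      assert (Hll : length l <= n) by (apply NoDup_length_le; auto; apply (se_nodup S2)).
      apply (wp_assemble w cap n st ln (ln st)) with (O := l) (hv := hvf ln (rule_of Gr)) (lt := ltf ln (rule_of Gr))
        (sd := sdf ln (rule_of Gr)) (eta := eta) (lng := lng) (hd := hd) (nxt := nxt) (rl := rule_of Gr); auto.
      * intros u Hu Hsd. destruct (HL u (Hln u Hu)) as [Hc _]. unfold sdf in Hsd.
        destruct (rule_of Gr u) as [a|b c|b k]; [exact I|destruct (_ <? _); lia|now apply Hc].
      * apply (st_m S6).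
      * apply (st_ord S6).
      * intros u Hu. split; [now apply (st_sd S6)|now apply (st_hv S6)].
      * intros u Hu. specialize (R2 u (Hln u Hu)). unfold rule_in in *. now rewrite !A46, !A3 by (cbn; lia).
      * lia.
      * intros [|] u Hu; [exact (F6 u Hu)|]. destruct (F5 u Hu) as (x & X1 & X2). exists x. split; [exact X1|].
        cbn [Nat.b2n Nat.add] in *. rewrite A6 by (cbn; lia). eapply unit_le_mono; [exact Gr6| |exact X2]. lia.
      * intros j Hj. destruct Gr5 as [_ Gr5]. destruct Gr6 as [_ Gr6]. unfold rule_out.
        destruct G4 as [G4 _]. destruct G5 as [G5 _].
        destruct (Gr6 j ltac:(lia)) as (-> & -> & ->). destruct (Gr5 j ltac:(lia)) as (-> & -> & ->).
        change (ar h4) with (ar h3). rewrite !A3, !A2 by (cbn; lia). now apply O1.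
      * intros h7 G7 N7 T7 D7 D7' Z7.
        split; [lia|]. split; [lia|].
        split; [eapply out_rlslp; eauto|]. split; [eapply out_generates; eauto|].
        split; [|intros; eapply out_height; eauto].
        intros i Hi. edestruct out_shape as [X|[X|[X _]]]; eauto.
Qed.
End Main.

Lemma exec_main w cap n st s t s1 h :
  exec w (core cap) s t s1 -> rep cap n st h s1 -> 0 < cap -> 30 * lim cap n <= 2 ^ w -> 1000 <= lim cap n -> st < n ->
  exists s', exec w (main cap) s (t + 10) s' /\ reg s' 0 = 3 * lim cap n /\ reg s' 1 = vr h rNo /\
    reg s' 2 = S st /\ mem s' = mem s1.
Proof.
  intros He (R1 & R2 & R3 & _) Hcap Hw Hl Hst. unfold lim in *.
  eexists. split; [|split; [|split; [|split]]].
  (* The three assignments cost 4, 2 and 4. The output address is computed first, while register 1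
     still holds the number of input rules. *)
  - unfold main. replace (t + 10) with (t + (4 + (2 + 4))) by lia.
    eapply exec_seq; [exact He|]. repeat (eapply exec_seq; [apply exec_assign|]). apply exec_assign.
  - cbn [reg update Nat.eqb eval]. rewrite R1. unfold eval_op.
    rewrite (Nat.mod_small (3 * cap)) by nia. rewrite Nat.mod_small; nia.
  - cbn [reg update Nat.eqb eval Nat.add]. apply (R3 5).
  - cbn [reg update Nat.eqb eval]. rewrite R2. unfold eval_op. rewrite (Nat.mod_small 1) by lia.
    rewrite Nat.mod_small by nia. lia.
  - reflexivity.
Qed.

Theorem theorem4 :
  exists (P : cmd) (K C : nat) (c : R),
  forall (w : nat) (G : grammar) (S : list nat) (s : state),
    rlslp G ->
    generates G S ->
    word_state w s ->
    stores w s G ->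
    reg s 0 = 0 ->
    K * (size G + length S) <= 2 ^ w ->
    exists (t : nat) (s' : state) (G' : grammar),
      exec w P s t s' /\
      t <= C * size G /\
      stores w s' G' /\
      rlslp G' /\
      generates G' S /\
      locally_balanced c G' /\
      size G' <= C * size G.
Proof.
  (* Keeps the numeral opaque, so that it is not unfolded into successors. *)
  remember 1000 as cap eqn:Ecap.
  (* Since [size Gr >= 1], the factor 127 covers [1 + 126 * size Gr], and 200 covers both the last
     10 time units and the size [122 * size Gr + 1]. As [lam <= 8 * log] and [log >= 1], the bound
     [11 * lam + 16] is at most [104 * log]. *)
  exists (main cap), (30 * cap), (127 * weight (core cap) + 200), 104%R.
  intros w Gr x s Hgr Hx _ (_ & S1 & S2 & S3) S0 HK.
  destruct (finite_choice (expands Gr) [] (size Gr) (proj2 (proj2 Hgr))) as [E HE].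
  pose proof (proj1 Hgr) as Hst.
  assert (Ex : E (start Gr) = x) by (eapply expands_det; [now apply HE|exact Hx]).
  assert (Hlim : lim cap (size Gr) = cap * size Gr) by reflexivity.
  assert (Hw : 30 * lim cap (size Gr) <= 2 ^ w) by lia.
  pose (h := AState 0 (fun y => reg s (y + 3)) (fun a i => mem s (addr cap (size Gr) a i))).
  assert (Hrep : rep cap (size Gr) (start Gr) h s) by (repeat split; auto).
  assert (Hin : forall u, u < size Gr -> rule_in h u (rule_of Gr u)).
  { intros u Hu. specialize (S3 u (rule_of Gr u) (rule_of_nth Gr u Hu)). rewrite S0 in S3.
    assert (Ea : forall a, a < 3 -> ar h a u = mem s (0 + 3 * u + a)).
    { intros a Ha. unfold h, addr. cbn [ar]. rewrite Nat.div_small, Nat.mod_small by exact Ha. f_equal. lia. }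
    unfold rule_at, rule_in in *. rewrite !Ea by lia. rewrite Nat.add_0_r.
    destruct (rule_of Gr u); tauto. }
  destruct (wp_core w cap Gr E Hgr HE ltac:(lia) Hw ltac:(rewrite Ex; nia) h Hin s Hrep)
    as (t & s1 & h' & i & X & Ht & Hrep' & Hi & Htk & Hno & Q1 & Q2 & Q3 & Q4).
  rewrite Ex in Q2.
  destruct (exec_main w cap (size Gr) (start Gr) s t s1 h' X Hrep' ltac:(lia) Hw ltac:(nia) Hst)
    as (s' & X' & F0 & F1 & F2 & Fm).
  exists (t + 10), s', (out Gr h'). rewrite out_size. change (tk h) with 0 in *.
  split; [exact X'|]. split; [nia|]. split; [|split; [exact Q1|split; [exact Q2|split]]].
  - unfold stores. rewrite F0, F1, F2, out_size. split; [lia|]. split; [reflexivity|]. split; [reflexivity|].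
    intros j r Hr. assert (Hj : j < vr h' rNo).
    { rewrite <- out_size with (Gr := Gr). apply nth_error_Some. congruence. }
    rewrite out_nth in Hr by exact Hj. injection Hr as <-.
    destruct Hrep' as (_ & _ & _ & Hm).
    assert (Ea : forall a, a < 3 -> mem s' (3 * lim cap (size Gr) + 3 * j + a) = ar h' (3 + a) j).
    { intros a Ha. rewrite Fm, <- Hm by (lia). f_equal. unfold addr.
      destruct a as [|[|[|a]]]; [| | |lia]; cbn [Nat.add]; [change (3 / 3) with 1|change (4 / 3) with 1|change (5 / 3) with 1];
        [change (3 mod 3) with 0|change (4 mod 3) with 1|change (5 mod 3) with 2]; lia. }
    pose proof (Ea 0 ltac:(lia)) as E0. rewrite Nat.add_0_r in E0.
    pose proof (Ea 1 ltac:(lia)) as E1. pose proof (Ea 2 ltac:(lia)) as E2. cbn [Nat.add] in E0, E1, E2.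
    unfold rule_at, out_rule. destruct (Q3 j Hj) as [(D & D')|[D|D]]; rewrite D in *; auto.
    now rewrite D' in E2.
  - intros A t' Ht'. specialize (Q4 A t' Ht'). apply le_INR in Q4. rewrite plus_INR, mult_INR in Q4.
    pose proof (lam_log (length (yield t'))) as Hl.
    pose proof (Rmax_l 1 (ln (INR (length (yield t'))) / ln 2)) as H1. fold (log (INR (length (yield t')))) in H1.
    replace (INR 11) with 11%R in Q4 by (cbn; lra). replace (INR 16) with 16%R in Q4 by (cbn; lra). lra.
  - nia.
Qed.
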